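(* For every real $d$, there is a Monte Carlo algorithm which solves Directed Hamiltonicity restricted to digraphs of average outdegree at most $d$ in time $\mathcal{O}^*((2-2^{-d})^n)$ and polynomial space, where $n$ is the number of vertices.
   Context: Directed Hamiltonicity: given a directed graph, decide whether it has a directed Hamiltonian cycle (a simple directed cycle through all vertices). The average outdegree of $G$ is $|E(G)|/|V(G)|$. A Monte Carlo algorithm is a randomized algorithm with bounded error probability. $\mathcal{O}^*(f(n))$ means $f(n)\cdot n^{\mathcal{O}(1)}$. *)

(* Defs.v *)
From HB Require Import structures.
From mathcomp Require Import all_boot all_order all_algebra.
From mathcomp Require Import all_classical all_reals all_analysis.

Set Implicit Arguments.
Unset Strict Implicit.
Unset Printing Implicit Defensive.

Import Order.TTheory GRing.Theory Num.Theory.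
Import numFieldNormedType.Exports.

(* The machine model is a randomized random-access machine under the
   logarithmic cost criterion, programmed with structured control flow.  It
   simulates, and is simulated by, probabilistic Turing machines with
   polynomial overhead in space and, when the space used is polynomial in the
   number of vertices, an overhead polynomial in that number in time.  The
   bounds below are insensitive to such overheads.

   A memory is a sequence of natural numbers; cells beyond its end read as 0. *)

Inductive binop := OpAdd | OpSub | OpMul | OpDiv | OpMod.

Inductive expr :=
  | Const of nat
  | Deref of expr
  | Bin of binop & expr & expr.

Inductive prog :=
  | Skip
  | Assign of expr & expr
  | Flip of expr
  | Seq of prog & prog
  | Ite of expr & prog & prog
  | While of expr & prog.

Definition binop_eval (o : binop) : nat -> nat -> nat :=
  match o with
  | OpAdd => addn | OpSub => subn | OpMul => muln | OpDiv => divn | OpMod => modn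
  end.

Fixpoint expr_eval (m : seq nat) (e : expr) : nat :=
  match e with
  | Const k => k
  | Deref a => nth 0 m (expr_eval m a)
  | Bin o e1 e2 => binop_eval o (expr_eval m e1) (expr_eval m e2)
  end.

Definition bitlen (k : nat) : nat := (trunc_log 2 k).+1.

(* Every value occurring in an evaluation, whether an address, an operand or an
   intermediate result, is charged its length in binary. *)
Fixpoint expr_cost (m : seq nat) (e : expr) : nat :=
  bitlen (expr_eval m e) +
  match e with
  | Const _ => 0
  | Deref a => expr_cost m a
  | Bin _ e1 e2 => expr_cost m e1 + expr_cost m e2
  end.

(* [todo] is the control stack, whose size is bounded in terms of the program
   alone; [coins] is the unread part of a one-way tape of random bits. *)
Record config := Config {
  todo : seq prog;
  cells : seq nat;
  coins : seq bool
}.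

Definition halted (c : config) : bool := nilp (todo c).

Definition step (c : config) : config :=
  let: Config t m w := c in
  match t with
  | [::] => c
  | Skip :: t' => Config t' m w
  | Assign a e :: t' => Config t' (set_nth 0 m (expr_eval m a) (expr_eval m e)) w
  | Flip a :: t' =>
      Config t' (set_nth 0 m (expr_eval m a) (nat_of_bool (head false w))) (behead w)
  | Seq p q :: t' => Config (p :: q :: t') m w
  | Ite e p q :: t' => Config ((if expr_eval m e != 0 then p else q) :: t') m w
  | While e p :: t' =>
      Config (if expr_eval m e != 0 then p :: While e p :: t' else t') m w
  end.

Definition step_cost (c : config) : nat :=
  match todo c with
  | [::] => 0
  | Skip :: _ | Seq _ _ :: _ => 1
  | Assign a e :: _ => expr_cost (cells c) a + expr_cost (cells c) e
  | Flip a :: _ => (expr_cost (cells c) a).+1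
  | Ite e _ _ :: _ | While e _ :: _ => expr_cost (cells c) e
  end.

(* All cells up to the highest address ever written are charged.  Expressions
   have constant size, so their intermediate values are longer than the stored
   ones by at most a constant factor. *)
Definition space_used (c : config) : nat := \sum_(v <- cells c) (bitlen v).+1.

Definition config_at (P : prog) (input : seq nat) (w : seq bool) (i : nat) :=
  iter i step (Config [:: P] input w).

(* A nonhalting step costs at least 1, so a run of total cost at most [T] halts
   within [T] steps and reads at most [T] coins; halted configurations are
   fixed and cost 0. *)
Definition runs_within (P : prog) (input : seq nat) (w : seq bool)
    (T S : nat) : Prop :=
  [/\ halted (config_at P input w T),
      \sum_(i < T) step_cost (config_at P input w i) <= T &
      forall i, i <= T -> space_used (config_at P input w i) <= S].

Definition accepts (P : prog) (input : seq nat) (w : seq bool) (T : nat) : bool :=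
  halted (config_at P input w T) &&
  (nth 0 (cells (config_at P input w T)) 0 != 0).

Definition accept_prob (P : prog) (input : seq nat) (T : nat) : rat :=
  (#|[set w : T.-tuple bool | accepts P input w T]|%:R / 2%:R ^+ T)%R.

(* [P] solves the promise problem with instances satisfying [dom] and
   yes-instances [yes], with error probability at most 1/3 on every instance,
   and every run on an instance of size parameter [n] stays within time [T n]
   and space [S n], whatever the outcomes of the coin flips. *)
Definition monte_carlo_solves (I : Type) (size_of : I -> nat)
    (encode : I -> seq nat) (dom yes : I -> Prop)
    (P : prog) (T S : nat -> nat) : Prop :=
  forall x : I, dom x ->
    [/\ forall w : (T (size_of x)).-tuple bool,
          runs_within P (encode x) w (T (size_of x)) (S (size_of x)),
        yes x -> (2%:R / 3%:R <= accept_prob P (encode x) (T (size_of x)))%R &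
        ~ yes x -> (accept_prob P (encode x) (T (size_of x)) <= 1 / 3%:R)%R].

(* Loops are allowed and counted as arcs. *)
Record digraph := Digraph { nvert : nat; adj : rel 'I_nvert }.

Definition narcs (G : digraph) : nat :=
  #|[set p : 'I_(nvert G) * 'I_(nvert G) | adj p.1 p.2]|.

Definition avg_outdegree (R : realType) (G : digraph) : R :=
  ((narcs G)%:R / (nvert G)%:R)%R.

Definition avg_outdegree_le (R : realType) (d : R) (G : digraph) : Prop :=
  0 < nvert G /\ (avg_outdegree R G <= d)%R.

Definition hamiltonian (G : digraph) : Prop :=
  exists c : seq 'I_(nvert G), ucycle (@adj G) c /\ forall v, v \in c.

(* The number of vertices followed by the adjacency matrix in row-major order. *)
Definition digraph_code (G : digraph) : seq nat :=
  nvert G :: [seq nat_of_bool (adj u v) | u <- enum 'I_(nvert G),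
                                          v <- enum 'I_(nvert G)].

Definition directed_hamiltonicity_solves (R : realType) (d : R) :=
  monte_carlo_solves nvert digraph_code (avg_outdegree_le d) hamiltonian.

Local Open Scope classical_set_scope.
Local Open Scope ring_scope.

Definition bigOstar (R : realType) (T : nat -> nat) (f : nat -> R) : Prop :=
  exists k : nat,
    (fun n => (T n)%:R : R^o) =O_\oo (fun n => (f n * n%:R ^+ k) : R^o).

Definition polynomially_bounded (R : realType) (S : nat -> nat) : Prop :=
  exists k : nat,
    (fun n => (S n)%:R : R^o) =O_\oo (fun n => (n%:R ^+ k) : R^o).

(* Main.v *)
Require Import Defs.
From mathcomp Require Import all_boot all_order all_algebra.
From mathcomp Require Import fingroup perm.
From mathcomp Require Import all_classical all_reals all_analysis.
From mathcomp Require Import zify ring lra.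

(* Fix a vertex [s] and call [x_uw], for an arc [uw], a weight [y_w - c_uw] with
   [c_uw] an arbitrary bit.  By the multilinearity of the determinant in its
   rows, the Laplacian whose row [u] is [sum_w x_uw (e_u - [w <> s] e_w)] has
   determinant [sum_f det(1 - P_f) prod_u x_(u, f u)], over all maps [f] along
   arcs.  Summing over [y] in [{0,1}^n] with the signs [prod_w (2 y_w - 1)]
   leaves only the permutations [f], because each [sum_(y_w)] of
   [(2 y_w - 1) (y_w - c)] is 1 and that of [2 y_w - 1] is 0; and for a
   permutation [det(1 - P_f)] is 1 if [f] is an [n]-cycle and 0 otherwise.  So
   the signed sum of the [2^n] determinants counts the Hamiltonian cycles.

   A row [u] is 0 as soon as [y_w = c_uw] for all out-neighbours [w] of [u],
   which for random [c] has probability [2^-(outdeg u)], independently for all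
   [u].  The program enumerates [y] as a binary counter and skips the largest
   aligned block on which some row is known to vanish.  For a prefix of [y] the
   expected number of surviving values is [2^i prod_u (1 - 2^-(outdeg u))], over
   the rows [u] decided by the prefix.  If bits are attached to vertices
   greedily, a vertex always being chosen whose undecided rows have
   [sum_u 1 / outdeg u <= 1] (a cycle cover satisfies Hall's condition, hence one
   exists), then longer prefixes only have larger expectations, so that
   [O(n) 2^n prod_u (1 - 2^-(outdeg u))] blocks are visited on average, and two
   uses of the AM-GM inequality bound this by [O(n) (2 - 2^-d)^n].  The program
   stops after three times that many steps; by Markov's inequality this loses a
   Hamiltonian cycle with probability at most 1/3.

   All numbers are kept modulo a power of 2 larger than the number of
   permutations.  The determinant of [A] is the coefficient of [X^n] in
   [det(1 + X A)], computed without divisions by switching on the rows of [A]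
   one at a time. *)

Set Implicit Arguments.
Unset Strict Implicit.
Unset Printing Implicit Defensive.

Import Order.TTheory GRing.Theory Num.Theory.
Local Open Scope nat_scope.

(** * Runs of the machine *)

Section Runs.
Variables (Kc Sp : nat).

(** Exactly [k] nonhalting steps, each of cost at most [Kc], with every configuration, the last one
    included, occupying at most [Sp]. Uniform bounds per step let runs compose by adding their
    lengths. *)
Inductive run : nat -> config -> config -> Prop :=
  | run0 c : space_used c <= Sp -> run 0 c c
  | runS k c c' : todo c <> [::] -> step_cost c <= Kc -> space_used c <= Sp ->
      run k (step c) c' -> run k.+1 c c'.

Lemma run_trans k1 k2 c1 c2 c3 :
  run k1 c1 c2 -> run k2 c2 c3 -> run (k1 + k2) c1 c3.
Proof.
elim=> [c _ //|k c c' t0 hc hs _ IH h3].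
by rewrite addSn; apply: runS => //; apply: IH.
Qed.

Lemma run_iter k c c' : run k c c' -> iter k step c = c'.
Proof. by elim=> // j d d' _ _ _ _ <-; rewrite iterSr. Qed.

Lemma run_cost k c c' : run k c c' ->
  \sum_(i < k) step_cost (iter i step c) <= k * Kc.
Proof.
elim=> [d _|j d d' _ hc _ _ IH]; first by rewrite big_ord0.
rewrite big_ord_recl mulSn leq_add //.
by under eq_bigr => i _ do rewrite lift0 iterSr.
Qed.

Lemma run_space k c c' : run k c c' ->
  forall i, i <= k -> space_used (iter i step c) <= Sp.
Proof.
elim=> [d hd [|i]|j d d' _ _ hs _ IH [|i] //] //; rewrite ltnS => ij.
by rewrite iterSr; apply: IH.
Qed.

Lemma iter_step_halted i m w : iter i step (Config [::] m w) = Config [::] m w.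
Proof. by elim: i => //= i ->. Qed.

(** Halted configurations are fixed and cost nothing, so a halting run of [k] steps can be padded to
    any [T >= k * Kc]. *)
Lemma run_halts P input w T k m w' : 0 < Kc ->
  run k (Config [:: P] input w) (Config [::] m w') -> k * Kc <= T ->
  runs_within P input w T Sp /\ config_at P input w T = Config [::] m w'.
Proof.
move=> K0 r kT.
have kleT : k <= T by apply: leq_trans kT; rewrite leq_pmulr.
have end_ i : k <= i -> config_at P input w i = Config [::] m w'.
  move=> ki; rewrite /config_at -(subnK ki) iterD (run_iter r).
  exact: iter_step_halted.
split; last exact: end_.
split; first by rewrite end_.
- rewrite -(big_mkord xpredT (fun i => step_cost (config_at P input w i))).
  rewrite (@big_cat_nat _ _ _ k) //= big_mkord.
  rewrite [X in _ + X]big1_seq ?addn0; last first.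
    by move=> i /=; rewrite mem_index_iota => /andP[ki _]; rewrite end_.
  by apply: leq_trans kT; apply: run_cost r.
- move=> i iT; case: (leqP i k) => ik; first exact: run_space r _ ik.
  by rewrite end_ ?(ltnW ik)// -(run_iter r); apply: run_space r _ (leqnn _).
Qed.

End Runs.

(** * Cost of expressions *)

(** If cells and constants are at most [M], with [1 < M], the value of [e] is at most
    [M ^ expr_degree e]. A [Deref] has degree 1 whatever its address, as it returns a stored
    value. *)
Fixpoint expr_degree (e : expr) : nat :=
  match e with
  | Const _ | Deref _ => 1
  | Bin _ e1 e2 => expr_degree e1 + expr_degree e2
  end.

(** The degrees of all subexpressions are added up, which bounds the logarithmic cost in units of
    the word length. *)
Fixpoint expr_weight (e : expr) : nat :=
  expr_degree e +
  match e with
  | Const _ => 0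
  | Deref a => expr_weight a
  | Bin _ e1 e2 => expr_weight e1 + expr_weight e2
  end.

Fixpoint expr_consts_le (b : nat) (e : expr) : bool :=
  match e with
  | Const k => k <= b
  | Deref a => expr_consts_le b a
  | Bin _ e1 e2 => expr_consts_le b e1 && expr_consts_le b e2
  end.

Lemma expr_consts_leW b b' e :
  b <= b' -> expr_consts_le b e -> expr_consts_le b' e.
Proof.
move=> bb'; elim: e => //= [k kb|o e1 IH1 e2 IH2 /andP[h1 h2]].
  exact: leq_trans bb'.
by rewrite IH1 ?IH2.
Qed.

Lemma expr_degree_gt0 e : 0 < expr_degree e.
Proof. by elim: e => //= o e1 IH1 e2 IH2; rewrite addn_gt0 IH1. Qed.

Lemma leq_bitlen a b : a <= b -> bitlen a <= bitlen b.
Proof. by move=> ab; rewrite ltnS leq_trunc_log. Qed.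

Lemma bitlen_leq a q : a <= 2 ^ q -> bitlen a <= q.+1.
Proof. by move=> /leq_bitlen /leq_trans; apply; rewrite /bitlen trunc_expnK. Qed.

Lemma all_nth0 (M : nat) m i : all (fun v => v <= M) m -> nth 0 m i <= M.
Proof.
move=> /all_nthP hm; case: (ltnP i (size m)) => hi; first exact: hm.
by rewrite nth_default.
Qed.

Section ExprCost.
Variables (M q : nat) (m : seq nat).
Hypothesis (M2 : 1 < M) (Mq : M = 2 ^ q) (mM : all (fun v => v <= M) m).

Lemma expr_eval_le e :
  expr_consts_le M e -> expr_eval m e <= M ^ expr_degree e.
Proof.
elim: e => [k|a IH|o e1 IH1 e2 IH2] /=; rewrite ?expn1 //.
  by move=> _; apply: all_nth0.
move=> /andP[/IH1 {}IH1 /IH2 {}IH2].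
(* Both bounds exceed 1, so their sum is at most their product. *)
have g1 : 1 < M ^ expr_degree e1.
  by rewrite -(exp1n (expr_degree e1)) ltn_exp2r // expr_degree_gt0.
have g2 : 1 < M ^ expr_degree e2.
  by rewrite -(exp1n (expr_degree e2)) ltn_exp2r // expr_degree_gt0.
rewrite expnD; case: o => /=.
- by apply: leq_trans (leq_add IH1 IH2) _; nia.
- by apply: leq_trans (leq_subr _ _) _; nia.
- exact: leq_mul.
- by apply: leq_trans (leq_div _ _) _; nia.
- by apply: leq_trans (leq_mod _ _) _; nia.
Qed.

Lemma expr_cost_le e :
  expr_consts_le M e -> expr_cost m e <= expr_weight e * q.+1.
Proof.
have main e' : expr_consts_le M e' ->
    bitlen (expr_eval m e') <= expr_degree e' * q.+1.
  move=> /expr_eval_le; rewrite Mq -expnM => /bitlen_leq /leq_trans; apply.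
  by have := expr_degree_gt0 e'; nia.
elim: e => [k|a IH|o e1 IH1 e2 IH2] /= h.
- by have := main (Const k) h; rewrite /= !addn0.
- by have := main (Deref a) h; have := IH h; rewrite /=; nia.
- move: (h) => /andP[/IH1 {}IH1 /IH2 {}IH2].
  by have := main (Bin o e1 e2) h; rewrite /=; nia.
Qed.

Lemma space_used_le t w L : size m <= L -> space_used (Config t m w) <= L * q.+2.
Proof.
move=> hL; rewrite /space_used /=; apply: (@leq_trans (size m * q.+2)).
  rewrite -sum1_size big_distrl /= !big_seq; apply: leq_sum => v vm.
  by rewrite mul1n ltnS bitlen_leq // -Mq (allP mM).
by rewrite leq_mul2r hL orbT.
Qed.

End ExprCost.

(** * A language of array programs with bounded loops *)

(* [EN] is the number of vertices, [EMod] a modulus by which all stored values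
   are reduced, [EAdj] the adjacency matrix, [ECoin] a matrix of random bits and
   [EArr k] the [k]th of 32 arrays. *)
Inductive aexpr :=
  | ECst of nat
  | EN
  | EMod
  | EAdj of aexpr & aexpr
  | ECoin of aexpr & aexpr
  | EArr of nat & aexpr
  | EBin of binop & aexpr & aexpr.

(* In [PFor k e p] the counter, cell 0 of array [k], runs down from [e - 1] to 0. *)
Inductive aprog :=
  | PSkip
  | PSet of nat & aexpr & aexpr
  | PSeq of aprog & aprog
  | PIf of aexpr & aprog & aprog
  | PFor of nat & aexpr & aprog.

Definition store := nat -> nat -> nat.

Definition upd (s : store) (k i v : nat) : store :=
  fun k' i' => if (k' == k) && (i' == i) then v else s k' i'.

Fixpoint loop (j : nat) (f : nat -> store -> store) (s : store) : store :=
  if j is i.+1 then loop i f (f i s) else s.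

(** The counter runs down, so [Inv j] is the state in which the counter values from [j] upwards have
    been handled. *)
Lemma loop_ind (Inv : nat -> store -> Prop) N f s :
  Inv N s -> (forall j s', j < N -> Inv j.+1 s' -> Inv j (f j s')) ->
  Inv 0 (loop N f s).
Proof.
elim: N s => //= N IH s h0 hS; apply: IH; first exact: hS.
by move=> j s' jN; apply: hS; apply: ltnW.
Qed.

Fixpoint writes (p : aprog) : seq nat :=
  match p with
  | PSkip => [::]
  | PSet k _ _ => [:: k]
  | PSeq p q | PIf _ p q => writes p ++ writes q
  | PFor k _ p => k :: writes p
  end.

Fixpoint aexpr_arrays_ok (e : aexpr) : bool :=
  match e with
  | ECst _ | EN | EMod => true
  | EAdj e1 e2 | ECoin e1 e2 | EBin _ e1 e2 =>
      aexpr_arrays_ok e1 && aexpr_arrays_ok e2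
  | EArr k e1 => (k < 32) && aexpr_arrays_ok e1
  end.

(** A loop body must not write its own counter: the compiled loop keeps the number of remaining
    rounds in that cell. *)
Fixpoint aprog_ok (p : aprog) : bool :=
  match p with
  | PSkip => true
  | PSet k e1 e2 => [&& k < 32, aexpr_arrays_ok e1 & aexpr_arrays_ok e2]
  | PSeq p q => aprog_ok p && aprog_ok q
  | PIf e p q => [&& aexpr_arrays_ok e, aprog_ok p & aprog_ok q]
  | PFor k e p =>
      [&& k < 32, aexpr_arrays_ok e, k \notin writes p & aprog_ok p]
  end.

Section Semantics.
Variables (n M : nat) (adjm coinm : nat -> nat -> nat).

Fixpoint aeval (s : store) (e : aexpr) : nat :=
  match e with
  | ECst c => c
  | EN => n
  | EMod => M
  | EAdj e1 e2 => adjm (aeval s e1 %% n) (aeval s e2 %% n)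
  | ECoin e1 e2 => coinm (aeval s e1 %% n) (aeval s e2 %% n)
  | EArr k e1 => s k (aeval s e1)
  | EBin o e1 e2 => binop_eval o (aeval s e1) (aeval s e2)
  end.

(* Reducing every write modulo [M], and its index modulo [(n + 1) ^ 2], bounds
   the space of all programs at once. *)
Fixpoint sem (p : aprog) (s : store) : store :=
  match p with
  | PSkip => s
  | PSet k e1 e2 => upd s k (aeval s e1 %% (n.+1 * n.+1)) (aeval s e2 %% M)
  | PSeq p q => sem q (sem p s)
  | PIf e p q => if aeval s e != 0 then sem p s else sem q s
  | PFor k e p =>
      loop (aeval s e %% M) (fun j s' => sem p (upd s' k 0 j))
        (upd s k 0 (aeval s e %% M))
  end.

Lemma sem_frame p s k : k \notin writes p -> sem p s k = s k.
Proof.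
have upd_frame s' k' i v : k != k' -> upd s' k' i v k = s' k.
  by move=> kk'; rewrite /upd (negPf kk').
elim: p s => //= [k' e1 e2 s|p IHp q IHq s|e p IHp q IHq s|k' e p IHp s].
- by rewrite inE; apply: upd_frame.
- by rewrite mem_cat negb_or => /andP[/IHp hp /IHq ->].
- by rewrite mem_cat negb_or => /andP[/IHp hp /IHq hq]; case: ifP.
- rewrite inE negb_or => /andP[kk' /IHp hp].
  apply: (@loop_ind (fun _ s' => s' k = s k)); first exact: upd_frame.
  by move=> j s' _ <-; rewrite hp upd_frame.
Qed.

(** These are exact numbers of machine steps: a round adds a test, a sequencing and a decrement to
    its body, and 1 pays for the final failing test. *)
Fixpoint loop_time (j : nat) (t : nat -> store -> nat)
    (f : nat -> store -> store) (s : store) : nat :=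
  if j is i.+1 then 3 + t i s + loop_time i t f (f i s) else 1.

Fixpoint time (p : aprog) (s : store) : nat :=
  match p with
  | PSkip | PSet _ _ _ => 1
  | PSeq p q => 1 + time p s + time q (sem p s)
  | PIf e p q => 1 + (if aeval s e != 0 then time p s else time q s)
  | PFor k e p =>
      2 + loop_time (aeval s e %% M) (fun j s' => time p (upd s' k 0 j))
        (fun j s' => sem p (upd s' k 0 j)) (upd s k 0 (aeval s e %% M))
  end.

End Semantics.

(** * Compilation to the machine *)

Definition c_n := Deref (Const 0).
Definition c_nn := Bin OpMul c_n c_n.
Definition c_mod := Deref (Bin OpAdd c_nn (Const 1)).
Definition c_idx (e1 e2 : expr) :=
  Bin OpAdd (Bin OpMul c_n (Bin OpMod e1 c_n)) (Bin OpMod e2 c_n).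

(* Memory layout: cell 0 and the next [n ^ 2] cells hold the input, the two
   following cells the modulus and a loop counter, then come [n ^ 2] coins and
   finally the 32 arrays, interleaved. *)
Definition c_cell (k : nat) (i : expr) :=
  Bin OpAdd (Bin OpAdd (Bin OpAdd c_nn c_nn) (Const (3 + k)))
    (Bin OpMul (Const 32) i).

Fixpoint compile_expr (e : aexpr) : expr :=
  match e with
  | ECst c => Const c
  | EN => c_n
  | EMod => c_mod
  | EAdj e1 e2 =>
      Deref (Bin OpAdd (Const 1) (c_idx (compile_expr e1) (compile_expr e2)))
  | ECoin e1 e2 =>
      Deref (Bin OpAdd (Bin OpAdd c_nn (Const 3))
               (c_idx (compile_expr e1) (compile_expr e2)))
  | EArr k e1 => Deref (c_cell k (compile_expr e1))
  | EBin o e1 e2 => Bin o (compile_expr e1) (compile_expr e2)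
  end.

Definition c_n1 := Bin OpAdd c_n (Const 1).

Fixpoint compile (p : aprog) : prog :=
  match p with
  | PSkip => Skip
  | PSet k e1 e2 =>
      Assign (c_cell k (Bin OpMod (compile_expr e1) (Bin OpMul c_n1 c_n1)))
        (Bin OpMod (compile_expr e2) c_mod)
  | PSeq p q => Seq (compile p) (compile q)
  | PIf e p q => Ite (compile_expr e) (compile p) (compile q)
  | PFor k e p =>
      let ctr := c_cell k (Const 0) in
      Seq (Assign ctr (Bin OpMod (compile_expr e) c_mod))
        (While (Deref ctr)
           (Seq (Assign ctr (Bin OpSub (Deref ctr) (Const 1))) (compile p)))
  end.

(** Bounds the cost of a single step in units of the word length; a constant of the program,
    independent of the input. *)
Fixpoint prog_weight (p : prog) : nat :=
  match p with
  | Skip => 1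
  | Assign a e => expr_weight a + expr_weight e
  | Flip a => (expr_weight a).+1
  | Seq p q => maxn 1 (maxn (prog_weight p) (prog_weight q))
  | Ite e p q => maxn (expr_weight e) (maxn (prog_weight p) (prog_weight q))
  | While e p => maxn (expr_weight e) (prog_weight p)
  end.

Fixpoint prog_consts_le (b : nat) (p : prog) : bool :=
  match p with
  | Skip => true
  | Assign a e => expr_consts_le b a && expr_consts_le b e
  | Flip a => expr_consts_le b a
  | Seq p q => prog_consts_le b p && prog_consts_le b q
  | Ite e p q => [&& expr_consts_le b e, prog_consts_le b p & prog_consts_le b q]
  | While e p => expr_consts_le b e && prog_consts_le b p
  end.

Arguments expr_weight : simpl never.
Arguments expr_consts_le : simpl never.

Lemma prog_consts_leW b b' p :
  b <= b' -> prog_consts_le b p -> prog_consts_le b' p.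
Proof.
move=> bb'; have W := expr_consts_leW bb'.
elim: p => //= [a e /andP[? ?]|p IHp q IHq /andP[? ?]|e p IHp q IHq
    /and3P[? ? ?]|e p IHp /andP[? ?]]; by rewrite ?W ?IHp ?IHq.
Qed.

Section Simulation.
Variables (n q Kw : nat) (adjm coinm : nat -> nat -> nat).
Let M := 2 ^ q.
Hypotheses (n0 : 0 < n) (M1 : 1 < M).

(** Input, modulus, counter and coins fill [2 * (n * n) + 3] cells; each array has one cell for
    every index left by the reduction in [sem]. *)
Definition mem_size := 2 * (n * n) + 3 + 32 * (n.+1 * n.+1).

(** Arrays are constrained at all indices, also beyond the end of memory, where cells read as 0.
    Cell [n * n + 2], the counter of the initialisation, is left free. *)
Record represents (s : store) (m : seq nat) : Prop := Represents {
  rep_n : nth 0 m 0 = n;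
  rep_adj : forall u v, u < n -> v < n -> nth 0 m (1 + (n * u + v)) = adjm u v;
  rep_mod : nth 0 m (n * n + 1) = M;
  rep_coin : forall u v, u < n -> v < n ->
    nth 0 m (n * n + 3 + (n * u + v)) = coinm u v;
  rep_arr : forall k i, k < 32 ->
    nth 0 m (n * n + n * n + (3 + k) + 32 * i) = s k i;
  rep_le : all (fun v => v <= M) m;
  rep_size : size m <= mem_size }.

Lemma expr_eval_compile s m e : represents s m -> aexpr_arrays_ok e ->
  expr_eval m (compile_expr e) = aeval n M adjm coinm s e.
Proof.
move=> r; elim: e => //=; rewrite ?(rep_n r) ?(rep_mod r) //.
- move=> e1 IH1 e2 IH2 /andP[/IH1-> /IH2->].
  by rewrite (rep_adj r) // ltn_pmod.
- move=> e1 IH1 e2 IH2 /andP[/IH1-> /IH2->].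
  by rewrite (rep_coin r) // ltn_pmod.
- by move=> k e IH /andP[k32 /IH->]; rewrite (rep_arr r).
- by move=> o e1 IH1 e2 IH2 /andP[/IH1-> /IH2->].
Qed.

Lemma expr_eval_cell s m k e : represents s m ->
  expr_eval m (c_cell k e) = n * n + n * n + (3 + k) + 32 * expr_eval m e.
Proof. by move=> r /=; rewrite (rep_n r). Qed.

Lemma represents_upd s m k i v : represents s m -> k < 32 ->
  i < n.+1 * n.+1 -> v <= M ->
  represents (upd s k i v) (set_nth 0 m (n * n + n * n + (3 + k) + 32 * i) v).
Proof.
move=> r k32 hi hv.
have lowP u v' : u < n -> v' < n -> n * u + v' < n * n by nia.
split.
- by rewrite nth_set_nth /= ifN ?(rep_n r) //; lia.
- move=> u v' hu hv'; rewrite nth_set_nth /= ifN ?(rep_adj r) //.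
  by have := lowP _ _ hu hv'; lia.
- by rewrite nth_set_nth /= ifN ?(rep_mod r) //; lia.
- move=> u v' hu hv'; rewrite nth_set_nth /= ifN ?(rep_coin r) //.
  by have := lowP _ _ hu hv'; lia.
(* The interleaved arrays are disjoint: division by 32 recovers [k] and [i] from the address. *)
- move=> k' i' k'32; rewrite nth_set_nth /= /upd (rep_arr r) //.
  by congr (if _ then _ else _); apply/eqP/andP => [?|[/eqP-> /eqP->] //]; lia.
- apply/(all_nthP 0) => j _; rewrite nth_set_nth /=.
  by case: ifP => // _; apply: all_nth0 (rep_le r).
- rewrite size_set_nth geq_max (rep_size r) andbT /mem_size.
  by move: hi; move: (n.+1 * n.+1) (n * n) => *; lia.
Qed.

Let Kc := Kw * q.+1.
Let Sp := mem_size * q.+2.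

Lemma rep_space s m t w : represents s m -> space_used (Config t m w) <= Sp.
Proof. by move=> r; apply: (space_used_le (erefl M)) (rep_le r) _ _ _ (rep_size r). Qed.

Lemma run_step_bounded k m p t w c' :
  all (fun v => v <= M) m -> size m <= mem_size ->
  prog_weight p <= Kw -> prog_consts_le M p ->
  run Kc Sp k (step (Config (p :: t) m w)) c' ->
  run Kc Sp k.+1 (Config (p :: t) m w) c'.
Proof.
move=> mM msz hK hC; apply: runS => //; last exact: space_used_le mM _ _ _ msz.
have cost e : expr_consts_le M e -> expr_cost m e <= expr_weight e * q.+1.
  by move=> he; apply: (expr_cost_le M1 (erefl M)) mM _ he.
rewrite /Kc; case: p hK hC => /= [|a e|a|p1 p2|e p1 p2|e p1].
- by rewrite muln_gt0 => ->.
- move=> hK /andP[/cost h1 /cost h2]; apply: leq_trans (leq_add h1 h2) _.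
  by rewrite -mulnDl leq_mul2r hK orbT.
- move=> hK /cost h1; apply: (@leq_trans ((expr_weight a).+1 * q.+1)).
    by rewrite /step_cost mulSn /=; lia.
  by rewrite leq_mul2r hK orbT.
- by rewrite geq_max muln_gt0 => /andP[->].
- rewrite geq_max => /andP[hK _] /and3P[/cost h1 _ _].
  by apply: leq_trans h1 _; rewrite leq_mul2r hK orbT.
- rewrite geq_max => /andP[hK _] /andP[/cost h1 _].
  by apply: leq_trans h1 _; rewrite leq_mul2r hK orbT.
Qed.

Lemma run_step k s m p t w c' : represents s m ->
  prog_weight p <= Kw -> prog_consts_le M p ->
  run Kc Sp k (step (Config (p :: t) m w)) c' ->
  run Kc Sp k.+1 (Config (p :: t) m w) c'.
Proof. by move=> r; apply: run_step_bounded (rep_le r) (rep_size r). Qed.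

Lemma run_assign s m k e1 e2 t w : represents s m -> k < 32 ->
  prog_weight (Assign (c_cell k e1) e2) <= Kw ->
  prog_consts_le M (Assign (c_cell k e1) e2) ->
  expr_eval m e1 < n.+1 * n.+1 -> expr_eval m e2 <= M ->
  exists2 m', represents (upd s k (expr_eval m e1) (expr_eval m e2)) m' &
    run Kc Sp 1 (Config (Assign (c_cell k e1) e2 :: t) m w) (Config t m' w).
Proof.
move=> r k32 hK hC h1 h2; have r' := represents_upd r k32 h1 h2.
exists (set_nth 0 m (n * n + n * n + (3 + k) + 32 * expr_eval m e1)
    (expr_eval m e2)) => //.
apply: (run_step r hK hC); rewrite /step (expr_eval_cell _ _ r).
by apply: run0; apply: rep_space r'.
Qed.

(** The rest [t] of the control stack is arbitrary, so that the runs of consecutive subprograms can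
    be chained in the induction. *)
Lemma compile_correct p s m t w : represents s m -> aprog_ok p ->
  prog_weight (compile p) <= Kw -> prog_consts_le M (compile p) ->
  exists2 m', represents (sem n M adjm coinm p s) m' &
    run Kc Sp (time n M adjm coinm p s)
      (Config (compile p :: t) m w) (Config t m' w).
Proof.
elim: p s m t w => [|k e1 e2|p IHp q' IHq|e p IHp q' IHq|k e p IHp] s m t w r ok hK hC.
- exists m => //; apply: (run_step r hK hC).
  by apply: run0; apply: rep_space r.
- move: ok => /= /and3P[k32 ok1 ok2].
  have := @run_assign s m k _ _ t w r k32 hK hC.
  rewrite /= (rep_n r) (rep_mod r) !(expr_eval_compile r) // addn1.
  by apply; rewrite ?ltn_pmod // ltnW // ltn_pmod // ltnW.
- move: (ok) (hK) (hC) => /= /andP[okp okq].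
  rewrite !geq_max => /and3P[_ hKp hKq] /andP[hCp hCq].
  have [m1 r1 run1] := IHp s m (compile q' :: t) w r okp hKp hCp.
  have [m2 r2 run2] := IHq _ m1 t w r1 okq hKq hCq.
  exists m2 => //; rewrite -addnA; apply: (run_step r hK hC).
  exact: run_trans run1 run2.
- move: (ok) (hK) (hC) => /= /and3P[oke okp okq].
  rewrite !geq_max => /and3P[_ hKp hKq] /and3P[hCe hCp hCq].
  have [m1 r1 run1] := IHp s m t w r okp hKp hCp.
  have [m2 r2 run2] := IHq s m t w r okq hKq hCq.
  case E: (aeval n M adjm coinm s e != 0); [exists m1 => //|exists m2 => //];
    by apply: (run_step r hK hC); rewrite /= (expr_eval_compile r oke) E.
- set ctr := c_cell k (Const 0).
  set body := Seq (Assign ctr (Bin OpSub (Deref ctr) (Const 1))) (compile p).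
  move: (ok) (hK) (hC) => /= /and4P[k32 oke kp okp].
  rewrite -/ctr -/body; set asg := Assign _ _.
  rewrite !geq_max => /and3P[hK1 hKa /and4P[hKw _ hKs hKp]].
  case/and3P=> /andP[hCa1 hCa2] hCw /andP[/andP[hCs1 hCs2] hCp].
  have hCa : prog_consts_le M asg by rewrite /= hCa1.
  have M0 : 0 < M by rewrite ltnW.
  have evctr s' m' : represents s' m' -> expr_eval m' (Deref ctr) = s' k 0.
    move=> r'; rewrite -[LHS]/(nth 0 m' (expr_eval m' ctr)).
    by rewrite (expr_eval_cell _ _ r') (rep_arr r').
  have hCs : prog_consts_le M (Assign ctr (Bin OpSub (Deref ctr) (Const 1))).
    by rewrite /= hCs1.
  have hKb : prog_weight body <= Kw by rewrite /= !geq_max hK1 hKs.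
  have hCb : prog_consts_le M body by rewrite /= hCs1 hCs2.
  have hKwh : prog_weight (While (Deref ctr) body) <= Kw by rewrite geq_max hKw.
  have hCwh : prog_consts_le M (While (Deref ctr) body).
    by rewrite -[prog_consts_le _ _]/(expr_consts_le _ _ && _) hCw.
  have [|m0 r0 run0] := @run_assign s m k (Const 0) (Bin OpMod (compile_expr e) c_mod)
      (While (Deref ctr) body :: t) w r k32 hKa hCa isT.
    by rewrite /= (rep_n r) (rep_mod r) ltnW // ltn_pmod.
  move: r0; rewrite /= (rep_n r) (rep_mod r) (expr_eval_compile r oke).
  set N := aeval _ _ _ _ _ _ %% M => r0.
  set s0 := upd s k 0 N in r0 *.
  (* After the initial assignment only the [While] loop is left; it is handled by induction on the
     value of its counter cell, for an arbitrary store. *)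
  suff [m' r' run'] : exists2 m', represents (loop N
        (fun j s' => sem n M adjm coinm p (upd s' k 0 j)) s0) m' &
      run Kc Sp (loop_time N (fun j s' => time n M adjm coinm p (upd s' k 0 j))
          (fun j s' => sem n M adjm coinm p (upd s' k 0 j)) s0)
        (Config (While (Deref ctr) body :: t) m0 w) (Config t m' w).
    exists m' => //; apply: (run_step r hK hC); apply: run_trans run0 run'.
  have : s0 k 0 = N by rewrite /s0 /upd !eqxx.
  clear run0; clearbody s0; move: N s0 m0 r0; elim=> [|N IHN] s0 m0 r0 s0k.
    exists m0 => //=; apply: (run_step r0 hKwh hCwh).
    by rewrite /step (evctr _ _ r0) s0k; apply: run0; apply: rep_space r0.
  have sub : expr_eval m0 (Bin OpSub (Deref ctr) (Const 1)) = N.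
    by rewrite -[LHS]/(expr_eval m0 (Deref ctr) - 1) (evctr _ _ r0) s0k subn1.
  have NM : N <= M.
    by apply: ltnW; rewrite -s0k -(rep_arr r0 _ k32); apply: all_nth0 (rep_le r0).
  have [|m1 r1 run1] := @run_assign s0 m0 k (Const 0)
    (Bin OpSub (Deref ctr) (Const 1)) (compile p :: While (Deref ctr) body :: t) w
    r0 k32 hKs hCs isT; first by rewrite sub.
  rewrite sub /= in r1.
  have [m2 r2 run2] := IHp _ m1 (While (Deref ctr) body :: t) w r1 okp hKp hCp.
  (* The body does not write its counter, so that cell still holds the decremented value. *)
  have [|m3 r3 run3] := IHN _ m2 r2.
    by rewrite sem_frame // /upd !eqxx.
  exists m3 => //=; rewrite -!addnA.
  apply: (run_step r0 hKwh hCwh); rewrite /step (evctr _ _ r0) s0k /=.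
  apply: (run_step r0 hKb hCb); rewrite /step.
  exact: run_trans run1 (run_trans run2 run3).
Qed.

End Simulation.

(** * Initialisation: the modulus and the coins *)

Definition c_ctr := Bin OpAdd c_nn (Const 2).

(** Starting from modulus 256, [n * n] multiplications by 256 give [256 ^ (n * n).+1], which is
    [2 ^ log_mod n]. Each round also stores one coin. *)
Definition init_body :=
  Seq (Assign (Bin OpAdd c_nn (Const 1)) (Bin OpMul c_mod (Const 256)))
    (Seq (Flip (Bin OpAdd (Bin OpAdd c_nn (Const 3))
                  (Bin OpSub c_nn (Deref c_ctr))))
       (Assign c_ctr (Bin OpSub (Deref c_ctr) (Const 1)))).

Definition init_prog :=
  Seq (Assign (Bin OpAdd c_nn (Const 1)) (Const 256))
    (Seq (Assign c_ctr c_nn) (While (Deref c_ctr) init_body)).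

(** Large enough for the modulus to exceed n!, hence the number of Hamiltonian cycles, as well as
    the budget and the products formed in the setup. *)
Definition log_mod (n : nat) := 8 * (n * n).+1.

Lemma set_nth_cat (T : Type) (x0 : T) s1 s2 i v :
  set_nth x0 (s1 ++ s2) (size s1 + i) v = s1 ++ set_nth x0 s2 i v.
Proof. by elim: s1 => //= x s1 IH; rewrite IH. Qed.

Lemma set_nth_size (T : Type) (x0 : T) s v :
  set_nth x0 s (size s) v = rcons s v.
Proof. by elim: s => //= x s ->. Qed.

Section Init.
Variables (n Kw : nat) (input : seq nat) (w : seq bool).
Hypotheses (n0 : 0 < n) (size_in : size input = (n * n).+1)
  (in_n : nth 0 input 0 = n) (in_le : all (fun v => v <= 2 ^ log_mod n) input)
  (hKw : prog_weight init_prog <= Kw).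
Let M := 2 ^ log_mod n.
Let Kc := Kw * (log_mod n).+1.
Let Sp := mem_size n * (log_mod n).+2.

(** The memory once [j] coins have been read, with modulus [x] and counter [y]. *)
Let mem (x y j : nat) : seq nat :=
  input ++ x :: y :: mkseq (fun i => nat_of_bool (nth false w i)) j.

Let nth_mem x y j i : nth 0 (mem x y j) i =
  if i < (n * n).+1 then nth 0 input i else
  if i == n * n + 1 then x else
  if i == n * n + 2 then y else
  if i < n * n + 3 + j then nat_of_bool (nth false w (i - (n * n + 3))) else 0.
Proof.
rewrite /mem nth_cat size_in; case: ltnP => // hi.
case: eqVneq => [->|i1]; first by rewrite addn1 subnn.
case: eqVneq => [->|i2]; first by rewrite addn2 subSn // subnn.
have -> : i - (n * n).+1 = (i - (n * n + 3)).+2 by lia.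
rewrite /=; case: ltnP => h3; first by rewrite nth_mkseq //; lia.
by rewrite nth_default // size_mkseq; lia.
Qed.

Let size_mem x y j : size (mem x y j) = n * n + 3 + j.
Proof. by rewrite /mem size_cat /= size_mkseq size_in; lia. Qed.

Let set_nth_input i v s : set_nth 0 (input ++ s) (n * n + i.+1) v = input ++ set_nth 0 s i v.
Proof. by rewrite addnS -addSn -size_in set_nth_cat. Qed.

Let nnM : n * n < M.
Proof.
apply: leq_trans (ltn_expl _ (isT : 1 < 2)) _.
by rewrite leq_exp2l // /log_mod; lia.
Qed.

Let mem_le x y j : x <= M -> y <= M -> all (fun v => v <= M) (mem x y j).
Proof.
move=> xM yM; rewrite all_cat in_le /= xM yM /=.
apply/allP => v /mapP[i _ ->].
by apply: leq_trans (leq_b1 _) _; apply: leq_ltn_trans nnM.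
Qed.

Let mem_fits x y j : j <= n * n -> size (mem x y j) <= mem_size n.
Proof.
by move=> jn; rewrite size_mem /mem_size; move: (n.+1 * n.+1) => z; lia.
Qed.

Let ev_ctr x y i : expr_eval (mem x y i) (Deref c_ctr) = y.
Proof.
rewrite /= !nth_mem /= in_n; case: ltnP => [|_]; first lia.
by case: eqVneq => [|_]; [lia|rewrite eqxx].
Qed.

(** The six steps are the loop test, two sequencings, two assignments and a flip. *)
Let step_loop k j t c' : j < n * n ->
  let c := Config (While (Deref c_ctr) init_body :: t) in
  run Kc Sp k (c (mem (256 ^ j.+2) (n * n - j.+1) j.+1) (drop j.+1 w)) c' ->
  run Kc Sp (6 + k) (c (mem (256 ^ j.+1) (n * n - j) j) (drop j w)) c'.
Proof.
move=> jn c r; have M1 : 1 < M by rewrite /M /log_mod mulnS expnD; nia.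
have M256 : 255 < M by rewrite (@leq_exp2l 2 8) // /log_mod; lia.
have powM i : i <= (n * n).+1 -> 256 ^ i <= M.
  by move=> hi; rewrite /M /log_mod expnM leq_exp2l.
have st x y i k' p t' w' : x <= M -> y <= M -> i <= n * n ->
    prog_weight p <= prog_weight init_prog -> prog_consts_le 256 p ->
    run Kc Sp k' (step (Config (p :: t') (mem x y i) w')) c' ->
    run Kc Sp k'.+1 (Config (p :: t') (mem x y i) w') c'.
  move=> xM yM hi hp hc; apply: run_step_bounded => //.
  - exact: mem_le.
  - exact: mem_fits.
  - exact: leq_trans hp hKw.
  - exact: prog_consts_leW M256 hc.
have ev_mod x y i : expr_eval (mem x y i) c_mod = x.
  by rewrite /= !nth_mem /= in_n ltnS leqNgt addn1 ltnS leqnn /= eqxx.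
have jM : n * n - j <= M by apply: leq_trans (leq_subr _ _) (ltnW nnM).
have set_mod x y i v : set_nth 0 (mem x y i) (n * n + 1) v = mem v y i.
  exact: set_nth_input.
have set_ctr x y i v : set_nth 0 (mem x y i) (n * n + 2) v = mem x v i.
  exact: set_nth_input.
have set_coin x y v : nat_of_bool (nth false w j) = v ->
    set_nth 0 (mem x y j) (n * n + 3 + j) v = mem x y j.+1.
  move=> <-; rewrite -addnA set_nth_input /= /mem mkseqS.
  by rewrite -[j in set_nth _ _ j](size_mkseq (fun i => nat_of_bool (nth false w i))) set_nth_size.
have nn_n x y i : nth 0 (mem x y i) 0 = n by rewrite nth_mem.
have jM' : 256 ^ j.+1 <= M by apply: powM; lia.
have jM2 : 256 ^ j.+2 <= M by apply: powM; lia.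
have jnn := ltnW jn.
rewrite /c; apply: (st) => //; rewrite /step ev_ctr.
have -> : n * n - j != 0 by lia.
have e1 x y i : expr_eval (mem x y i) (Bin OpAdd c_nn (Const 1)) = n * n + 1.
  by rewrite /= nn_n.
have e2 x y i : expr_eval (mem x y i) (Bin OpMul c_mod (Const 256)) = x * 256.
  by rewrite -[LHS]/(expr_eval (mem x y i) c_mod * 256) ev_mod.
have e3 x y i : expr_eval (mem x y i) (Bin OpAdd (Bin OpAdd c_nn (Const 3))
    (Bin OpSub c_nn (Deref c_ctr))) = n * n + 3 + (n * n - y).
  rewrite -[LHS]/(expr_eval (mem x y i) c_nn + 3 +
    (expr_eval (mem x y i) c_nn - expr_eval (mem x y i) (Deref c_ctr))).
  by rewrite ev_ctr /= nn_n.
have e4 x y i : expr_eval (mem x y i) c_ctr = n * n + 2 by rewrite /= nn_n.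
have e5 x y i : expr_eval (mem x y i) (Bin OpSub (Deref c_ctr) (Const 1)) = y - 1.
  by rewrite -[LHS]/(expr_eval (mem x y i) (Deref c_ctr) - 1) ev_ctr.
apply: (st) => //; rewrite /step /init_body.
apply: (st) => //; rewrite /step e1 e2 set_mod -expnSr.
apply: (st) => //; rewrite /step.
apply: (st) => //; rewrite /step e3 (subKn jnn) set_coin; last first.
  by rewrite -nth0 nth_drop addn0.
apply: (st) => //; rewrite /step e4 e5.
rewrite set_ctr subn1 -subnS -drop1 drop_drop add1n.
exact: r.
Qed.

(** Besides six steps per round, four go into the two initial assignments and their sequencing and
    one into the final test. *)
Lemma init_correct t : exists2 m',
  represents n (log_mod n) (fun u v => nth 0 input (1 + (n * u + v)))
    (fun u v => nat_of_bool (nth false w (n * u + v))) (fun _ _ => 0) m' &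
  run Kc Sp (6 * (n * n) + 5) (Config (init_prog :: t) input w)
    (Config t m' (drop (n * n) w)).
Proof.
exists (mem M 0 (n * n)).
  have lowP u v' : u < n -> v' < n -> n * u + v' < n * n by nia.
  split.
  - by rewrite nth_mem.
  - by move=> u v hu hv; rewrite nth_mem ifT // add1n ltnS lowP.
  - by rewrite nth_mem ifF ?eqxx //; lia.
  - move=> u v hu hv; have := lowP _ _ hu hv; rewrite nth_mem => h.
    case: ltnP => [|_]; first lia; case: eqVneq => [|_]; first lia.
    case: eqVneq => [|_]; first lia; case: ltnP => [_|]; last lia.
    by rewrite addKn.
  - by move=> k i _; rewrite nth_default // size_mem; lia.
  - exact: mem_le.
  - exact: mem_fits.
have M256 : 256 <= M by rewrite (@leq_exp2l 2 8) // /log_mod; lia.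
have in_sz : size input <= mem_size n.
  by rewrite size_in /mem_size; move: (n.+1 * n.+1) => z; lia.
have in_sz1 : size (input ++ [:: 256]) <= mem_size n.
  by rewrite size_cat size_in /mem_size /=; move: (n.+1 * n.+1) => z; lia.
have in_le1 : all (fun v => v <= M) (input ++ [:: 256]).
  by rewrite all_cat in_le /= M256.
have M1 : 1 < M by apply: leq_trans M256.
have -> : 6 * (n * n) + 5 = (6 * (n * n) + 1).+4 by lia.
have st1 k' p t' m w' c' : all (fun v => v <= M) m -> size m <= mem_size n ->
    prog_weight p <= prog_weight init_prog -> prog_consts_le 256 p ->
    run Kc Sp k' (step (Config (p :: t') m w')) c' ->
    run Kc Sp k'.+1 (Config (p :: t') m w') c'.
  move=> mM msz hp hc; apply: run_step_bounded => //.
  - exact: leq_trans hp hKw.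
  - exact: prog_consts_leW M256 hc.
apply: (st1) => //; rewrite /step /init_prog.
apply: (st1) => //; rewrite /step.
have -> : expr_eval input (Bin OpAdd c_nn (Const 1)) = n * n + 1 by rewrite /= in_n.
have -> : set_nth 0 input (n * n + 1) (expr_eval input (Const 256)) = input ++ [:: 256].
  by rewrite -{1}[input]cats0 set_nth_input.
apply: (st1) => //; rewrite /step.
apply: (st1) => //; rewrite /step.
have n_in1 : nth 0 (input ++ [:: 256]) 0 = n by rewrite nth_cat size_in.
have -> : expr_eval (input ++ [:: 256]) c_ctr = n * n + 2 by rewrite /= n_in1.
have -> : expr_eval (input ++ [:: 256]) c_nn = n * n by rewrite /= n_in1.
rewrite set_nth_input /=.
have loopP i : i <= n * n -> run Kc Sp (6 * i + 1)
    (Config (While (Deref c_ctr) init_body :: t) (mem (256 ^ (n * n - i).+1) i (n * n - i))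
       (drop (n * n - i) w)) (Config t (mem M 0 (n * n)) (drop (n * n) w)).
  elim: i => [_|i IH hi].
    rewrite subn0 muln0 add0n.
    have -> : 256 ^ (n * n).+1 = M by rewrite /M /log_mod expnM.
    apply: (st1) => //; first exact: mem_le.
      exact: mem_fits.
    rewrite /step ev_ctr; apply: run0.
    by apply: space_used_le (mem_le _ _ _) _ _ _ (mem_fits _ _ _).
  have [jn E] : n * n - i.+1 < n * n /\ n * n - i = (n * n - i.+1).+1 by lia.
  have := IH (ltnW hi); rewrite E => run_i; have := @step_loop (6 * i + 1) _ t _ jn.
  rewrite -E (subKn hi) (subKn (ltnW hi)) E mulnS -addnA.
  exact.
by have := loopP _ (leqnn (n * n)); rewrite subnn drop0.
Qed.

End Init.

(** * Static running time *)

(** Programs whose loops all range over the vertices run in polynomial time on every store. Only the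
    main loop, which is bounded by the budget, falls outside this class. *)
Fixpoint vertex_loops (p : aprog) : bool :=
  match p with
  | PSkip | PSet _ _ _ => true
  | PSeq p q | PIf _ p q => vertex_loops p && vertex_loops q
  | PFor _ e p => (if e is EN then true else false) && vertex_loops p
  end.

Fixpoint static_time (n : nat) (p : aprog) : nat :=
  match p with
  | PSkip | PSet _ _ _ => 1
  | PSeq p q | PIf _ p q => 1 + static_time n p + static_time n q
  | PFor _ _ p => 3 + n * (3 + static_time n p)
  end.

Lemma loop_time_le b j t f s : (forall i s', t i s' <= b) ->
  loop_time j t f s <= 1 + j * (3 + b).
Proof.
move=> tb; elim: j s => //= j IH s; rewrite mulSn.
by have := IH (f j s); have := tb j s; lia.
Qed.

Lemma time_le n M adjm coinm p s : vertex_loops p ->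
  time n M adjm coinm p s <= static_time n p.
Proof.
elim: p s => //= [p IHp q IHq s /andP[/IHp h1 /IHq h2]|e p IHp q IHq s
    /andP[/IHp h1 /IHq h2]|k e p IHp s].
- by rewrite !leq_add.
- by have := h1 s; have := h2 s; case: ifP; lia.
- case: e => //= /IHp h; rewrite -[3 + _]/(2 + (1 + _)) leq_add2l.
  apply: leq_trans (loop_time_le _ _ _ (fun i s' => h _)) _.
  by rewrite leq_add2l leq_mul2r leq_mod orbT.
Qed.

Lemma static_time_poly p : exists c k, forall n, static_time n p <= c * n.+1 ^ k.
Proof.
have pw n j k : j <= k -> n.+1 ^ j <= n.+1 ^ k by move=> ?; rewrite leq_pexp2l.
have pos n j : 0 < n.+1 ^ j by rewrite expn_gt0.
elim: p => /= [|k e1 e2|p [c1 [k1 h1]] q [c2 [k2 h2]]|e p [c1 [k1 h1]] q [c2 [k2 h2]]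
    |k e p [c1 [k1 h1]]].
- by exists 1, 0.
- by exists 1, 0.
- exists (1 + c1 + c2), (k1 + k2) => n.
  have := h1 n; have := h2 n; have := pos n (k1 + k2).
  have := pw n _ _ (leq_addr k2 k1); have := pw n _ _ (leq_addl k1 k2).
  by move: (n.+1 ^ _) (n.+1 ^ _) (n.+1 ^ _) => *; nia.
- exists (1 + c1 + c2), (k1 + k2) => n.
  have := h1 n; have := h2 n; have := pos n (k1 + k2).
  have := pw n _ _ (leq_addr k2 k1); have := pw n _ _ (leq_addl k1 k2).
  by move: (n.+1 ^ _) (n.+1 ^ _) (n.+1 ^ _) => *; nia.
- exists (6 + c1), k1.+1 => n; have := h1 n; have := pos n k1; rewrite expnS.
  by move: (n.+1 ^ _) => *; nia.
Qed.

(** * Hamiltonian cycles as an alternating sum of determinants *)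

Definition bit (p i : nat) : nat := (p %/ 2 ^ i) %% 2.

Lemma bit_small p i : p < 2 ^ i -> bit p i = 0.
Proof. by move=> h; rewrite /bit divn_small // mod0n. Qed.

Lemma bit_add_pow p n i : i < n -> bit (2 ^ n + p) i = bit p i.
Proof.
move=> hi; have -> : 2 ^ n = 2 ^ (n - i.+1) * 2 * 2 ^ i.
  by rewrite -mulnA -expnS -expnD subnK.
by rewrite /bit divnMDl ?expn_gt0 // -modnDml modnMl.
Qed.

Lemma bit_add_pow_top p n : p < 2 ^ n -> bit (2 ^ n + p) n = 1.
Proof.
by move=> hp; rewrite /bit -{1}[2 ^ n]mul1n divnMDl ?expn_gt0 // divn_small.
Qed.

Local Open Scope ring_scope.

(** The numbers below [2 ^ n] run through all bit vectors; the induction splits off the top bit. *)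
Lemma sum_prod_bits (R : comNzRingType) (n : nat) (h : nat -> nat -> R) :
  \sum_(p < 2 ^ n) \prod_(i < n) h i (bit p i) =
  \prod_(i < n) (h i 0%N + h i 1%N).
Proof.
elim: n => [|n IH]; first by rewrite expn0 big_ord_recl big_ord0 !big_ord0 addr0.
rewrite big_ord_recr /= -IH mulrDr expnS mul2n -addnn.
rewrite -(big_mkord xpredT (fun p => \prod_(i < n.+1) h i (bit p i))).
rewrite (@big_cat_nat _ _ _ (2 ^ n)) ?leq_addr //=; congr (_ + _).
  rewrite big_mkord big_distrl; apply: eq_bigr => p _ /=.
  by rewrite big_ord_recr /= [bit p n]bit_small.
rewrite -{1}[(2 ^ n)%N]add0n big_addn addnK big_mkord big_distrl.
apply: eq_bigr => p _ /=; rewrite big_ord_recr /= addnC bit_add_pow_top //.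
by congr (_ * _); apply: eq_bigr => i _; rewrite bit_add_pow.
Qed.

(** In Leibniz's formula the product over the rows is distributed over the sums: row [u] chooses its
    summand [f u]. *)
Lemma det_sum_rows (R : comNzRingType) n (a : 'I_n -> 'I_n -> R)
    (r : 'I_n -> 'I_n -> 'I_n -> R) :
  \det (\matrix_(u, v) \sum_w a u w * r u w v) =
  \sum_(f : {ffun 'I_n -> 'I_n})
    (\prod_u a u (f u)) * \det (\matrix_(u, v) r u (f u) v).
Proof.
transitivity (\sum_(f : {ffun 'I_n -> 'I_n}) \sum_(sg : 'S_n) (\prod_u a u (f u)) *
    ((-1) ^+ sg * \prod_u (\matrix_(u, v) r u (f u) v) u (sg u))).
  rewrite exchange_big; apply: eq_bigr => sg _ /=.
  under eq_bigr => u _ do rewrite mxE.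
  rewrite bigA_distr_bigA big_distrr; apply: eq_bigr => f _ /=.
  by rewrite big_split /= mulrCA; do 2 congr (_ * _); apply: eq_bigr => u _; rewrite mxE.
by apply: eq_bigr => f _; rewrite big_distrr.
Qed.

(** * Determinants of permutation graphs with the arcs into [s] dropped *)

Section CycleMatrix.
Variables (R : comNzRingType) (n : nat) (s : 'I_n).

(* [1 - P_f], where the arcs of the functional graph of [f] that enter [s] are
   dropped *)
Definition fun_mx (f : 'I_n -> 'I_n) : 'M[R]_n :=
  \matrix_(u, v) ((u == v)%:R - ((v == f u) && (v != s))%:R).

(** Only the identity survives in Leibniz's formula: a permutation with a nonzero term follows [f]
    from any point it moves, until it would need the dropped arc into [s]. The diagonal entries are
    1 because only [s] can be a fixed point of [f]. *)
Lemma det_fun_mx_cycle (f : 'S_n) :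
  porbit f s = [set: 'I_n]%SET -> \det (fun_mx f) = 1.
Proof.
move=> fs; have reach u : exists i, s = (f ^+ i)%g u.
  have : s \in porbit f u by rewrite porbit_sym fs inE.
  by case/porbitP => i ->; exists i.
rewrite /determinant (bigD1 1%g) //= odd_perm1 expr0 mul1r.
rewrite big1 ?big1 ?addr0 // => [sg sg1|u _].
  suff [u hu] : exists u, (sg u != u) && ~~ ((sg u == f u) && (sg u != s)).
    rewrite (bigD1 u) //= mxE eq_sym; case/andP: hu => /negPf -> /negPf ->.
    by rewrite subrr mul0r mulr0.
  apply/existsP; apply: contraNT sg1; rewrite negb_exists => /forallP hsg.
  apply/eqP/permP => u; rewrite perm1; apply/eqP/negP => /negP su.
  have step v : sg v != v -> [/\ sg v = f v, f v != s & sg (f v) != f v].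
    move=> sv; have := hsg v; rewrite sv /= negbK => /andP[/eqP E]; rewrite E.
    by split=> //; rewrite -{2}E (inj_eq perm_inj) -E.
  have stay i : sg ((f ^+ i)%g u) != (f ^+ i)%g u.
    elim: i => [|i IHi]; first by rewrite expg0 perm1.
    by rewrite expgSr permM; have [_ _] := step _ IHi.
  have [[|i] Es] := reach (f u).
    have [_ + _] := step u su.
    by rewrite Es expg0 perm1 eqxx.
  have [_ + _] := step _ (stay i.+1).
  by rewrite -permM -expgSr expgS permM -Es eqxx.
rewrite mxE perm1 eqxx; case: eqP => //= Eu; last by rewrite subr0.
have [i Es] := reach u.
have -> : s = u.
  by rewrite Es; elim: i {Es} => [|i IHi]; rewrite ?expg0 ?perm1 // expgSr permM IHi -Eu.
by rewrite eqxx subr0.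
Qed.

(** The indicator vector of a cycle avoiding [s] lies in the kernel. Since it has an entry 1,
    multiplying by the adjugate shows that the determinant is 0 over any commutative ring. *)
Lemma det_fun_mx_noncycle (f : 'S_n) :
  porbit f s != [set: 'I_n]%SET -> \det (fun_mx f) = 0.
Proof.
move=> hs.
have [v hv] : exists v, v \notin porbit f s.
  apply/existsP; rewrite -negb_forall; apply: contra hs => /forallP h.
  by apply/eqP/setP => v; rewrite h inE.
pose col : 'cV[R]_n := \col_u (u \in porbit f v)%:R.
have ker : fun_mx f *m col = 0.
  apply/matrixP => u j; rewrite !mxE.
  under eq_bigr => w _ do rewrite !mxE mulrBl.
  have fuE : porbit f (f u) = porbit f u.
    by rewrite -(porbit_perm f 1 u) expg1.
  rewrite sumrB (bigD1 u) //= eqxx mul1r big1 => [|w wu]; last first.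
    by rewrite eq_sym (negPf wu) mul0r.
  rewrite (bigD1 (f u)) //= eqxx big1 => [|w wu]; last by rewrite (negPf wu) mul0r.
  have -> : (f u \in porbit f v) = (u \in porbit f v).
    by rewrite -!eq_porbit_mem fuE.
  rewrite !addr0; case: (boolP (u \in porbit f v)) => [uv|_]; last by rewrite mulr0 subrr.
  suff -> : f u != s by rewrite mul1r subrr.
  by apply: contra hv => /eqP <-; rewrite fuE porbit_sym.
have := congr1 (fun A => (\adj (fun_mx f) *m A) v 0) ker.
rewrite mulmxA mul_adj_mx mulmx0 mul_scalar_mx !mxE.
by rewrite porbit_id mulr1.
Qed.

End CycleMatrix.

(** Hamiltonian cycles, encoded by their successor permutations. *)
Definition cycle_perms n (s : 'I_n) (e : rel 'I_n) : {set 'S_n} :=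
  [set f : 'S_n | [forall u, e u (f u)] && (porbit f s == [set: 'I_n]%SET)]%SET.

(** * The signed sum counts Hamiltonian cycles *)

Section SignedSum.
Variables (R : comNzRingType) (n : nat) (s : 'I_n) (e : rel 'I_n).
Variables (b : 'S_n) (c : 'I_n -> 'I_n -> R).

(** The number [p] encodes the vector y, with y_w at bit position [b w]. The sum over all [p] is the
    same for every [b], which leaves [b] free to be chosen for the pruning. *)
Definition arc_weight (p : nat) (u w : 'I_n) : R :=
  (e u w)%:R * ((bit p (b w))%:R - c u w).

Definition laplacian (p : nat) : 'M[R]_n :=
  \matrix_(u, v) ((u == v)%:R * (\sum_w arc_weight p u w) -
                  (v != s)%:R * arc_weight p u v).

Definition signed_det (p : nat) : R :=
  (\prod_(w < n) ((bit p (b w))%:R *+ 2 - 1)) * \det (laplacian p).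

(** Grouping the factors by their target makes the sum factor over the bits. A target hit exactly
    once contributes [(1 - c) - (0 - c) = 1], a target never hit contributes [1 - 1 = 0], and a map
    that is not injective misses a target. *)
Let sum_signs (f : 'I_n -> 'I_n) :
  \sum_(p < 2 ^ n) (\prod_(w < n) ((bit p (b w))%:R *+ 2 - 1)) *
     \prod_u ((bit p (b (f u)))%:R - c u (f u)) = (injectiveb f)%:R.
Proof.
pose h (w : 'I_n) (t : nat) : R := (t%:R *+ 2 - 1) * \prod_(u | f u == w) (t%:R - c u w).
(* The factors are indexed by bit positions; the default 1 lies outside the range of the product. *)
pose h' i t := if insub i is Some i then h (b^-1 i)%g t else 1.
transitivity (\sum_(p < 2 ^ n) \prod_(i < n) h' i (bit p i)).
  apply: eq_bigr => p _; rewrite [RHS](reindex_inj (@perm_inj _ b)) /=.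
  rewrite [X in _ * X](partition_big f xpredT) //= -big_split /=.
  apply: eq_bigr => w _; rewrite /h' valK /= permK; congr (_ * _).
  by apply: eq_bigr => u /eqP ->.
rewrite sum_prod_bits (reindex_inj (@perm_inj _ b)) /=.
under eq_bigr => w _ do rewrite /h' valK /= permK /h mul0rn sub0r mulN1r -mulr_natr mul1r.
case: (boolP (injectiveb f)) => [/injectiveP fi|].
  apply: big1 => w _; have [g gf fg] := injF_bij fi.
  rewrite -(fg w); under eq_bigl => u do rewrite (inj_eq fi).
  under [X in _ + _ * X]eq_bigl => u do rewrite (inj_eq fi).
  by rewrite !big_pred1_eq; ring.
move=> fi; suff [w hw] : exists w, w \notin codom f.
  have fw : (fun u => f u == w) =1 pred0.
    by move=> u; apply/eqP => fu; rewrite -fu codom_f in hw.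
  by rewrite (bigD1 w) //= !(big_pred0 _ _ _ _ fw); ring.
apply/existsP; apply: contraNT fi; rewrite negb_exists => /forallP onto.
have /fintype.image_injP fi : #|fintype.image f predT| == #|[pred _ : 'I_n | true]|.
  by apply/eqP/eq_card => w; have := onto w; rewrite negbK => ->.
by apply/injectiveP => u v fuv; apply: (fi u v).
Qed.

Lemma sum_signed_det :
  \sum_(p < 2 ^ n) signed_det p = (#|cycle_perms s e|)%:R.
Proof.
have lapE p : laplacian p = \matrix_(u, v)
    \sum_w arc_weight p u w * ((u == v)%:R - ((v == w) && (v != s))%:R).
  apply/matrixP => u v; rewrite !mxE; under [RHS]eq_bigr => w _ do rewrite mulrBr.
  rewrite sumrB -big_distrl /= mulrC; congr (_ - _).
  rewrite (bigD1 v) //= eqxx /= big1 ?addr0 1?mulrC // => w wv.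
  by rewrite eq_sym (negPf wv) mulr0.
pose F (f : {ffun 'I_n -> 'I_n}) : R := (\prod_u (e u (f u))%:R) * (injectiveb f)%:R *
  \det (fun_mx R s f).
transitivity (\sum_(f : {ffun 'I_n -> 'I_n}) F f).
  under eq_bigr => p _ do rewrite /signed_det lapE det_sum_rows big_distrr /=.
  rewrite exchange_big /=; apply: eq_bigr => f _.
  rewrite /F -sum_signs [X in _ = X * _]big_distrr [RHS]big_distrl /=; apply: eq_bigr => p _.
  rewrite big_split /= mulrA; congr (_ * _).
  ring.
rewrite (bigID (fun f : {ffun _} => injectiveb f)) /= [X in _ + X]big1 ?addr0; last first.
  by move=> f /negPf fi; rewrite /F fi mulr0 mul0r.
(* The remaining injective maps are exactly the permutations; the default of [fp] concerns only the
   maps already discarded. *)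
pose fp (f : {ffun 'I_n -> 'I_n}) : 'S_n := insubd (1%g : 'S_n) f.
rewrite (reindex (fun g : 'S_n => pval g)) /=; last first.
  exists fp => [g _|f]; rewrite /fp; first exact: (valKd (1%g : 'S_n) g).
  by move=> fi; apply: (insubdK (1%g : 'S_n)).
rewrite (eq_bigl xpredT); last by move=> g; apply: (valP g : injectiveb (pval g)).
rewrite -sum1_card natr_sum [RHS]big_mkcond /=; apply: eq_bigr => g _.
rewrite /F (valP g : injectiveb (pval g)) mulr1 inE.
have -> : fun_mx R s (pval g) = fun_mx R s g.
  by apply/matrixP => u v; rewrite !mxE pvalE.
case: (boolP [forall u, e u (g u)]) => [/forallP eg|]; last first.
  by case/forallPn => u /negPf ug; rewrite (bigD1 u) //= pvalE ug !mul0r.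
rewrite big1 ?mul1r => [|u _]; last by rewrite pvalE eg.
case: (boolP (porbit g s == _)) => [/eqP gs|gs] /=.
  exact: det_fun_mx_cycle.
exact: det_fun_mx_noncycle.
Qed.

End SignedSum.

(** The successor map of a Hamiltonian cycle has a single orbit; conversely, the orbit of [s] lists
    the cycle. *)
Lemma hamiltonian_cycle_perms (G : digraph) (s : 'I_(nvert G)) :
  hamiltonian G <-> (0 < #|cycle_perms s (@adj G)|)%N.
Proof.
have porbit_fconnect (f : 'S_(nvert G)) u : (u \in porbit f s) = fconnect f s u.
  apply/porbitP/idP => [[i ->]|/iter_findex <-].
    by rewrite permX fconnect_iter.
  by exists (findex f s u); rewrite permX.
split=> [[c [/andP[cyc unq] cT]]|/card_gt0P[f]].
- have inj : injective (next c) by apply: can_inj (prev_next unq).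
  apply/card_gt0P; exists (perm inj); rewrite inE; apply/andP; split.
    by apply/forallP => u; rewrite permE; apply: next_cycle.
  apply/eqP/setP => u; rewrite porbit_fconnect [RHS]inE.
  rewrite (eq_fconnect (permE inj)) (@fconnect_cycle _ _ c) ?cT //.
  exact: cycle_next.
- rewrite inE => /andP[/forallP ef /eqP fs]; exists (orbit f s); split.
    rewrite /ucycle orbit_uniq andbT.
    apply: sub_cycle (cycle_orbit (@perm_inj _ f) s) => u v /eqP <-; exact: ef.
  by move=> v; rewrite -fconnect_orbit -porbit_fconnect fs inE.
Qed.

(** * Division-free computation of a determinant *)

Lemma coef_prod_linear (R : comNzRingType) (I : Type) (r : seq I) (c d : I -> R) :
  let P := \prod_(i <- r) ((c i)%:P + 'X * (d i)%:P) in
  (size P <= (size r).+1)%N /\ P`_(size r) = \prod_(i <- r) d i.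
Proof.
elim: r => [|i r [IHs IHc]] /=; first by rewrite !big_nil size_poly1 coef1.
rewrite !big_cons mulrDl; set P := \prod_(j <- r) _ in IHs IHc *.
rewrite -mulrA -commr_polyX mul_polyC mul_polyC; split.
  apply: leq_trans (size_polyD _ _) _; rewrite geq_max.
  rewrite (leq_trans (size_scale_leq _ _)) ?(leq_trans IHs) //.
  have [->|nz] := eqVneq (d i *: P) 0; first by rewrite mul0r size_poly0.
  by rewrite size_mulX // ltnS (leq_trans (size_scale_leq _ _)).
by rewrite coefD coefMX /= !coefZ IHc nth_default ?mulr0 ?add0r.
Qed.

Section DetSeries.
Variables (R : comNzRingType) (n : nat) (A : 'M[R]_n).

(* [1 + X A] with the rows of [A] of index less than [i] replaced by 0 *)
Definition tail_mx (i : nat) : 'M[{poly R}]_n :=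
  \matrix_(u, v) ((u == v)%:R + (if (i <= u)%N then 'X * (A u v)%:P else 0)).

Definition tail_det (i : nat) : {poly R} := \det (tail_mx i).

(** Row [i] of [A] times the adjugate of [tail_mx i.+1]. At [v = i] this is the determinant of
    [tail_mx i.+1] with its row [i] replaced by that of [A]. *)
Definition tail_row (i : 'I_n) (v : 'I_n) : {poly R} :=
  \sum_j (A i j)%:P * cofactor (tail_mx i.+1) v j.

Lemma tail_det_top : tail_det n = 1.
Proof.
rewrite /tail_det (_ : tail_mx n = 1%:M) ?det1 //.
by apply/matrixP => u v; rewrite !mxE leqNgt ltn_ord addr0.
Qed.

(** The determinant is linear in row [i], which is a unit row plus ['X] times the row of [A]. *)
Lemma tail_det_step (i : 'I_n) :
  tail_det i = tail_det i.+1 + 'X * tail_row i i.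
Proof.
pose C : 'M[{poly R}]_n := \matrix_(u, v) (if u == i then (A i v)%:P else tail_mx i.+1 u v).
have lift_neq u : (lift i u == i) = false.
  by rewrite eq_sym (negPf (neq_lift _ _)).
have lift_neqn u : (i == lift i u :> nat) = false.
  by rewrite -(lift_neq u) eq_sym.
have -> : tail_row i i = \det C.
  rewrite (expand_det_row _ i); apply: eq_bigr => j _.
  rewrite mxE eqxx; congr (_ * _).
  rewrite /cofactor; congr (_ * \det _); apply/matrixP => u v; rewrite !mxE.
  by rewrite lift_neq.
rewrite -[tail_det i.+1]mul1r; apply: (determinant_multilinear (i0 := i)).
- by apply/rowP => v; rewrite !mxE leqnn ltnn eqxx addr0 mul1r.
- apply/matrixP => u v; rewrite !mxE ltn_neqAle.
  by rewrite lift_neqn.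
- apply/matrixP => u v; rewrite !mxE lift_neq ltn_neqAle.
  by rewrite lift_neqn.
Qed.

(** A row times the adjugate times the matrix is the determinant times that row. The matrix being 1
    plus a multiple of ['X], this determines [tail_row] degree by degree without divisions. *)
Lemma tail_row_eq (i v : 'I_n) :
  tail_row i v + 'X * \sum_(l < n | (i < l)%N) tail_row i l * (A l v)%:P =
  tail_det i.+1 * (A i v)%:P.
Proof.
pose a : 'rV[{poly R}]_n := \row_j (A i j)%:P.
have := congr1 (fun B => (a *m B) 0 v) (mul_adj_mx (tail_mx i.+1)).
rewrite mulmxA mul_mx_scalar !mxE -/(tail_det _) => <-.
have xE l : (a *m \adj (tail_mx i.+1)) 0 l = tail_row i l.
  by rewrite mxE; apply: eq_bigr => j _; rewrite !mxE.
under [RHS]eq_bigr => l _ do rewrite xE mxE mulrDr.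
rewrite big_split /=; congr (_ + _).
  rewrite (bigD1 v) //= eqxx mulr1 big1 ?addr0 // => l lv.
  by rewrite (negPf lv) mulr0.
rewrite big_distrr /= big_mkcond; apply: eq_bigr => l _ /=.
by case: ifP => _; rewrite ?mulr0 // mulrCA.
Qed.

Lemma tail_det_coef0 i : (i <= n)%N -> (tail_det i)`_0 = 1.
Proof.
move=> iN; rewrite -(subKn iN); move: (n - i)%N (leq_subr i n) => j; elim: j => [|j IHj] jn.
  by rewrite subn0 tail_det_top coef1.
have hj : (n - j.+1 < n)%N by lia.
rewrite (tail_det_step (Ordinal hj)) /= coefD coefXM addr0.
by rewrite (_ : (n - j.+1).+1 = n - j)%N ?IHj //; lia.
Qed.

Lemma tail_det_coefS (i : 'I_n) k :
  (tail_det i)`_k.+1 = (tail_det i.+1)`_k.+1 + (tail_row i i)`_k.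
Proof. by rewrite tail_det_step coefD coefXM. Qed.

(** The recurrence executed by [det_entry]. *)
Lemma tail_row_coef (i v : 'I_n) k :
  (tail_row i v)`_k = (tail_det i.+1)`_k * A i v -
    (if k is j.+1 then \sum_(l < n | (i < l)%N) (tail_row i l)`_j * A l v else 0).
Proof.
rewrite -coefMC -tail_row_eq coefD coefXM; case: k => [|j] /=.
  by rewrite addr0 subr0.
have -> : (\sum_(l < n | (i < l)%N) tail_row i l * (A l v)%:P)`_j =
    \sum_(l < n | (i < l)%N) (tail_row i l)`_j * A l v.
  by rewrite coef_sum; apply: eq_bigr => l _; rewrite coefMC.
by rewrite addrK.
Qed.

(** Each term of Leibniz's formula is a product of [n] linear factors, whose top coefficient is a
    product of entries of [A]. *)
Lemma tail_det_coef : (tail_det 0)`_n = \det A.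
Proof.
rewrite /tail_det /determinant coef_sum; apply: eq_bigr => sg _.
rewrite -[(-1) ^+ sg in LHS](rmorph_sign polyC).
rewrite coefCM; congr (_ * _).
under eq_bigr => u _ do rewrite mxE leq0n -[_%:R]/(_%:R) -(rmorph_nat polyC).
have [_] := coef_prod_linear (index_enum 'I_n) (fun u => (u == sg u)%:R) (fun u => A u (sg u)).
suff -> : size (index_enum 'I_n) = n by [].
by rewrite [index_enum _]unlock -enumT size_enum_ord.
Qed.

End DetSeries.

Local Open Scope nat_scope.

(** * Skipping blocks of vanishing determinants *)

Lemma bit_eq_div p p' i j : j <= i -> p %/ 2 ^ j = p' %/ 2 ^ j -> bit p i = bit p' i.
Proof. by move=> ji E; rewrite /bit -(subnKC ji) expnD !divnMA E. Qed.

Section Search.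
Variables (n : nat) (e : rel 'I_n) (b : 'S_n) (c : 'I_n -> 'I_n -> bool).

Definition violated (p : nat) (u : 'I_n) : bool :=
  [forall w, e u w ==> (bit p (b w) == c u w)].

(** Whether row [u] is violated depends only on the bits from [low_bit u] upwards. A row without
    out-neighbours is always violated and gets the value [n]. *)
Definition low_bit (u : 'I_n) : nat := \big[minn/n]_(w | e u w) b w.

Definition skip (p : nat) : nat := \max_(u | violated p u) low_bit u.

Definition next_index (p : nat) : nat := (p %/ 2 ^ skip p).+1 * 2 ^ skip p.

(** On the aligned block number [q] of size [2 ^ j], no row decided by the bits from [j] upwards is
    violated. *)
Definition alive (j q : nat) : bool :=
  [forall u, ~~ ((j <= low_bit u) && violated (q * 2 ^ j) u)].

(** Counts the aligned blocks not yet passed at [p] that are the whole range or have an alive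
    parent, [q./2] being the parent of [q]. Each visit of the search passes such a block. *)
Definition potential (p : nat) : nat :=
  \sum_(j < n.+1) \sum_(q < 2 ^ (n - j))
    [&& (j == n :> nat) || alive j.+1 q./2 & p < q.+1 * 2 ^ j].

Lemma low_bit_le u : low_bit u <= n.
Proof.
rewrite /low_bit; elim/big_ind: _ => // [x y hx hy|w _].
  by rewrite geq_min hx.
exact: ltnW.
Qed.

Lemma low_bit_leP j u : j <= n ->
  reflect (forall w, e u w -> j <= b w) (j <= low_bit u).
Proof.
move=> jn; rewrite /low_bit; apply: (iffP idP) => [h w ew|h].
  apply: leq_trans h _; have := mem_index_enum w; elim: (index_enum _) => //= v r IH.
  rewrite inE big_cons; case/predU1P => [<-|/IH h]; first by rewrite ew geq_min leqnn.
  by case: ifP => // _; rewrite geq_min h orbT.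
by elim/big_ind: _ => // x y hx hy; rewrite leq_min hx.
Qed.

Lemma skip_le p : skip p <= n.
Proof. by apply/bigmax_leqP => u _; apply: low_bit_le. Qed.

Lemma next_index_gt p : p < next_index p.
Proof. by rewrite /next_index {1}(divn_eq p (2 ^ skip p)) mulSn addnC ltn_add2r ltn_pmod // expn_gt0. Qed.

Lemma next_index_le p : p < 2 ^ n -> next_index p <= 2 ^ n.
Proof.
move=> hp; have := skip_le p; rewrite /next_index; move: (skip p) => j jn.
have E : 2 ^ n = 2 ^ (n - j) * 2 ^ j by rewrite -expnD subnK.
by rewrite E leq_mul2r expn_eq0 /= ltn_divLR ?expn_gt0 // -E.
Qed.

Lemma violated_eq_div j p p' u : j <= n -> j <= low_bit u ->
  p %/ 2 ^ j = p' %/ 2 ^ j -> violated p u = violated p' u.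
Proof.
move=> jn /(low_bit_leP _ jn) hu E; apply: eq_forallb => w.
by case: (boolP (e u w)) => //= /hu jw; rewrite (bit_eq_div jw E).
Qed.

Lemma violated_skip p : 0 < skip p ->
  exists2 u, violated p u & low_bit u = skip p.
Proof.
move=> sp; have [u0 hu0] : exists u, violated p u.
  apply/existsP; apply: contraTT sp; rewrite negb_exists => /forallP h.
  by rewrite /skip big_pred0 // => u; apply/negbTE.
have := @eq_bigmax_cond _ (violated p) low_bit.
case; first by apply/card_gt0P; exists u0.
by move=> u hu E; exists u.
Qed.

(** Indices jumped over agree with [p] on all bits from [skip p] upwards, so the row causing the
    jump is violated there too. *)
Lemma violated_skipped p p' : p < p' -> p' < next_index p ->
  exists u, violated p' u.
Proof.
rewrite /next_index => pp' hp'; have [s0|sp] := posnP (skip p).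
  by move: hp'; rewrite s0 expn0 divn1 muln1 ltnS leqNgt pp'.
have [u hu us] := violated_skip sp.
have := hp'; rewrite -ltn_divLR ?expn_gt0 // ltnS => le1.
have le2 := leq_div2r (2 ^ skip p) (ltnW pp').
exists u; rewrite (@violated_eq_div (skip p) p' p) ?us ?skip_le //.
by apply/eqP; rewrite eqn_leq le1 le2.
Qed.

(** The block jumped over leaves the count. It was counted at [p]: by maximality of [skip p], no row
    decided on its parent is violated. *)
Lemma potential_next p : p < 2 ^ n -> potential (next_index p) < potential p.
Proof.
move=> hp; have jn := skip_le p; pose j : 'I_n.+1 := Ordinal (jn : skip p < n.+1).
have hq : p %/ 2 ^ j < 2 ^ (n - j).
  by rewrite ltn_divLR ?expn_gt0 // -expnD subnK.
pose q := Ordinal hq.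
have mono (i : 'I_n.+1) (r : 'I_(2 ^ (n - i))) :
    ([&& (i == n :> nat) || alive i.+1 r./2 & next_index p < r.+1 * 2 ^ i] <=
     [&& (i == n :> nat) || alive i.+1 r./2 & p < r.+1 * 2 ^ i])%N.
  case: (_ || _) => //=; case: (ltnP (next_index p)) => //= h.
  by rewrite (ltn_trans (next_index_gt p) h).
rewrite /potential (bigD1 j) //= [X in _ < X](bigD1 j) //=.
rewrite (bigD1 q) //= [X in _ < X + _](bigD1 q) //=.
rewrite ltnn andbF add0n next_index_gt andbT.
suff -> : (skip p == n) || alive (skip p).+1 (p %/ 2 ^ skip p)./2.
  rewrite add1n addSn ltnS leq_add //; first by apply: leq_sum => r _; exact: (mono j r).
  by apply: leq_sum => i _; apply: leq_sum => r _; apply: mono.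
case: eqVneq => //= jn'; apply/forallP => u; apply/negP => /andP[hu].
have jn1 : skip p < n by rewrite ltn_neqAle jn' jn.
rewrite (@violated_eq_div (skip p).+1 _ p) // => [vu|]; last first.
  by rewrite mulnK ?expn_gt0 // -divn2 [in RHS]expnSr divnMA.
have := @leq_bigmax_cond _ (violated p) low_bit u vu.
by rewrite -/(skip p) leqNgt hu.
Qed.

(** The whole range contributes at most 1, and every alive block has two children. *)
Lemma potential0_le :
  potential 0 <= 1 + \sum_(j < n) 2 * \sum_(q < 2 ^ (n - j.+1)) alive j.+1 q.
Proof.
rewrite /potential big_ord_recr /= subnn expn0 addnC leq_add //.
  by rewrite big_ord_recl big_ord0 addn0 leq_b1.
apply: leq_sum => j _; rewrite [j == n :> nat]ltn_eqF //=.
have -> : 2 ^ (n - j) = (2 ^ (n - j.+1)).*2.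
  by rewrite -mul2n -expnS -subSn // subSS.
move: (2 ^ (n - j.+1)) => m; rewrite big_distrr /=.
rewrite -(big_mkord xpredT (fun q => 2 * alive j.+1 q)).
rewrite -(big_mkord xpredT (fun q => nat_of_bool (alive j.+1 q./2 && (0 < q.+1 * 2 ^ j)))).
elim: m => [|m IH]; first by rewrite !big_geq.
rewrite doubleS !big_nat_recr //= -addnA leq_add //.
rewrite uphalf_double doubleK; case: (alive _ _) => //=.
exact: leq_add (leq_b1 _) (leq_b1 _).
Qed.

End Search.

(** * Jumps lose no summand *)

Section Vanish.
Variables (R : comNzRingType) (n : nat) (s : 'I_n) (e : rel 'I_n) (b : 'S_n).
Variable c : 'I_n -> 'I_n -> bool.

Let sdet := signed_det s e b (fun u w => (c u w)%:R : R)%R.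

Lemma signed_det_violated p u : violated e b c p u -> sdet p = 0%R.
Proof.
move=> /forallP h; rewrite /sdet /signed_det.
have a0 w : arc_weight e b (fun u w => (c u w)%:R : R)%R p u w = 0%R.
  rewrite /arc_weight; have := h w; case: (e u w) => [/eqP ->|_].
    by rewrite subrr mulr0.
  by rewrite mul0r.
rewrite (expand_det_row _ u) [X in (_ * X)%R]big1 ?mulr0 // => v _.
by rewrite mxE a0 big1 ?mulr0 ?subrr ?mul0r // => w _; rewrite a0.
Qed.

Lemma sum_signed_det_next p :
  (\sum_(p <= i < next_index e b c p) sdet i = sdet p)%R.
Proof.
rewrite big_ltn ?next_index_gt // big_nat_cond big1 ?addr0 // => i.
rewrite andbT => /andP[pi ip]; have [u hu] := violated_skipped pi ip.
exact: signed_det_violated hu.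
Qed.

End Vanish.

(** * Expected number of visited blocks *)

Section Coins.
Variables (n : nat) (e : rel 'I_n) (b : 'S_n).

Definition outdeg (u : 'I_n) : nat := #|[set w | e u w]%SET|.

Lemma card_agree (y : 'I_n -> bool) u :
  #|[set r : {ffun 'I_n -> bool} | [forall w, e u w ==> (y w == r w)]]%SET| =
  2 ^ (n - outdeg u).
Proof.
pose F (w : 'I_n) : pred bool := if e u w then pred1 (y w) else predT.
have -> : #|[set r : {ffun 'I_n -> bool} | [forall w, e u w ==> (y w == r w)]]%SET| =
    #|family F|.
  apply: eq_card => r; rewrite inE; apply: eq_forallb => w.
  by rewrite -[RHS]/(F w (r w)) /F eq_sym; case: (e u w).
rewrite card_family foldrE big_map big_enum /=.
rewrite (bigID (e u)) /= big1 ?mul1n; last first.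
  by move=> w ew; rewrite /F ew card1.
rewrite (eq_bigr (fun=> 2)); last by move=> w /negPf ew; rewrite /F ew card_bool.
rewrite prod_nat_const; congr (2 ^ _).
have := cardsC [set w | e u w]%SET; rewrite card_ord /outdeg => E.
rewrite -[n in n - _]E addKn; apply: eq_card => w; rewrite !inE //.
Qed.

(** The number of coin matrices leaving a block of size [2 ^ j] alive: a decided row excludes the
    coins that agree with the block on all out-neighbours. *)
Definition survivors (j : nat) : nat :=
  \prod_u (if j <= low_bit e b u then 2 ^ n - 2 ^ (n - outdeg u) else 2 ^ n).

(** The rows of the coin matrix are independent, so the count is a product over rows, the same for
    every block [q]. *)
Lemma card_alive j q :
  #|[set f : {ffun 'I_n -> {ffun 'I_n -> bool}} |
       alive e b (fun u w => f u w) j q]%SET| = survivors j.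
Proof.
rewrite -sum1_card big_mkcond /=.
pose G u (r : {ffun 'I_n -> bool}) : nat :=
  ~~ ((j <= low_bit e b u) && [forall w, e u w ==> (bit (q * 2 ^ j) (b w) == r w)]).
transitivity (\sum_(f : {ffun 'I_n -> {ffun 'I_n -> bool}}) \prod_u G u (f u)).
  apply: eq_bigr => f _; rewrite inE /alive.
  case: forallP => [h|h]; first by rewrite big1 // => u _; rewrite /G (h u).
  have /forallPn[u hu] : ~~ [forall u, ~~ ((j <= low_bit e b u) &&
      violated e b (fun u w => f u w) (q * 2 ^ j) u)] by apply/forallP.
  rewrite negbK in hu.
  by rewrite (bigD1 u) //= /G -/(violated e b (fun u w => f u w) (q * 2 ^ j) u) hu.
rewrite -bigA_distr_bigA; apply: eq_bigr => u _.
rewrite /G; case: (j <= _) => /=; last first.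
  by rewrite sum1_card card_ffun card_bool card_ord.
rewrite -(card_agree (fun w => bit (q * 2 ^ j) (b w) == 1) u).
have := cardsC [set r : {ffun 'I_n -> bool} |
  [forall w, e u w ==> ((bit (q * 2 ^ j) (b w) == 1) == r w)]]%SET.
rewrite card_ffun card_bool card_ord => {1}<-; rewrite addKn -sum1_card big_mkcond /=.
rewrite [RHS]big_mkcond; apply: eq_bigr => r _; rewrite !inE.
have -> : [forall w, e u w ==> (bit (q * 2 ^ j) (b w) == r w)] =
          [forall w, e u w ==> ((bit (q * 2 ^ j) (b w) == 1) == r w)].
  apply: eq_forallb => w; congr (_ ==> _); rewrite /bit.
  by have := ltn_pmod (q * 2 ^ j %/ 2 ^ b w) (isT : 0 < 2); case: (_ %% 2) => [|[|]] //; case: (r w).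
by case: [forall _, _].
Qed.

End Coins.

(** * Coin matrices read off the random tape *)

Section CoinTuples.
Variable n : nat.

Definition coins_of (w : seq bool) : {ffun 'I_n -> {ffun 'I_n -> bool}} :=
  [ffun u : 'I_n => [ffun v : 'I_n => nth false w (n * u + v)]].

(** The matrix fixes the first [n * n] bits of the tape and leaves the others free. *)
Lemma card_coins_of (T : nat) f : n * n <= T ->
  #|[set w : T.-tuple bool | coins_of w == f]%SET| = 2 ^ (T - n * n).
Proof.
move=> /subnKC <-; rewrite addKn; move: (T - n * n) => r.
pose pre := mkseq (fun i => if (insub (i %/ n), insub (i %% n)) is (Some u, Some v)
                   then (f u) v else false) (n * n).
have szpre : size pre == n * n by rewrite size_mkseq.
pose ext (t : r.-tuple bool) := cat_tuple (Tuple szpre) t.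
have ext_inj : injective ext.
  move=> t t' /(congr1 (fun x => drop (n * n) (val x))) /=.
  by rewrite !drop_size_cat ?(eqP szpre) // => /val_inj.
have nth_pre (u v : 'I_n) : nth false pre (n * u + v) = f u v.
  have n0 : 0 < n by apply: leq_trans (ltn_ord u).
  rewrite nth_mkseq; last by have := ltn_ord u; have := ltn_ord v; nia.
  rewrite mulnC divnMDl // divn_small // addn0 valK.
  by rewrite modnMDl modn_small // valK.
have idx (u v : 'I_n) : n * u + v < n * n.
  by have := ltn_ord u; have := ltn_ord v; nia.
transitivity #|ext @: [set: r.-tuple bool]%SET|; last first.
  by rewrite card_imset // cardsT card_tuple card_bool.
apply: eq_card => w; rewrite inE; apply/eqP/imsetP => [Ew|[t _ ->]]; last first.
  apply/ffunP => u; apply/ffunP => v; rewrite !ffunE /=.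
  by rewrite nth_cat (eqP szpre) idx nth_pre.
have szd : size (drop (n * n) w) == r by rewrite size_drop size_tuple addKn.
exists (Tuple szd) => //; apply/val_inj => /=.
rewrite -[LHS](cat_take_drop (n * n)); congr (_ ++ _).
have szt : size (take (n * n) w) = n * n by rewrite size_takel // size_tuple leq_addr.
apply: (@eq_from_nth _ false); rewrite szt ?(eqP szpre) // => i hi.
have n0 : 0 < n by move: hi; case: (n).
have h1 : i %/ n < n by rewrite ltn_divLR.
have h2 : i %% n < n by rewrite ltn_pmod.
rewrite nth_take // (divn_eq i n) mulnC.
rewrite -[i %/ n]/(nat_of_ord (Ordinal h1)) -[i %% n]/(nat_of_ord (Ordinal h2)).
by rewrite nth_pre -Ew !ffunE.
Qed.

Lemma sum_coins_of (T : nat) (g : {ffun 'I_n -> {ffun 'I_n -> bool}} -> nat) :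
  n * n <= T ->
  \sum_(w : T.-tuple bool) g (coins_of w) = 2 ^ (T - n * n) * \sum_f g f.
Proof.
move=> nT; rewrite (partition_big (fun w : T.-tuple bool => coins_of w) xpredT) //=.
rewrite big_distrr; apply: eq_bigr => f _ /=.
rewrite (eq_bigr (fun=> g f)) => [|w /eqP -> //].
rewrite sum_nat_const -(card_coins_of f nT); congr (_ * _).
by apply: eq_card => w; rewrite inE.
Qed.

End CoinTuples.

(** * Expectations, written as sums over all tapes *)

Section Expectation.
Variables (n : nat) (e : rel 'I_n) (b : 'S_n) (T : nat).
Hypothesis nT : n * n <= T.
Local Open Scope ring_scope.

Definition blocks (w : seq bool) : nat :=
  potential e b (fun u v => coins_of n w u v) 0.

(** The probability that row [u] is not violated at a given index. *)
Definition kept (u : 'I_n) : rat := 1 - 2^-1 ^+ outdeg e u.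

(** The expected number of alive blocks of size [2 ^ j]. *)
Definition rate (j : nat) : rat :=
  2 ^+ (n - j) * \prod_(u | (j <= low_bit e b u)%N) kept u.

Lemma kept_ge0 u : 0 <= kept u.
Proof. by rewrite subr_ge0 exprn_ile1. Qed.

Lemma outdeg_le u : (outdeg e u <= n)%N.
Proof. by rewrite -[X in (_ <= X)%N]card_ord; apply: max_card. Qed.

Lemma survivors_rate j : (survivors e b j)%:R =
  2 ^+ (n * n) * \prod_(u | (j <= low_bit e b u)%N) kept u :> rat.
Proof.
have -> : 2 ^+ (n * n) = \prod_(u < n) 2 ^+ n :> rat.
  by rewrite prodr_const card_ord exprM.
rewrite /survivors natr_prod [X in _ * X]big_mkcond -big_split /=.
apply: eq_bigr => u _; case: ifP => _; last by rewrite mulr1 natrX.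
rewrite natrB; last by rewrite leq_exp2l // leq_subr.
rewrite !natrX mulrBr mulr1; congr (_ - _).
by rewrite exprVn expfB_cond ?outdeg_le // pnatr_eq0.
Qed.

Lemma sum_blocks :
  (\sum_(w : T.-tuple bool) blocks w)%:R <=
    2 ^+ T * (1 + 2 * \sum_(j < n) rate j.+1) :> rat.
Proof.
pose g (f : {ffun 'I_n -> {ffun 'I_n -> bool}}) : nat :=
  (1 + \sum_(j < n) 2 * \sum_(q < 2 ^ (n - j.+1)) alive e b (fun u v => f u v) j.+1 q)%N.
apply: (@le_trans _ _ (\sum_(w : T.-tuple bool) g (coins_of n w))%N%:R).
  by rewrite ler_nat; apply: leq_sum => w _; apply: potential0_le.
rewrite sum_coins_of // natrM natrX.
have E : (\sum_f g f)%:R = 2 ^+ (n * n) * (1 + 2 * \sum_(j < n) rate j.+1) :> rat.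
  rewrite /g big_split /= sum1_card !card_ffun card_bool card_ord.
  rewrite mulrDr mulr1 natrD -expnM natrX; congr (_ + _).
  rewrite exchange_big natr_sum mulrA big_distrr /=; apply: eq_bigr => j _.
  rewrite -big_distrr exchange_big /=.
  rewrite (eq_bigr (fun=> survivors e b j.+1)) => [|q _]; last first.
    rewrite -(card_alive e b j.+1 q) -sum1_card [RHS]big_mkcond /=.
    by apply: eq_bigr => f _; rewrite inE; case: (alive _ _ _ _ _).
  rewrite sum_nat_const card_ord !natrM natrX survivors_rate /rate.
  by rewrite mulrCA [in RHS]mulrAC -!mulrA; ring.
by rewrite E mulrA -exprD subnK.
Qed.

End Expectation.

(** * A greedy elimination order *)

Section Greedy.
Variables (n : nat) (e : rel 'I_n).

Definition avoids (U : {set 'I_n}) (u : 'I_n) : bool := [forall w, e u w ==> (w \notin U)].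

(** If [U] occupies the lower bit positions and [w] receives the next one, these are the rows whose
    lowest bit is that of [w]. The sum of [1 / outdeg] is scaled by n! to stay integral. *)
Definition load (U : {set 'I_n}) (w : 'I_n) : nat :=
  \sum_(u | e u w && avoids U u) n`! %/ outdeg e u.

(* Hall's condition makes the loads of the unused vertices at most [n!] on average. *)
Lemma load_le_fact (f : 'S_n) (U : {set 'I_n}) : (forall u, e u (f u)) ->
  U != [set: 'I_n]%SET -> exists2 w, w \notin U & load U w <= n`!.
Proof.
move=> ef UT; have [|h] := boolP [exists w, (w \notin U) && (load U w <= n`!)].
  by case/existsP => w /andP[? ?]; exists w.
exfalso; have big w : w \in ~: U -> n`! < load U w.
  by rewrite inE => wU; move: h => /existsPn/(_ w); rewrite wU /= -ltnNge.
have W0 : 0 < #|~: U|.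
  rewrite card_gt0; apply: contraNneq UT => E; apply/eqP/finset.setP => x.
  by have := finset.in_set0 x; rewrite -E !inE => /negbFE ->.
have : \sum_(w in ~: U) load U w <= n`! * #|~: U|.
  rewrite /load (exchange_big_dep (avoids U)) /=; last by move=> w u _ /andP[].
  apply: (@leq_trans (\sum_(u | avoids U u) n`!)).
    (* A row gives its share of n! to at most [outdeg e u] vertices. *)
    apply: leq_sum => u hu; rewrite sum_nat_const.
    apply: leq_trans (leq_divM n`! (outdeg e u)); rewrite mulnC leq_mul2l; apply/orP; right.
    apply: subset_leq_card; apply/fintype.subsetP => w; rewrite !inE.
    by move=> /and3P[].
  rewrite sum_nat_const mulnC leq_mul2l; apply/orP; right.
  (* The cycle cover [f] maps the rows avoiding [U] injectively into the complement of [U]. *)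
  rewrite -(card_imset [pred u | avoids U u] (@perm_inj _ f)).
  apply: subset_leq_card; apply/fintype.subsetP => w /imsetP[u /forallP hu ->].
  by rewrite inE; apply: (implyP (hu (f u))).
apply/negP; rewrite -ltnNge.
apply: (@leq_trans (\sum_(w in ~: U) n`!.+1)).
  by rewrite sum_nat_const [X in _ < X]mulnC ltn_pmul2r.
by apply: leq_sum => w; apply: big.
Qed.

End Greedy.

(** * Effect of the greedy order on the expectation *)

Section Rate.
Variables (n : nat) (e : rel 'I_n) (b : 'S_n).
Hypothesis outdeg0 : forall u, 0 < outdeg e u.
Hypothesis greedy : forall w,
  \sum_(u | e u w && (b w <= low_bit e b u)) n`! %/ outdeg e u <= n`!.
Local Open Scope ring_scope.

Lemma bernoulli_sub (F : numDomainType) (x : F) k :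
  0 <= x <= 1 -> 1 - x *+ k <= (1 - x) ^+ k.
Proof.
move=> /andP[x0 x1]; elim: k => [|k IH]; first by rewrite expr0 mulr0n subr0.
apply: (@le_trans _ _ ((1 - x *+ k) * (1 - x))); last first.
  by rewrite exprSr ler_wpM2r // subr_ge0.
have -> : (1 - x *+ k) * (1 - x) = 1 - x *+ k.+1 + (x * x) *+ k.
  by rewrite mulrSr -[in RHS]mulrnAl; ring.
by rewrite lerDl mulrn_wge0 // mulr_ge0.
Qed.

(** With [k = outdeg e u], Bernoulli's inequality gives the lower bound [1 - k / 2 ^ k], and
    [k <= 2 ^ (k - 1)]. *)
Lemma kept_exp_ge u : 2^-1 <= kept e u ^+ outdeg e u.
Proof.
have := outdeg0 u; rewrite /kept; case: (outdeg e u) => // k _.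
apply: le_trans (bernoulli_sub _ _); last by rewrite exprn_ge0 ?exprn_ile1.
have -> : 2^-1 ^+ k.+1 *+ k.+1 = 2^-1 * (2^-1 ^+ k * k.+1%:R) :> rat.
  by rewrite exprS -[LHS]mulr_natr mulrA.
have : 2^-1 ^+ k * k.+1%:R <= 1 :> rat.
  rewrite exprVn mulrC ler_pdivrMr ?exprn_gt0 // mul1r -natrX ler_nat.
  exact: ltn_expl.
lra.
Qed.

(** After raising to the power n!, each factor is at least one half to the power n! divided by its
    outdegree, and these exponents add up to at most n!. *)
Lemma prod_kept_ge (P : pred 'I_n) :
  (\sum_(u | P u) n`! %/ outdeg e u <= n`!)%N -> 2^-1 <= \prod_(u | P u) kept e u.
Proof.
move=> hP; have F0 := fact_gt0 n.
rewrite -(ler_pXn2r F0) ?nnegrE ?invr_ge0 ?prodr_ge0 // => [|u _]; last exact: kept_ge0.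
apply: (@le_trans _ _ (\prod_(u | P u) 2^-1 ^+ (n`! %/ outdeg e u))).
  by rewrite prodrXr ler_wiXn2l // invf_le1.
rewrite -prodrXl; apply: ler_prod => u _; rewrite exprn_ge0 //=.
have dv : (outdeg e u %| n`!)%N by rewrite dvdn_fact // outdeg0 outdeg_le.
rewrite -{2}(divnK dv) mulnC exprM lerXn2r ?nnegrE ?exprn_ge0 ?kept_ge0 //.
exact: kept_exp_ge.
Qed.

(** Passing from [j.+1] to [j] doubles the number of blocks, while the newly decided rows, those
    whose lowest bit is [j], cost a factor of at least one half by the greedy choice. *)
Lemma rate_step j : (j < n)%N -> rate e b j.+1 <= rate e b j.
Proof.
move=> jn; pose w := (b^-1%g (Ordinal jn)).
have bw : b w = j :> nat by rewrite /w permKV.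
have split u : (j <= low_bit e b u)%N =
    (j < low_bit e b u)%N || (e u w && (b w <= low_bit e b u)%N).
  rewrite bw; apply/idP/orP => [hu|[/ltnW //|/andP[] //]].
  case: (boolP (e u w)) => euw; [by right; rewrite hu|left].
  apply/(low_bit_leP _ _ _ jn) => v euv; rewrite ltn_neqAle.
  rewrite (low_bit_leP _ _ _ (ltnW jn) hu) // andbT -bw.
  apply: contraNneq euw => /val_inj/perm_inj ->; exact: euv.
have excl u : e u w -> (j < low_bit e b u)%N = false.
  move=> euw; apply/negbTE/negP => /(low_bit_leP _ _ _ jn)/(_ w euw).
  by rewrite bw ltnn.
rewrite /rate -[(n - j)%N]subnSK // exprS.
rewrite (bigID (fun u => e u w && (b w <= low_bit e b u)%N)
  (fun u => (j <= low_bit e b u)%N)) /=.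
set P1 := \prod_(u | _ && ~~ _) _; set P2 := \prod_(u | _ && (e u w && _)) _.
have -> : \prod_(u | (j < low_bit e b u)%N) kept e u = P1.
  apply: eq_bigl => u; rewrite split; case: (boolP (e u w)) => [euw|_] /=.
    by rewrite excl //= andbN.
  by rewrite orbF andbT.
have P2E : P2 = \prod_(u | e u w && (b w <= low_bit e b u)%N) kept e u.
  by apply: eq_bigl => u; rewrite split; case: (_ && (b w <= _)%N); rewrite ?orbT ?andbF.
have P2h : 2^-1 <= P2 by rewrite P2E; apply: prod_kept_ge (greedy w).
have P10 : 0 <= P1 by apply: prodr_ge0 => u _; apply: kept_ge0.
rewrite [X in _ <= X](_ : _ = 2 ^+ (n - j.+1) * (2 * P2 * P1)); last by ring.
by rewrite ler_wpM2l ?exprn_ge0 // -[X in X <= _]mul1r ler_wpM2r //; lra.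
Qed.

Lemma rate_le j : (j <= n)%N -> rate e b j <= rate e b 0.
Proof.
by elim: j => // j IH jn; apply: le_trans (rate_step jn) (IH (ltnW jn)).
Qed.

(** Lets the contribution 1 of the whole range be absorbed into the main term. *)
Lemma rate0_ge1 : 1 <= rate e b 0.
Proof.
have : 2^-1 ^+ n <= \prod_u kept e u.
  rewrite -[in X in _ ^+ X](card_ord n) -prodr_const; apply: ler_prod => u _.
  rewrite invr_ge0 ler0n /= /kept lerBrDr.
  have := outdeg0 u; case: (outdeg e u) => // k _; rewrite exprS.
  have : 2^-1 ^+ k <= 1 :> rat by rewrite exprn_ile1.
  lra.
rewrite /rate subn0; under [in X in _ -> X]eq_bigl => u do rewrite leq0n.
by rewrite exprVn -[_ ^-1]mulr1 ler_pdivrMl ?exprn_gt0.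
Qed.

(** Markov's inequality, with probabilities multiplied by the number [2 ^ T] of tapes. *)
Lemma markov_blocks T B : (n * n <= T)%N -> (0 < B)%N ->
  3 * ((2 * n + 1)%:R * rate e b 0) <= B%:R ->
  (3 * #|[set w : T.-tuple bool | B < blocks e b w]%SET| <= 2 ^ T)%N.
Proof.
move=> nT B0 hB.
have h1 := sum_blocks e b nT.
have h2 : (B * #|[set w : T.-tuple bool | B < blocks e b w]%SET| <=
    \sum_(w : T.-tuple bool) blocks e b w)%N.
  rewrite mulnC -sum_nat_const [in X in (_ <= X)%N](bigID (fun w => w \in
    [set w : T.-tuple bool | (B < blocks e b w)%N]%SET)) /=.
  apply: leq_trans (leq_addr _ _); apply: leq_sum => w; rewrite inE; exact: ltnW.
have h3 : 1 + 2 * \sum_(j < n) rate e b j.+1 <= (2 * n + 1)%:R * rate e b 0.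
  have : \sum_(j < n) rate e b j.+1 <= n%:R * rate e b 0.
    apply: (@le_trans _ _ (\sum_(j < n) rate e b 0)).
      by apply: ler_sum => j _; apply: rate_le.
    by rewrite sumr_const card_ord -[_ *+ n]mulr_natl lexx.
  by rewrite natrD natrM; have := rate0_ge1; lra.
move: h2; rewrite -(ler_nat rat) natrM => h2.
rewrite -(ler_nat rat) natrM natrX -(ler_pM2l (_ : 0 < B%:R)) ?ltr0n // mulrCA.
apply: (@le_trans _ _ (3 * (2 ^+ T * (1 + 2 * \sum_(j < n) rate e b j.+1)))).
  by rewrite ler_pM2l // (le_trans h2 h1).
rewrite mulrCA [B%:R * _]mulrC ler_wpM2l ?exprn_ge0 //.
by apply: le_trans hB; rewrite ler_pM2l.
Qed.

End Rate.

Local Open Scope ring_scope.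

Lemma prod_outdeg_le (R : realType) (n : nat) (k : 'I_n -> nat) (d : R) :
  (0 < n)%N -> (\sum_u k u)%:R <= d * n%:R ->
  \prod_(u < n) (2 - 2 * 2^-1 ^+ k u) <= (2 - 2 * 2 `^ (- d)) ^+ n.
Proof.
move=> n0 hk; have n0R : 0 < n%:R :> R by rewrite ltr0n.
pose mean := (\sum_(u < n) 2^-1 ^+ k u) / n%:R : R.
(* First AM-GM inequality: the geometric mean of the [2^-1 ^+ k u] is 2 to minus the average of
   [k]. *)
have mean_ge : 2 `^ (- d) <= mean.
  have pos : 0 <= mean by rewrite divr_ge0 ?sumr_ge0 // => u _; rewrite exprn_ge0.
  rewrite -(ler_pXn2r n0) ?nnegrE ?powR_ge0 //.
  have := leif_AGM (A := 'I_n) (E := fun i => 2^-1 ^+ k i : R).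
  rewrite card_ord -/mean => /(_ _)[i _|]; first by rewrite exprn_ge0.
  move=> + _; apply: le_trans.
  rewrite prodrXr exprVn -powR_mulrn ?powR_ge0 // -powRrM -powR_invn //.
  by rewrite ler_powR ?ler1n // mulNr lerN2.
(* Second AM-GM inequality, for the factors themselves, whose arithmetic mean is [2 - 2 * mean]. *)
have := leif_AGM (A := 'I_n) (E := fun i => 2 - 2 * 2^-1 ^+ k i : R).
rewrite card_ord => /(_ _)[i _|]; first by rewrite subr_ge0 ler_piMr // exprn_ile1 // invf_le1 ?ler1n.
move=> + _; move/le_trans; apply.
rewrite sumrB sumr_const card_ord -mulr_sumr -[_ *+ n]mulr_natr.
have -> : (2 * n%:R - 2 * \sum_(i < n) 2^-1 ^+ k i) / n%:R = 2 - 2 * mean.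
  by rewrite /mean; field; rewrite gt_eqF.
have mean_le1 : mean <= 1.
  rewrite /mean ler_pdivrMr // mul1r -[X in _ <= X%:R](card_ord n) -sumr_const.
  by apply: ler_sum => i _; rewrite exprn_ile1 // invf_le1 ?ler1n.
by rewrite lerXn2r ?nnegrE; lra.
Qed.

Local Open Scope nat_scope.

(** * The program *)

Declare Scope aexpr_scope.
Delimit Scope aexpr_scope with A.
Notation "x + y" := (EBin OpAdd x y) : aexpr_scope.
Notation "x - y" := (EBin OpSub x y) : aexpr_scope.
Notation "x * y" := (EBin OpMul x y) : aexpr_scope.
Notation "x %/ y" := (EBin OpDiv x y) : aexpr_scope.
Notation "x %% y" := (EBin OpMod x y) : aexpr_scope.
Notation "a .{ i }" := (EArr a i) (at level 2, format "a .{ i }") : aexpr_scope.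
Coercion ECst : nat >-> aexpr.

(* [vPW.{w}] is [2 ^ b w], where [b w] is the position in the counter [vPOS] of
   the bit attached to [w]; [vWT] is the next free power of 2, hence [2 ^ n] in
   the end.  [vUSED.{w}] tells whether [w] has a bit and [vOUT.{u}] is the number
   of out-neighbours of [u] that have one.  [vVIO] tells whether the current row
   is 0, [vLOW] is the least weight of one of its bits and [vJP] the size of the
   block to be skipped. *)
Notation iU := 0 (only parsing).
Notation iV := 1 (only parsing).
Notation iW := 2 (only parsing).
Notation iK := 3 (only parsing).
Notation iL := 4 (only parsing).
Notation iT := 5 (only parsing).
Notation vDEG := 6 (only parsing).
Notation vFAC := 7 (only parsing).
Notation vNUM := 8 (only parsing).
Notation vDEN := 9 (only parsing).
Notation vPWD := 10 (only parsing).
Notation vBUD := 11 (only parsing).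
Notation vUSED := 12 (only parsing).
Notation vOUT := 13 (only parsing).
Notation vBEST := 14 (only parsing).
Notation vSUM := 15 (only parsing).
Notation vWT := 16 (only parsing).
Notation vPW := 17 (only parsing).
Notation vPOS := 18 (only parsing).
Notation vY := 19 (only parsing).
Notation vJP := 20 (only parsing).
Notation vVIO := 21 (only parsing).
Notation vLOW := 22 (only parsing).
Notation vSGN := 23 (only parsing).
Notation vACC := 24 (only parsing).
Notation vMAT := 25 (only parsing).
Notation vDET := 26 (only parsing).
Notation vX := 27 (only parsing).
Notation vNX := 28 (only parsing).
Notation vCAR := 29 (only parsing).
Notation vRES := 30 (only parsing).
Notation vTMP := 31 (only parsing).

Notation "! a" := (EArr a (ECst 0)) (at level 1, a at level 1, format "! a") : aexpr_scope.

Notation "a ::= e" := (PSet a (ECst 0) e%A) (at level 60, e at level 55).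
Notation "a @ i ::= e" := (PSet a i%A e%A) (at level 60, i at level 50, e at level 55).
Notation "p ;; q" := (PSeq p q) (at level 65, right associativity).

(* Subtraction being truncated, [1 - (1 - x)] is the truth value of [x != 0],
   [x - (x - y)] the minimum of [x] and [y], and [x + (y - x)] their maximum. *)
Definition det_entry : aprog :=
  vSUM ::= vDET.{EN - 1 - !iK} * vMAT.{EN * !iU + !iV};;
  PFor iL EN (
    vSUM ::= !vSUM + (1 - (1 - (!iL - !iU))) *
               ((EMod - 1) * (vX.{!iL} * vMAT.{EN * !iL + !iV})));;
  vNX @ !iV ::= !vSUM.

(** As [iK] runs down, the degree [EN - 1 - !iK] runs up. [vDET] is overwritten at this degree only
    after [det_entry] has read the old coefficient; the carry comes from the degree below. *)
Definition det_coef : aprog :=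
  PFor iV EN det_entry;;
  PFor iV EN (vX @ !iV ::= vNX.{!iV});;
  vDET @ EN - 1 - !iK ::= vDET.{EN - 1 - !iK} + !vCAR;;
  vCAR ::= vX.{!iU}.

(** The loop treats the degrees below [n]; the last line adds the remaining carry at degree [n]. *)
Definition det_row : aprog :=
  vCAR ::= 0;;
  PFor iV EN (vX @ !iV ::= 0);;
  PFor iK EN det_coef;;
  vDET @ EN ::= vDET.{EN} + !vCAR.

Definition det_prog : aprog :=
  PFor iK EN (vDET @ !iK + 1 ::= 0);;
  vDET @ 0 ::= 1;;
  PFor iU EN det_row.

Definition setup_entry : aprog :=
  vSUM ::= !vSUM + EAdj !iU !iV;;
  vPWD ::= !vPWD * (1 + EAdj !iU !iV).

Definition setup_row : aprog :=
  vFAC ::= !vFAC * (!iU + 1);;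
  vPWD ::= 1;; vSUM ::= 0;;
  PFor iV EN setup_entry;;
  vDEG @ !iU ::= !vSUM;;
  vNUM ::= !vNUM * (2 * (!vPWD - 1));;
  vDEN ::= !vDEN * !vPWD.

Definition setup_prog : aprog :=
  vFAC ::= 1;; vNUM ::= 1;; vDEN ::= 1;;
  PFor iU EN setup_row;;
  vBUD ::= !vNUM * (6 * EN + 3) %/ !vDEN + 1.

Definition load_prog : aprog :=
  vSUM ::= 0;;
  PFor iU EN (
    vSUM ::= !vSUM + EAdj !iU !iW * ((1 - vOUT.{!iU}) * (!vFAC %/ vDEG.{!iU}))).

Definition choose_prog : aprog :=
  PIf vUSED.{!iW}%A PSkip (
    load_prog;;
    PIf ((!vSUM - !vFAC) * (EN - !vBEST))%A PSkip (vBEST ::= !iW)).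

Definition place_prog : aprog :=
  vBEST ::= EN;;
  PFor iW EN choose_prog;;
  vUSED @ !vBEST ::= 1;;
  vPW @ !vBEST ::= !vWT;;
  vWT ::= !vWT * 2;;
  PFor iU EN (vOUT @ !iU ::= vOUT.{!iU} + EAdj !iU !vBEST).

Definition order_prog : aprog := vWT ::= 1;; PFor iT EN place_prog.

Definition sign_loop : aprog :=
  PFor iV EN (
    vY @ !iV ::= (!vPOS %/ vPW.{!iV}) %% 2;;
    vSGN ::= !vSGN * (2 * vY.{!iV} + (EMod - 1))).

(** Vertex 0 plays the role of [s], and [EMod - 1] that of -1. The two truncated differences add up
    to the absolute difference of bit and coin. *)
Definition row_entry : aprog :=
  vVIO ::= !vVIO * (1 - EAdj !iU !iV *
             ((vY.{!iV} - ECoin !iU !iV) + (ECoin !iU !iV - vY.{!iV})));;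
  vLOW ::= !vLOW - EAdj !iU !iV * (!vLOW - vPW.{!iV});;
  vTMP ::= EAdj !iU !iV * (vY.{!iV} + (EMod - 1) * ECoin !iU !iV);;
  vSUM ::= !vSUM + !vTMP;;
  vMAT @ EN * !iU + !iV ::= (1 - (1 - !iV)) * ((EMod - 1) * !vTMP).

Definition row_prog : aprog :=
  vVIO ::= 1;; vLOW ::= !vWT;; vSUM ::= 0;;
  PFor iV EN row_entry;;
  vMAT @ EN * !iU + !iU ::= vMAT.{EN * !iU + !iU} + !vSUM;;
  vJP ::= !vJP + !vVIO * (!vLOW - !vJP).

Definition matrix_prog : aprog :=
  vJP ::= 1;; vSGN ::= 1;;
  sign_loop;;
  PFor iU EN row_prog.

Definition search_prog : aprog :=
  PIf (!vWT - !vPOS)%A (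
    matrix_prog;;
    det_prog;;
    vACC ::= !vACC + !vSGN * vDET.{EN};;
    vPOS ::= (!vPOS %/ !vJP + 1) * !vJP) PSkip.

(** The last factor forces the answer 0 if the budget runs out before the search is complete, so
    errors are one-sided. *)
Definition main_prog : aprog :=
  setup_prog;; order_prog;;
  PFor iT (!vBUD)%A search_prog;;
  vRES ::= (1 - (!vWT - !vPOS)) * !vACC.

(** * Invariant rules for loops *)

Section Rules.
Variables (n M : nat) (adjm coinm : nat -> nat -> nat).
Local Notation exec := (sem n M adjm coinm).
Local Notation eval := (aeval n M adjm coinm).

(** The body may assume that all arrays not written by the loop have their initial contents, so
    invariants mention only what changes. *)
Lemma for_rule k e p (Inv : nat -> store -> Prop) s :
  k \notin writes p ->
  (forall j s' v, Inv j s' -> Inv j (upd s' k 0 v)) ->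
  Inv (eval s e %% M) s ->
  (forall j s', j < eval s e %% M -> s' k 0 = j ->
     (forall k', k' \notin k :: writes p -> s' k' = s k') ->
     Inv j.+1 s' -> Inv j (exec p s')) ->
  Inv 0 (exec (PFor k e p) s).
Proof.
move=> kp hk h0 hS; rewrite /=.
pose Inv' j s' := (forall k', k' \notin k :: writes p -> s' k' = s k') /\ Inv j s'.
have frame k' s' i v : k' \notin k :: writes p -> upd s' k i v k' = s' k'.
  rewrite inE negb_or => /andP[/negPf kk' _]; apply: funext => i'.
  by rewrite /upd kk'.
suff [] : Inv' 0 (loop (eval s e %% M) (fun j s' => exec p (upd s' k 0 j))
    (upd s k 0 (eval s e %% M))) by [].
apply: (loop_ind (Inv := Inv')) => [|j s' jN [fr inv]].
  by split; [move=> k' hk'; apply: frame|apply: hk].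
have fr' k' : k' \notin k :: writes p -> upd s' k 0 j k' = s k'.
  by move=> hk'; rewrite frame // fr.
split; last first.
  by apply: hS => //; [rewrite /upd !eqxx|apply: hk].
move=> k' hk'; rewrite [LHS]sem_frame ?fr' //.
by move: hk'; rewrite inE negb_or => /andP[].
Qed.

Lemma vertex_for_rule k p (Inv : nat -> store -> Prop) s : n < M ->
  k \notin writes p ->
  (forall j s' v, Inv j s' -> Inv j (upd s' k 0 v)) ->
  Inv n s ->
  (forall j s', j < n -> s' k 0 = j ->
     (forall k', k' \notin k :: writes p -> s' k' = s k') ->
     Inv j.+1 s' -> Inv j (exec p s')) ->
  Inv 0 (exec (PFor k EN p) s).
Proof.
by move=> nM kp hk h0 hS; apply: for_rule => //; rewrite /= modn_small.
Qed.

Lemma sem_seq p q s : exec (p ;; q) s = exec q (exec p s).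
Proof. by []. Qed.

Lemma sem_if e p q s :
  exec (PIf e p q) s = if eval s e != 0 then exec p s else exec q s.
Proof. by []. Qed.

Lemma sem_assign k e s : exec (k ::= e) s = upd s k 0 (eval s e %% M).
Proof. by rewrite /= mod0n. Qed.

End Rules.

Lemma big_ord_geS (T : Type) (x0 : T) (op : Monoid.com_law x0) n j (jn : j < n) F :
  \big[op/x0]_(l < n | j <= l) F l =
  op (F (Ordinal jn)) (\big[op/x0]_(l < n | j < l) F l).
Proof.
rewrite (bigD1 (Ordinal jn)) //=; congr (op _ _); apply: eq_bigl => l.
by rewrite ltn_neqAle andbC eq_sym.
Qed.

Lemma big_ord_ge (T : Type) (x0 : T) (op : Monoid.com_law x0) n (v : 'I_n) F :
  \big[op/x0]_(l < n | v <= l) F l =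
  op (F v) (\big[op/x0]_(l < n | v < l) F l).
Proof.
by rewrite (big_ord_geS _ (ltn_ord v)); congr (op (F _) _); apply: val_inj.
Qed.

Lemma big_ord_ge_all (T : Type) (x0 : T) (op : T -> T -> T) n (F : 'I_n -> T) :
  \big[op/x0]_(l < n | n <= l) F l = x0.
Proof. by rewrite big_pred0 // => l; rewrite leqNgt ltn_ord. Qed.

(** * Correctness of the determinant program *)

Section DetProg.
Variables (n M : nat) (adjm coinm : nat -> nat -> nat).
Hypotheses (n0 : 0 < n) (nM : n < M).
Local Notation exec := (sem n M adjm coinm).

Let idx1 i : i <= n -> i %% (n.+1 * n.+1) = i.
Proof. by move=> h; rewrite modn_small //; nia. Qed.

Variable R : comNzRingType.
Hypothesis MR : (M%:R = 0 :> R)%R.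

(** Stored values are interpreted in a ring where [M] is 0, which makes all reductions invisible. *)
Lemma natr_modM x : ((x %% M)%:R = x%:R :> R)%R.
Proof. by rewrite {2}(divn_eq x M) natrD natrM MR mulr0 add0r. Qed.

Lemma natr_predM : ((M - 1)%:R = -1 :> R)%R.
Proof. by rewrite natrB ?MR ?sub0r // (leq_trans _ nM). Qed.

Lemma natr_ltn i j : ((1 - (1 - (j - i)))%:R = (i < j)%:R :> R)%R.
Proof. by case: ltnP => h; congr (_%:R)%R; lia. Qed.

Variable A : 'M[R]_n.

Let entry_loop (u v : 'I_n) k (s : store) :
  k < n -> s iU 0 = u :> nat -> s iV 0 = v :> nat -> s iK 0 = n - 1 - k ->
  (forall i j : 'I_n, (s vMAT (n * i + j))%:R = A i j)%R ->
  ((s vDET k)%:R = (tail_det A u.+1)`_k)%R ->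
  (forall v : 'I_n, (s vX v)%:R = (if k is k'.+1 then (tail_row A u v)`_k' else 0))%R ->
  (forall i : nat, i != v :> nat -> exec det_entry s vNX i = s vNX i) /\
  ((exec det_entry s vNX v)%:R = (tail_row A u v)`_k)%R.
Proof.
move=> kn sU sV sK sA sD sX.
rewrite /det_entry sem_seq; set s1 := exec (vSUM ::= _) s.
have s1S : ((s1 vSUM 0)%:R = (tail_det A u.+1)`_k * A u v)%R.
  rewrite /s1 sem_assign /= natr_modM natrM -sD -sA sU sV sK.
  by rewrite (_ : n - 1 - (n - 1 - k) = k) //; lia.
have fr1 a : a \notin [:: vSUM] -> s1 a = s a by move=> ha; rewrite /s1 sem_frame.
clearbody s1; rewrite sem_seq; set s2 := exec (PFor _ _ _) s1.
have s2S : ((s2 vSUM 0)%:R = (tail_row A u v)`_k)%R.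
  pose Inv j (s' : store) := ((s' vSUM 0)%:R = (tail_det A u.+1)`_k * A u v -
      \sum_(l < n | (j <= l)%N) (u < l)%:R * ((s vX l)%:R * A l v))%R.
  suff : Inv 0 s2.
    rewrite /Inv => ->; rewrite tail_row_coef; congr (_ - _)%R.
    case: k {kn sK sD s1S Inv} sX => [|k] sX.
      by rewrite big1 // => l _; rewrite sX mul0r mulr0.
    rewrite [RHS]big_mkcond; apply: eq_bigr => l _; rewrite sX.
    by case: ifP; rewrite ?mul1r ?mul0r.
  apply: vertex_for_rule => //.
    by rewrite /Inv big_ord_ge_all subr0.
  move=> j s' jn s'L fr'; rewrite /Inv sem_assign /= => IH.
  rewrite natr_modM natrD !natrM natr_predM natr_ltn s'L IH.
  rewrite !fr' // !fr1 // sU sV (sA (Ordinal jn) v).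
  by rewrite [in RHS](big_ord_geS _ jn) /=; ring.
have fr2 a : a \notin [:: iL; vSUM] -> s2 a = s1 a by move=> ha; rewrite /s2 sem_frame.
have s2V : s2 iV 0 = v :> nat by rewrite fr2 // fr1 // sV.
have s2N : s2 vNX = s vNX by rewrite fr2 // fr1.
clearbody s2; rewrite /= s2V idx1 ?(ltnW (ltn_ord v)) // /upd /= s2N eqxx natr_modM s2S.
by split=> // i /negPf ->.
Qed.

(* Invariant of the loop on [iK]: the coefficients of index less than [k] have
   been updated and [vX] and [vCAR] hold the coefficients of index [k - 1]. *)
Let coef_inv (u : 'I_n) k (s : store) : Prop :=
  [/\ forall v : 'I_n,
        ((s vX v)%:R = if k is k'.+1 then (tail_row A u v)`_k' else 0)%R,
      ((s vCAR 0)%:R = if k is k'.+1 then (tail_row A u u)`_k' else 0)%R &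
      forall i, i <= n ->
        ((s vDET i)%:R = (if (i < k)%N then tail_det A u else tail_det A u.+1)`_i)%R].

Let coef_step (u : 'I_n) k (s : store) :
  k < n -> s iU 0 = u :> nat -> s iK 0 = n - 1 - k ->
  (forall i j : 'I_n, (s vMAT (n * i + j))%:R = A i j)%R ->
  coef_inv u k s -> coef_inv u k.+1 (exec det_coef s).
Proof.
move=> kn sU sK sA [sX sC sD].
have sDk : ((s vDET k)%:R = (tail_det A u.+1)`_k)%R by rewrite sD ?ltnn // ltnW.
rewrite /det_coef sem_seq; set s1 := exec (PFor _ _ _) s.
have s1N (v : 'I_n) : ((s1 vNX v)%:R = (tail_row A u v)`_k)%R.
  pose Inv j (s' : store) :=
    forall v : 'I_n, j <= v -> ((s' vNX v)%:R = (tail_row A u v)`_k)%R.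
  suff h : Inv 0 s1 by apply: h.
  apply: vertex_for_rule => // [v'|j s' jn s'V fr inv v' jv'].
    by rewrite leqNgt ltn_ord.
  have [fU fK fA] : [/\ s' iU = s iU, s' iK = s iK & s' vMAT = s vMAT] by rewrite !fr.
  have [fD fX] : s' vDET = s vDET /\ s' vX = s vX by rewrite !fr.
  have [|||||| old new] := @entry_loop u (Ordinal jn) k s' kn;
    rewrite ?fU ?fK ?fA ?fD ?fX //.
  have [->|ne] := eqVneq v' (Ordinal jn); first exact: new.
  by rewrite old // inv // ltn_neqAle jv' andbT eq_sym.
have fr1 a : a \notin writes (PFor iV EN det_entry) -> s1 a = s a.
  by move=> ha; rewrite /s1 sem_frame.
clearbody s1; rewrite sem_seq; set s2 := exec (PFor _ _ _) s1.
have s2X (v : 'I_n) : s2 vX v = s1 vNX v %% M.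
  pose Inv j (s' : store) := forall v : 'I_n, j <= v -> s' vX v = s1 vNX v %% M.
  suff h : Inv 0 s2 by apply: h.
  apply: vertex_for_rule => // [v'|j s' jn s'V fr inv v' jv'].
    by rewrite leqNgt ltn_ord.
  rewrite /= s'V idx1 ?(ltnW jn) // /upd /= fr //.
  by case: eqVneq => [->//|ne]; apply: inv; rewrite ltn_neqAle jv' andbT eq_sym.
have fr2 a : a \notin [:: iV; vX] -> s2 a = s1 a.
  by move=> ha; rewrite /s2 sem_frame.
clearbody s2; rewrite sem_seq /= !mod0n.
have sK' : n - 1 - (n - 1 - k) = k by lia.
have [s2U s2K] : s2 iU 0 = u :> nat /\ s2 iK 0 = n - 1 - k by rewrite !fr2 // !fr1.
have [s2D s2C] : s2 vDET = s vDET /\ s2 vCAR = s vCAR by rewrite !fr2 // !fr1.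
rewrite /upd /= s2U s2K sK' s2D s2C idx1 ?(ltnW kn) //.
split=> [v||i ni]; rewrite ?s2X ?natr_modM ?s1N //.
rewrite ltnS leq_eqVlt.
rewrite /= s2D; case: eqVneq => [->|ik] /=; last by rewrite sD.
rewrite natr_modM natrD sDk sC.
(* In degree 0 there is no carry: both constant coefficients are 1. *)
case: k {kn sK sX sC sD sDk s1N s2X sK' s2K ni} => [|k].
  by rewrite !tail_det_coef0 ?addr0 // ltnW.
by rewrite [RHS]tail_det_coefS.
Qed.

Let row_step (u : 'I_n) (s : store) :
  s iU 0 = u :> nat ->
  (forall i j : 'I_n, (s vMAT (n * i + j))%:R = A i j)%R ->
  (forall i, (i <= n)%N -> (s vDET i)%:R = (tail_det A u.+1)`_i)%R ->
  (forall i, (i <= n)%N -> (exec det_row s vDET i)%:R = (tail_det A u)`_i)%R.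
Proof.
move=> sU sA sD; rewrite /det_row sem_seq; set s1 := exec (vCAR ::= 0) s.
have s1C : s1 vCAR 0 = 0 by rewrite /s1 sem_assign /= mod0n.
have fr1 a : a \notin [:: vCAR] -> s1 a = s a by move=> ha; rewrite /s1 sem_frame.
clearbody s1; rewrite sem_seq; set s2 := exec (PFor _ _ _) s1.
have s2X (v : 'I_n) : s2 vX v = 0.
  pose Inv j (s' : store) := forall v : 'I_n, j <= v -> s' vX v = 0.
  suff h : Inv 0 s2 by apply: h.
  apply: vertex_for_rule => // [v'|j s' jn s'V fr inv v' jv'].
    by rewrite leqNgt ltn_ord.
  rewrite /= s'V idx1 ?(ltnW jn) // /upd /= mod0n.
  by case: eqVneq => [//|ne]; apply: inv; rewrite ltn_neqAle jv' andbT eq_sym.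
have fr2 a : a \notin [:: iV; vX] -> s2 a = s1 a.
  by move=> ha; rewrite /s2 sem_frame.
clearbody s2; rewrite sem_seq; set s3 := exec (PFor _ _ _) s2.
have [s2U s2A s2D s2C] : [/\ s2 iU = s iU, s2 vMAT = s vMAT, s2 vDET = s vDET &
    s2 vCAR 0 = 0].
  by rewrite !fr2 // s1C !fr1.
have [s3X s3C s3D] : coef_inv u n s3.
  pose Inv j := coef_inv u (n - j); suff : Inv 0 s3.
    by rewrite /Inv subn0.
  apply: vertex_for_rule => // [|j s' jn s'K fr].
    rewrite /Inv subnn; split=> [v||i ni]; rewrite ?s2X ?s2C ?s2D //.
    by rewrite sD.
  rewrite /Inv -[n - j]subnSK //; apply: coef_step.
  - by lia.
  - by rewrite fr // s2U.
  - by rewrite s'K; lia.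
  - by move=> i i'; rewrite fr // s2A.
clearbody s3; move=> i ni; rewrite /= idx1 // /upd /=.
have [->|ik] := eqVneq i n; last first.
  by rewrite s3D // ltn_neqAle ik ni.
rewrite natr_modM natrD s3D // ltnn s3C; have := ltn_ord u.
case: (n) A (u) => [|n'] A' u'; first by case: u' => /=.
by move=> _; rewrite [RHS]tail_det_coefS.
Qed.

Lemma det_prog_correct s :
  (forall i j : 'I_n, (s vMAT (n * i + j))%:R = A i j)%R ->
  ((exec det_prog s vDET n)%:R = \det A)%R.
Proof.
move=> sA; rewrite -tail_det_coef /det_prog sem_seq; set s1 := exec (PFor _ _ _) s.
have s1D i : i < n -> s1 vDET i.+1 = 0.
  pose Inv j (s' : store) := forall i, j <= i < n -> s' vDET i.+1 = 0.
  suff h : Inv 0 s1 by move=> hi; apply: h.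
  apply: vertex_for_rule => // [v' /andP[h1 h2]|j s' jn s'K fr inv i' /andP[ji iN]].
    by move: h2; rewrite ltnNge h1.
  rewrite /= s'K addn1 idx1 // /upd /= mod0n.
  by rewrite eqSS; case: eqVneq => [//|ne]; apply: inv; rewrite ltn_neqAle ji iN andbT eq_sym ne.
have fr1 a : a \notin [:: iK; vDET] -> s1 a = s a by move=> ha; rewrite /s1 sem_frame.
clearbody s1; rewrite sem_seq; set s2 := exec (vDET @ 0 ::= 1) s1.
have s2D i : i <= n -> ((s2 vDET i)%:R = (tail_det A n)`_i)%R.
  move=> ni; rewrite /s2 /= mod0n /upd /= tail_det_top coef1.
  case: i ni => [|i] ni /=; last by rewrite s1D.
  by rewrite natr_modM.
have s2A : s2 vMAT = s vMAT by rewrite /s2 sem_frame // fr1.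
clearbody s2.
pose Inv j (s' : store) := forall i, i <= n -> ((s' vDET i)%:R = (tail_det A j)`_i)%R.
suff h : Inv 0 (exec (PFor iU EN det_row) s2) by apply: h.
apply: vertex_for_rule => // j s' jn s'U fr inv.
apply: (@row_step (Ordinal jn)) => // i i'.
by rewrite fr // s2A.
Qed.

End DetProg.

(** * Correctness of the search *)

Section SearchProg.
Variables (n M : nat) (adjm coinm : nat -> nat -> nat).
Hypotheses (n0 : 0 < n) (pow_nM : 2 ^ n < M).
Local Notation exec := (sem n M adjm coinm).
Variables (e : rel 'I_n) (c : 'I_n -> 'I_n -> bool) (b : 'S_n).
Hypothesis adjmE : forall u v : 'I_n, adjm u v = e u v.
Hypothesis coinmE : forall u v : 'I_n, coinm u v = c u v.
Variable R : comNzRingType.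
Hypothesis MR : (M%:R = 0 :> R)%R.

Let s0 : 'I_n := Ordinal n0.
Let cR (u v : 'I_n) : R := ((c u v)%:R)%R.

Let nM : n < M.
Proof. by apply: leq_trans pow_nM; apply: ltnW; apply: ltn_expl. Qed.

Let M1 : 1 < M.
Proof. by apply: leq_ltn_trans nM. Qed.

Let idx1 i : i <= n -> i %% (n.+1 * n.+1) = i.
Proof. by move=> h; rewrite modn_small //; nia. Qed.

Let idx2 u v : u < n -> v < n -> (n * u + v) %% (n.+1 * n.+1) = n * u + v.
Proof. by move=> hu hv; rewrite modn_small //; nia. Qed.

Let powM i : i <= n -> 2 ^ i < M.
Proof. by move=> h; apply: leq_ltn_trans pow_nM; rewrite leq_exp2l. Qed.

Let natr_mod x : ((x %% M)%:R = x%:R :> R)%R := natr_modM MR x.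

Let natr_pred : ((M - 1)%:R = -1 :> R)%R := natr_predM nM MR.

Definition search_static (s : store) : Prop :=
  (forall w : 'I_n, s vPW w = 2 ^ b w) /\ s vWT 0 = 2 ^ n.

Let sign_correct p s : search_static s -> s vPOS 0 = p -> s vSGN 0 = 1 ->
  (forall v : 'I_n, exec sign_loop s vY v = bit p (b v)) /\
  ((exec sign_loop s vSGN 0)%:R = \prod_(w < n) ((bit p (b w))%:R *+ 2 - 1) :> R)%R.
Proof.
move=> [sPW sWT] sP sS.
pose J j (s' : store) := (forall v : 'I_n, j <= v -> s' vY v = bit p (b v)) /\
  ((s' vSGN 0)%:R = \prod_(w < n | (j <= w)%N) ((bit p (b w))%:R *+ 2 - 1) :> R)%R.
suff [h1 h2] : J 0 (exec sign_loop s) by split=> // v; apply: h1.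
apply: vertex_for_rule => // [|j s' jn s'V fr [inv1 inv2]].
  split; last by rewrite sS big_ord_ge_all.
  by move=> v; rewrite leqNgt ltn_ord.
have [fP fPW] : s' vPOS = s vPOS /\ s' vPW = s vPW by rewrite !fr.
have bitM : (s vPOS 0 %/ s vPW j %% 2) %% M = bit p (b (Ordinal jn)).
  rewrite sP (sPW (Ordinal jn)) modn_small //.
  exact: leq_trans (ltn_pmod _ _) M1.
rewrite sem_seq [exec (vY @ _ ::= _) s']/= s'V idx1 ?(ltnW jn) // fP fPW bitM.
rewrite sem_assign /= /upd /= s'V eqxx; split.
  move=> v jv /=; case: eqVneq => [E|ne].
    by congr (bit p (b _)); apply: val_inj.
  by apply: inv1; rewrite ltn_neqAle jv andbT eq_sym.
rewrite natr_mod natrM inv2 natrD natr_pred natrM mulr_natl.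
by rewrite (big_ord_geS _ jn) mulrC.
Qed.

Let agrees p u v := e u v ==> (bit p (b v) == c u v).

(** The exponent [l] is a lower bound for the bits seen so far that is attained or equal to [n]; at
    [j = 0] this pins down [low_bit]. The row sum is not yet added to the diagonal entry. *)
Let row_inv p (u : 'I_n) (s : store) j (s' : store) : Prop :=
  [/\ s' vVIO 0 = \big[andb/true]_(v < n | j <= v) agrees p u v,
      exists l, [/\ s' vLOW 0 = 2 ^ l, l <= n, 
         forall v : 'I_n, j <= v -> e u v -> l <= b v &
         l = n \/ exists v : 'I_n, [/\ e u v & l = b v]],
      ((s' vSUM 0)%:R = \sum_(v < n | (j <= v)%N) arc_weight e b cR p u v)%R,
      (forall v : 'I_n, j <= v ->
        ((s' vMAT (n * u + v))%:R = - ((v != s0)%:R * arc_weight e b cR p u v))%R) &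
      (forall i v : 'I_n, i != u -> s' vMAT (n * i + v) = s vMAT (n * i + v))].

Let bit_le1 p i : bit p i <= 1.
Proof. by rewrite -ltnS ltn_pmod. Qed.

Let row_step p (u v : 'I_n) (s s' : store) :
  s' iU 0 = u :> nat -> s' iV 0 = v :> nat ->
  (forall w : 'I_n, s' vPW w = 2 ^ b w) -> (forall w : 'I_n, s' vY w = bit p (b w)) ->
  row_inv p u s v.+1 s' -> row_inv p u s v (exec row_entry s').
Proof.
move=> sU sV sPW sY [iVIO [l [iLOW lle ln lex]] iSUM iMAT iOLD].
have av : adjm (u %% n) (v %% n) = e u v by rewrite !modn_small.
have cv : coinm (u %% n) (v %% n) = c u v by rewrite !modn_small.
rewrite /row_entry !sem_seq !sem_assign.
rewrite /= /upd /= sU sV av cv sPW sY iVIO iLOW.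
have TMP : ((((e u v * (bit p (b v) + (M - 1) * c u v)) %% M)%:R : R) =
    arc_weight e b cR p u v)%R.
  by rewrite natr_mod natrM natrD natrM natr_pred mulN1r.
split=> /=.
- rewrite big_ord_ge /=; set B := \big[_/_]_(_ < _ | _) _.
  have -> : 1 - e u v * (bit p (b v) - c u v + (c u v - bit p (b v))) = agrees p u v.
    rewrite /agrees; have := bit_le1 p (b v).
    by case: (e u v); case: (c u v); case: (bit p (b v)) => [|[|k]].
  by rewrite mulnb andbC modn_small // (leq_ltn_trans (leq_b1 _)).
- have [euv|neuv] := boolP (e u v); last first.
    exists l; rewrite mul0n subn0 modn_small ?powM //; split=> // w.
    rewrite leq_eqVlt => /predU1P[/val_inj <- euv|]; last exact: ln.
    by rewrite euv in neuv.
  have -> : 2 ^ l - 1 * (2 ^ l - 2 ^ b v) = 2 ^ minn l (b v).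
    rewrite mul1n; case: leqP => h.
      by have := leq_pexp2l (isT : 0 < 2) h; lia.
    by have := leq_pexp2l (isT : 0 < 2) (ltnW h); lia.
  exists (minn l (b v)); rewrite modn_small; last first.
    by apply: powM; rewrite geq_min lle.
  split=> //; first by rewrite geq_min lle.
    move=> w; rewrite leq_eqVlt => /predU1P[/val_inj <- _|vw ew].
      by rewrite geq_minr.
    by rewrite geq_min ln.
  case: leqP => h; last by right; exists v.
  by case: lex => [|[w hw]]; [left|right; exists w].
- by rewrite natr_mod natrD iSUM TMP big_ord_ge addrC.
- move=> w vw; rewrite idx2 // eqn_add2l; case: eqVneq => [E|ne].
    rewrite (val_inj E) natr_mod !natrM natr_pred TMP mulN1r mulrN.
    congr (- (_ * _))%R; rewrite -(inj_eq val_inj) /=.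
    by case: (nat_of_ord v).
  by apply: iMAT; rewrite ltn_neqAle vw andbT eq_sym.
- move=> i w iu; rewrite idx2 // ifN ?iOLD //.
  apply: contra iu => /eqP E; apply/eqP/val_inj => /=.
  by have := ltn_ord v; have := ltn_ord w; nia.
Qed.

Let row_correct p (u : 'I_n) (s : store) m :
  search_static s -> (forall w : 'I_n, s vY w = bit p (b w)) ->
  s iU 0 = u :> nat -> s vJP 0 = 2 ^ m -> m <= n ->
  [/\ forall v : 'I_n,
        ((exec row_prog s vMAT (n * u + v))%:R = laplacian s0 e b cR p u v)%R,
      forall i v : 'I_n, i != u -> exec row_prog s vMAT (n * i + v) = s vMAT (n * i + v) &
      exec row_prog s vJP 0 = 2 ^ (maxn (if violated e b c p u then low_bit e b u else 0) m)].
Proof.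
move=> [sPW sWT] sY sU sJ mn.
rewrite /row_prog sem_seq; set s1 := exec (vVIO ::= _) s.
have s1V : s1 vVIO 0 = 1 by rewrite /s1 sem_assign /= /upd /= modn_small.
have fr1 a : a \notin [:: vVIO] -> s1 a = s a by move=> ha; rewrite /s1 sem_frame.
clearbody s1; rewrite sem_seq; set s2 := exec (vLOW ::= _) s1.
have s2L : s2 vLOW 0 = 2 ^ n.
  by rewrite /s2 sem_assign /= /upd /= fr1 // sWT modn_small.
have fr2 a : a \notin [:: vLOW] -> s2 a = s1 a by move=> ha; rewrite /s2 sem_frame.
clearbody s2; rewrite sem_seq; set s3 := exec (vSUM ::= _) s2.
have s3S : s3 vSUM 0 = 0 by rewrite /s3 sem_assign /= /upd /= mod0n.
have fr3 a : a \notin [:: vSUM] -> s3 a = s2 a by move=> ha; rewrite /s3 sem_frame.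
clearbody s3; rewrite sem_seq; set s4 := exec (PFor _ _ _) s3.
have [s3U s3PW s3Y s3M] : [/\ s3 iU = s iU, s3 vPW = s vPW, s3 vY = s vY & s3 vMAT = s vMAT].
  by rewrite !fr3 // !fr2 // !fr1.
have [s3V s3L s3J] : [/\ s3 vVIO 0 = 1, s3 vLOW 0 = 2 ^ n & s3 vJP = s vJP].
  by rewrite !fr3 // s2L !fr2 // s1V fr1.
have inv : row_inv p u s 0 s4.
  apply: vertex_for_rule => // [|j s' jn s'V fr iv].
    split; rewrite ?s3V ?s3S ?s3M ?big_ord_ge_all //.
      exists n; split=> //; [|by left] => v; by rewrite leqNgt ltn_ord.
    by move=> v; rewrite leqNgt ltn_ord.
  apply: (@row_step p u (Ordinal jn)) => //.
  - by rewrite fr // s3U.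
  - by move=> w; rewrite fr // s3PW.
  - by move=> w; rewrite fr // s3Y.
have fr4 a : a \notin writes (PFor iV EN row_entry) -> s4 a = s3 a.
  by move=> ha; rewrite /s4 sem_frame.
have [s4U s4J] : s4 iU 0 = u :> nat /\ s4 vJP 0 = 2 ^ m.
  by rewrite !fr4 // s3U s3J.
have [iVIO [l [iLOW lle ln lex]] iSUM iMAT iOLD] := inv; clearbody s4.
have lE : l = low_bit e b u.
  apply/eqP; rewrite eqn_leq; apply/andP; split.
    by apply/low_bit_leP => // w; apply: ln.
  case: lex => [->|[w [euw ->]]]; first exact: low_bit_le.
  exact: (low_bit_leP _ _ _ (low_bit_le e b u) (leqnn _)).
have vE : s4 vVIO 0 = violated e b c p u.
  by rewrite iVIO big_andE; congr nat_of_bool; apply: eq_forallb => w.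
rewrite sem_seq [exec (vMAT @ _ ::= _) s4]/= s4U idx2 // sem_assign /= /upd /=.
rewrite vE iLOW lE s4J; split.
- move=> v; rewrite eqn_add2l mxE; case: eqVneq => [/val_inj ->|ne].
    rewrite natr_mod natrD iMAT // iSUM eqxx mul1r addrC.
    by congr (_ - _ * _)%R.
  have uv : (u == v) = false by rewrite -(inj_eq val_inj) eq_sym (negPf ne).
  by rewrite iMAT // uv mul0r sub0r.
- move=> i v iu; rewrite ifN ?iOLD //.
  apply: contra iu => /eqP E; apply/eqP/val_inj => /=.
  by have := ltn_ord u; have := ltn_ord v; nia.
- have hl := low_bit_le e b u; case: (violated _ _ _ _ _); last first.
    by rewrite mul0n addn0 max0n modn_small // powM.
  have -> : 2 ^ m + 1 * (2 ^ low_bit e b u - 2 ^ m) = 2 ^ maxn (low_bit e b u) m.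
    rewrite mul1n; case: leqP => h.
      by have := leq_pexp2l (isT : 0 < 2) h; lia.
    by have := leq_pexp2l (isT : 0 < 2) (ltnW h); lia.
  by rewrite modn_small // powM // geq_max hl mn.
Qed.

Let matrix_correct p (s : store) :
  search_static s -> s vPOS 0 = p ->
  [/\ forall u v : 'I_n,
        ((exec matrix_prog s vMAT (n * u + v))%:R = laplacian s0 e b cR p u v)%R,
      ((exec matrix_prog s vSGN 0)%:R =
         \prod_(w < n) ((bit p (b w))%:R *+ 2 - 1) :> R)%R &
      exec matrix_prog s vJP 0 = 2 ^ skip e b c p].
Proof.
move=> st sP; rewrite /matrix_prog sem_seq; set s1 := exec (vJP ::= _) s.
have s1J : s1 vJP 0 = 1 by rewrite /s1 sem_assign /= /upd /= modn_small.
have fr1 a : a \notin [:: vJP] -> s1 a = s a by move=> ha; rewrite /s1 sem_frame.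
clearbody s1; rewrite sem_seq; set s2 := exec (vSGN ::= _) s1.
have s2S : s2 vSGN 0 = 1 by rewrite /s2 sem_assign /= /upd /= modn_small.
have fr2 a : a \notin [:: vSGN] -> s2 a = s1 a by move=> ha; rewrite /s2 sem_frame.
clearbody s2; rewrite sem_seq; set s3 := exec sign_loop s2.
have fr3 a : a \notin writes sign_loop -> s3 a = s2 a by move=> ha; rewrite /s3 sem_frame.
have s2st : search_static s2 by rewrite /search_static !fr2 // !fr1.
have s2P : s2 vPOS 0 = p by rewrite fr2 // fr1.
have [s3Y s3S] := sign_correct s2st s2P s2S; rewrite -/s3 in s3Y s3S; clearbody s3.
have s3J : s3 vJP 0 = 1 by rewrite fr3 // fr2.
have s3st : search_static s3 by rewrite /search_static !fr3.
set s4 := exec (PFor _ _ _) s3.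
have s4S : s4 vSGN = s3 vSGN by rewrite /s4 sem_frame.
rewrite s4S; pose low u := if violated e b c p u then low_bit e b u else 0.
pose J j (s' : store) :=
  (forall u v : 'I_n, j <= u -> ((s' vMAT (n * u + v))%:R = laplacian s0 e b cR p u v)%R) /\
  s' vJP 0 = 2 ^ \max_(u < n | j <= u) low u.
suff [h1 h2] : J 0 s4.
  split=> //; first by move=> u v; apply: h1.
  by rewrite h2 /skip [in RHS]big_mkcond.
apply: vertex_for_rule => // [|j s' jn s'U fr [inv1 inv2]].
  split; last by rewrite s3J big_ord_ge_all.
  by move=> u v; rewrite leqNgt ltn_ord.
have s'st : search_static s' by rewrite /search_static !fr.
have [||new old mx] := @row_correct p (Ordinal jn) s' _ s'st _ s'U inv2.
- by move=> w; rewrite fr.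
- by apply/bigmax_leqP => u _; rewrite /low; case: ifP => // _; apply: low_bit_le.
split; last by rewrite mx (big_ord_geS _ jn).
move=> u v ju; have [->|ne] := eqVneq u (Ordinal jn); first exact: new.
by rewrite old // inv1 // ltn_neqAle ju andbT eq_sym.
Qed.

Let sdet := signed_det s0 e b cR.

Lemma search_step_correct p (s : store) :
  search_static s -> s vPOS 0 = p -> p < 2 ^ n ->
  [/\ search_static (exec search_prog s),
      exec search_prog s vPOS 0 = next_index e b c p &
      ((exec search_prog s vACC 0)%:R = (s vACC 0)%:R + sdet p)%R].
Proof.
move=> st sP hp; have [sPW sWT] := st.
rewrite /search_prog.
have -> : exec (PIf (!vWT - !vPOS)%A (matrix_prog;; det_prog;;
    vACC ::= !vACC + !vSGN * vDET.{EN};; vPOS ::= (!vPOS %/ !vJP + 1) * !vJP) PSkip) s =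
    exec (matrix_prog;; det_prog;;
    vACC ::= !vACC + !vSGN * vDET.{EN};; vPOS ::= (!vPOS %/ !vJP + 1) * !vJP) s.
  rewrite -[LHS]/(if s vWT 0 - s vPOS 0 != 0 then _ else _) sWT sP.
  by rewrite subn_eq0 -ltnNge hp.
have [mMAT mSGN mJP] := matrix_correct st sP.
rewrite sem_seq; set s1 := exec matrix_prog s in mMAT mSGN mJP *.
have fr1 a : a \notin writes matrix_prog -> s1 a = s a by move=> ha; rewrite /s1 sem_frame.
have [s1P s1A s1st] : [/\ s1 vPOS = s vPOS, s1 vACC = s vACC & search_static s1].
  by rewrite /search_static !fr1.
clearbody s1; rewrite sem_seq.
have dD := det_prog_correct adjm coinm n0 nM MR mMAT.
set s2 := exec det_prog s1 in dD *.
have fr2 a : a \notin writes det_prog -> s2 a = s1 a by move=> ha; rewrite /s2 sem_frame.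
have [s2P s2A s2S s2J] : [/\ s2 vPOS = s vPOS, s2 vACC = s vACC, s2 vSGN = s1 vSGN & s2 vJP = s1 vJP].
  by rewrite !fr2 // s1P s1A.
have s2st : search_static s2 by rewrite /search_static !fr2.
clearbody s2; rewrite sem_seq !sem_assign /=; split.
- exact: s2st.
- rewrite /upd /= s2P s2J mJP sP addn1 modn_small //.
  by apply: leq_ltn_trans pow_nM; apply: (next_index_le e b c hp).
- by rewrite /upd /= natr_mod natrD natrM s2A s2S mSGN dD.
Qed.

(** Until the range is exhausted, each round lowers the potential by at least 1, so a budget of at
    least the initial potential suffices. *)
Lemma search_loop_correct (s : store) :
  search_static s -> s vPOS 0 = 0 -> s vACC 0 = 0 -> s vBUD 0 < M ->
  exists2 p, exec (PFor iT (!vBUD)%A search_prog) s vPOS 0 = p /\ p <= 2 ^ n &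
    ((exec (PFor iT (!vBUD)%A search_prog) s vACC 0)%:R = \sum_(0 <= i < p) sdet i)%R /\
    (potential e b c 0 <= s vBUD 0 -> p = 2 ^ n).
Proof.
move=> st sP sA sB.
pose J j (s' : store) := search_static s' /\ exists2 p, s' vPOS 0 = p /\ p <= 2 ^ n &
  ((s' vACC 0)%:R = \sum_(0 <= i < p) sdet i)%R /\
  (p = 2 ^ n \/ potential e b c p + s vBUD 0 <= potential e b c 0 + j).
have [_ [p hp [hA hpot]]] : J 0 (exec (PFor iT (!vBUD)%A search_prog) s).
  have bE : aeval n M adjm coinm s (!vBUD)%A %% M = s vBUD 0 by rewrite /= modn_small.
  apply: for_rule => //; rewrite bE.
    split=> //; exists 0; first by rewrite sP.
    by rewrite sA big_geq //; split=> //; right.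
  move=> j s' jB s'T fr [st' [p [s'P hp] [s'A pot]]].
  have [pn|np] := leqP (2 ^ n) p.
    have pE : p = 2 ^ n by apply/eqP; rewrite eqn_leq hp pn.
    have -> : exec search_prog s' = s'.
      rewrite -[LHS]/(if s' vWT 0 - s' vPOS 0 != 0 then _ else s').
      by rewrite st'.2 s'P pE subnn.
    by split=> //; exists p => //; split=> //; left.
  have [st2 P2 A2] := search_step_correct st' s'P np.
  split=> //; exists (next_index e b c p).
    by split=> //; apply: next_index_le.
  split; last first.
    right; have := potential_next e b c np.
    by case: pot => [E|]; [rewrite E ltnn in np|lia].
  rewrite A2 s'A (@big_cat_nat _ _ _ p 0 (next_index e b c p)) //=; last first.
    by apply: ltnW; apply: next_index_gt.
  by rewrite (sum_signed_det_next R s0 e b c p).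
exists p => //; split=> // hB; case: hpot => // h.
have [//|np] := eqVneq p (2 ^ n).
have lt_p : p < 2 ^ n by rewrite ltn_neqAle np; case: hp.
(* An unfinished search would still have positive potential. *)
by have := potential_next e b c lt_p; lia.
Qed.

End SearchProg.

Lemma prod_ord_le (n B : nat) (P : pred 'I_n) (F : 'I_n -> nat) : 0 < B ->
  (forall u, F u <= B) -> \prod_(u < n | P u) F u <= B ^ n.
Proof.
move=> B0 hF; apply: (@leq_trans (\prod_(u < n | P u) B)).
  by apply: leq_prod => u _.
rewrite prod_nat_const leq_pexp2l // -[X in _ <= X](card_ord n).
exact: max_card.
Qed.

(** * Degrees, factorial and budget *)

Section SetupProg.
Variables (n : nat) (adjm coinm : nat -> nat -> nat).
Hypothesis n0 : 0 < n.
Let M := 2 ^ log_mod n.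
Local Notation exec := (sem n M adjm coinm).
Variable e : rel 'I_n.
Hypothesis adjmE : forall u v : 'I_n, adjm u v = e u v.

Lemma lt_mod k : k < log_mod n -> 2 ^ k < M.
Proof. by move=> h; rewrite ltn_exp2l. Qed.

Let nM : n < M.
Proof.
apply: leq_trans (ltn_expl n (isT : 1 < 2)) _; apply/ltnW/lt_mod.
by rewrite /log_mod; nia.
Qed.

Let M1 : 1 < M.
Proof. by apply: leq_ltn_trans nM. Qed.

Let idx1 i : i <= n -> i %% (n.+1 * n.+1) = i.
Proof. by move=> h; rewrite modn_small //; nia. Qed.

Definition budget_num : nat := \prod_(u < n) (2 * (2 ^ outdeg e u - 1)).
Definition budget_den : nat := \prod_(u < n) 2 ^ outdeg e u.
(** The quotient of numerator and denominator is [rate] at 0, and [6 * n + 3] is three times the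
    [2 * n + 1] of [markov_blocks]; the successor rounds up. *)
Definition budget : nat := (budget_num * (6 * n + 3) %/ budget_den).+1.

Lemma outdegE u : outdeg e u = \sum_v e u v.
Proof.
rewrite /outdeg -sum1_card big_mkcond; apply: eq_bigr => v _.
by rewrite inE; case: (e u v).
Qed.

Let partial_deg_le j u : \sum_(v < n | j <= v) e u v <= n.
Proof.
apply: (@leq_trans (\sum_(v < n) 1)); last by rewrite sum1_card card_ord.
by rewrite big_mkcond; apply: leq_sum => v _; case: ifP => // _; apply: leq_b1.
Qed.

Lemma budget_lt : budget < M.
Proof.
have h1 : budget_num <= 2 ^ (n.+1 * n).
  rewrite expnM; apply: prod_ord_le; first by rewrite expn_gt0.
  move=> u; rewrite expnS leq_mul2l /=; apply: leq_trans (leq_subr _ _) _.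
  by rewrite leq_exp2l // outdeg_le.
have h2 : 6 * n + 3 <= 2 ^ (n + 3) by have := ltn_expl n (isT : 1 < 2); rewrite expnD; lia.
apply: (@leq_ltn_trans (2 ^ (n.+1 * n + (n + 3))).+1).
  rewrite ltnS; apply: leq_trans (leq_div _ _) _; rewrite expnD; exact: leq_mul.
apply: (@leq_ltn_trans (2 ^ (n.+1 * n + (n + 3)).+1)).
  rewrite expnS mul2n -addnn -addn1 leq_add2l expn_gt0 //.
by apply: lt_mod; rewrite /log_mod; nia.
Qed.

Let setup_entry_correct (u : 'I_n) s : s iU 0 = u :> nat ->
  s vSUM 0 = 0 -> s vPWD 0 = 1 ->
  let s' := exec (PFor iV EN setup_entry) s in
  s' vSUM 0 = outdeg e u /\ s' vPWD 0 = 2 ^ outdeg e u.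
Proof.
move=> sU sS sP s'.
pose J j (s' : store) := s' vSUM 0 = \sum_(v < n | j <= v) e u v /\
  s' vPWD 0 = 2 ^ \sum_(v < n | j <= v) e u v.
suff : J 0 s' by rewrite /J outdegE.
apply: vertex_for_rule => // [|j t jn tV fr [h1 h2]].
  by rewrite /J big_ord_ge_all.
have av : adjm (t iU 0 %% n) (t iV 0 %% n) = e u (Ordinal jn).
  by rewrite fr // sU tV -adjmE !modn_small.
rewrite /setup_entry sem_seq !sem_assign /= /J /upd /= av h1 h2.
have E := big_ord_geS _ jn (fun v => nat_of_bool (e u v)).
have le := partial_deg_le j u; rewrite E /= in le *.
rewrite !modn_small.
- by split; [rewrite addnC|rewrite expnD mulnC; case: (e u _)].
- have -> : 2 ^ (\sum_(v < n | j < v) e u v) * (1 + e u (Ordinal jn)) =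
    2 ^ (e u (Ordinal jn) + \sum_(v < n | j < v) e u v).
    by rewrite expnD mulnC; case: (e u _).
  by apply: lt_mod; apply: leq_ltn_trans le _; rewrite /log_mod; nia.
- by rewrite addnC; apply: leq_ltn_trans nM.
Qed.

Let setup_inv j (s : store) : Prop :=
  [/\ forall u : 'I_n, j <= u -> s vDEG u = outdeg e u,
      s vFAC 0 = \prod_(u < n | j <= u) u.+1,
      s vNUM 0 = \prod_(u < n | j <= u) (2 * (2 ^ outdeg e u - 1)) &
      s vDEN 0 = \prod_(u < n | j <= u) 2 ^ outdeg e u].

Let setup_row_correct (u : 'I_n) s : s iU 0 = u :> nat ->
  setup_inv u.+1 s -> setup_inv u (exec setup_row s).
Proof.
move=> sU [sD sF sN sE].
rewrite /setup_row sem_seq; set s1 := exec (vFAC ::= _) s.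
have s1F : s1 vFAC 0 = \prod_(v < n | u <= v) v.+1.
  rewrite /s1 sem_assign /= /upd /= sF sU addn1 big_ord_ge /= mulnC modn_small //.
  rewrite -(big_ord_ge _ u (fun v : 'I_n => v.+1)).
  apply: (@leq_ltn_trans (2 ^ (n * n))); last by apply: lt_mod; rewrite /log_mod; nia.
  rewrite expnM; apply: prod_ord_le => [|v]; first by rewrite expn_gt0.
  by apply: leq_trans (ltn_ord v) (ltnW (ltn_expl _ _)).
have fr1 a : a \notin [:: vFAC] -> s1 a = s a by move=> ha; rewrite /s1 sem_frame.
clearbody s1; rewrite sem_seq; set s2 := exec (vPWD ::= _) s1.
have s2P : s2 vPWD 0 = 1 by rewrite /s2 sem_assign /= /upd /= modn_small.
have fr2 a : a \notin [:: vPWD] -> s2 a = s1 a by move=> ha; rewrite /s2 sem_frame.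
clearbody s2; rewrite sem_seq; set s3 := exec (vSUM ::= _) s2.
have s3S : s3 vSUM 0 = 0 by rewrite /s3 sem_assign /= /upd /= mod0n.
have fr3 a : a \notin [:: vSUM] -> s3 a = s2 a by move=> ha; rewrite /s3 sem_frame.
have s3P : s3 vPWD 0 = 1 by rewrite fr3.
have s3U : s3 iU 0 = u :> nat by rewrite fr3 // fr2 // fr1.
clearbody s3; rewrite sem_seq; set s4 := exec (PFor _ _ _) s3.
have [s4S s4P] : s4 vSUM 0 = outdeg e u /\ s4 vPWD 0 = 2 ^ outdeg e u.
  exact: setup_entry_correct s3U s3S s3P.
have fr4 a : a \notin writes (PFor iV EN setup_entry) -> s4 a = s3 a.
  by move=> ha; rewrite /s4 sem_frame.
have [s4U s4D s4N s4E] : [/\ s4 iU 0 = u :> nat, s4 vDEG = s vDEG, s4 vNUM = s vNUM &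
    s4 vDEN = s vDEN].
  by rewrite !fr4 // s3U !fr3 // !fr2 // !fr1.
have s4F : s4 vFAC = s1 vFAC by rewrite !fr4 // !fr3 // !fr2.
clearbody s4; rewrite sem_seq [exec (vDEG @ _ ::= _) s4]/= s4U s4S idx1 ?(ltnW (ltn_ord u)) //.
rewrite modn_small ?(leq_ltn_trans (outdeg_le e u) nM) // sem_seq !sem_assign /= /upd /=.
rewrite s4P s4N s4E sN sE; split=> /=.
- move=> v uv; case: eqVneq => [/val_inj -> //|ne].
  by rewrite s4D sD // ltn_neqAle uv andbT eq_sym.
- by rewrite s4F s1F.
- rewrite big_ord_ge /= mulnC modn_small //.
  rewrite -(big_ord_ge _ u (fun v : 'I_n => 2 * (2 ^ outdeg e v - 1))).
  apply: (@leq_ltn_trans (2 ^ (n.+1 * n))); last by apply: lt_mod; rewrite /log_mod; nia.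
  rewrite expnM; apply: prod_ord_le => [|v]; first by rewrite expn_gt0.
  rewrite expnS leq_mul2l /=; apply: leq_trans (leq_subr _ _) _.
  by rewrite leq_exp2l // outdeg_le.
- rewrite big_ord_ge /= mulnC modn_small //.
  rewrite -(big_ord_ge _ u (fun v : 'I_n => 2 ^ outdeg e v)).
  apply: (@leq_ltn_trans (2 ^ (n * n))); last by apply: lt_mod; rewrite /log_mod; nia.
  rewrite expnM; apply: prod_ord_le => [|v]; first by rewrite expn_gt0.
  by rewrite leq_exp2l // outdeg_le.
Qed.

Lemma setup_correct s :
  let s' := exec setup_prog s in
  [/\ forall u : 'I_n, s' vDEG u = outdeg e u, s' vFAC 0 = n`! & s' vBUD 0 = budget].
Proof.
rewrite /setup_prog sem_seq; set s1 := exec (vFAC ::= _) s.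
have s1F : s1 vFAC 0 = 1 by rewrite /s1 sem_assign /= /upd /= modn_small.
clearbody s1; rewrite sem_seq; set s2 := exec (vNUM ::= _) s1.
have s2N : s2 vNUM 0 = 1 by rewrite /s2 sem_assign /= /upd /= modn_small.
have fr2 a : a \notin [:: vNUM] -> s2 a = s1 a by move=> ha; rewrite /s2 sem_frame.
clearbody s2; rewrite sem_seq; set s3 := exec (vDEN ::= _) s2.
have s3D : s3 vDEN 0 = 1 by rewrite /s3 sem_assign /= /upd /= modn_small.
have fr3 a : a \notin [:: vDEN] -> s3 a = s2 a by move=> ha; rewrite /s3 sem_frame.
have [s3F s3N] : s3 vFAC 0 = 1 /\ s3 vNUM 0 = 1 by rewrite !fr3 // s2N fr2.
clearbody s3; rewrite sem_seq; set s4 := exec (PFor _ _ _) s3.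
have [h1 h2 h3 h4] : setup_inv 0 s4.
  apply: vertex_for_rule => // [|j t jn tU fr]; last exact: (@setup_row_correct (Ordinal jn)).
  split; rewrite ?s3F ?s3N ?s3D ?big_ord_ge_all // => u.
  by rewrite leqNgt ltn_ord.
clearbody s4; rewrite sem_assign /= /upd /=; split.
- by move=> u; rewrite h1.
- by rewrite h2 fact_prod big_add1 big_mkord.
- by rewrite h3 h4 addn1 modn_small // budget_lt.
Qed.

End SetupProg.

(** * Correctness of the greedy order *)

Section OrderProg.
Variables (n : nat) (adjm coinm : nat -> nat -> nat).
Hypothesis n0 : 0 < n.
Let M := 2 ^ log_mod n.
Local Notation exec := (sem n M adjm coinm).
Variable e : rel 'I_n.
Hypothesis adjmE : forall u v : 'I_n, adjm u v = e u v.

Let lt_modM k : k < log_mod n -> 2 ^ k < M := @lt_mod n k.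

Let nM : n < M.
Proof.
apply: leq_trans (ltn_expl n (isT : 1 < 2)) _; apply/ltnW/lt_modM.
by rewrite /log_mod; nia.
Qed.

Let M1 : 1 < M.
Proof. by apply: leq_ltn_trans nM. Qed.

Let idx1 i : i <= n -> i %% (n.+1 * n.+1) = i.
Proof. by move=> h; rewrite modn_small //; nia. Qed.

Let out_of (U : {set 'I_n}) u := #|[set w in U | e u w]%SET|.

Let out_of_avoids (U : {set 'I_n}) u : 1 - out_of U u = avoids e U u.
Proof.
rewrite /out_of /avoids; case: forallP => h /=.
  rewrite (_ : [set _ in _ | _]%SET = finset.set0) ?cards0 //; apply/finset.setP => w.
  rewrite !inE; apply/negbTE; rewrite negb_and.
  by have := h w; case: (e u w); rewrite /= ?orbT // => ->.
suff : 0 < out_of U u by rewrite /out_of; case: #|_|.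
have /forallPn[w] : ~~ [forall w, e u w ==> (w \notin U)] by apply/forallP.
rewrite negb_imply negbK => /andP[euw wU].
by apply/card_gt0P; exists w; rewrite inE wU.
Qed.

Let loadM (U : {set 'I_n}) w : load e U w =
  \sum_(u < n) e u w * ((1 - out_of U u) * (n`! %/ outdeg e u)).
Proof.
rewrite /load big_mkcond; apply: eq_bigr => u _; rewrite out_of_avoids.
by case: (e u w); case: (avoids e U u); rewrite /= ?mul0n ?mul1n.
Qed.

Let order_static (U : {set 'I_n}) (s : store) : Prop :=
  [/\ forall u : 'I_n, s vDEG u = outdeg e u, s vFAC 0 = n`! &
      forall u : 'I_n, s vOUT u = out_of U u].

Let load_correct (U : {set 'I_n}) (w : 'I_n) s : order_static U s ->
  s iW 0 = w :> nat -> exec load_prog s vSUM 0 = load e U w.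
Proof.
move=> [sD sF sO] sW; rewrite /load_prog sem_seq; set s1 := exec (vSUM ::= _) s.
have s1S : s1 vSUM 0 = 0 by rewrite /s1 sem_assign /= /upd /= mod0n.
have fr1 a : a \notin [:: vSUM] -> s1 a = s a by move=> ha; rewrite /s1 sem_frame.
clearbody s1; pose t (u : 'I_n) := e u w * ((1 - out_of U u) * (n`! %/ outdeg e u)).
set s2 := exec (PFor _ _ _) s1.
pose J j (s' : store) := s' vSUM 0 = \sum_(u < n | j <= u) t u.
suff : J 0 s2 by rewrite /J loadM.
apply: vertex_for_rule => // [|j s' jn s'U fr h].
  by rewrite /J big_ord_ge_all.
have av : adjm (s' iU 0 %% n) (s' iW 0 %% n) = e (Ordinal jn) w.
  by rewrite s'U fr // fr1 // sW -adjmE !modn_small.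
rewrite /J sem_assign /= /upd /= av h s'U.
have [fO fF fD] : [/\ s' vOUT = s vOUT, s' vFAC = s vFAC & s' vDEG = s vDEG].
  by rewrite !fr // !fr1.
rewrite fO fF fD (sO (Ordinal jn)) sF (sD (Ordinal jn)).
rewrite -/(t (Ordinal jn)) addnC -(big_ord_geS _ jn t) modn_small //.
apply: (@leq_ltn_trans (2 ^ (n + n * n))); last by apply: lt_modM; rewrite /log_mod; nia.
have fact_le : n`! <= 2 ^ (n * n).
  rewrite fact_prod big_add1 big_mkord expnM; apply: prod_ord_le => [|v].
    by rewrite expn_gt0.
  by apply: leq_trans (ltn_ord v) (ltnW (ltn_expl _ _)).
apply: (@leq_trans (n * n`!)).
  rewrite -[X in _ <= X * _](card_ord n) -sum_nat_const big_mkcond.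
  apply: leq_sum => u _; case: ifP => // _; rewrite /t.
  apply: leq_trans (leq_div n`! (outdeg e u)).
  by rewrite out_of_avoids; case: (e u w); case: (avoids e U u); rewrite /= ?mul0n ?mul1n.
by rewrite expnD leq_mul // ltnW // ltn_expl.
Qed.

(* Outcome of the selection of the next vertex after the candidates [w >= j]
   have been examined. *)
Let chosen (U : {set 'I_n}) j (s : store) : Prop :=
  (s vBEST 0 = n /\ forall w : 'I_n, j <= w -> w \in U) \/
  exists w0 : 'I_n, [/\ s vBEST 0 = w0 :> nat, w0 \notin U &
    forall w : 'I_n, j <= w -> w \notin U -> load e U w <= n`! -> load e U w0 <= n`!].

Let choose_correct (U : {set 'I_n}) (w : 'I_n) s : order_static U s ->
  (forall v : 'I_n, s vUSED v = (v \in U)) ->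
  s iW 0 = w :> nat -> chosen U w.+1 s -> chosen U w (exec choose_prog s).
Proof.
move=> st sU sW ch; rewrite /choose_prog.
have splitw (v : 'I_n) : w <= v -> v = w \/ w < v.
  by rewrite leq_eqVlt => /predU1P[/val_inj ->|]; [left|right].
have [wU|wU] := boolP (w \in U).
  rewrite sem_if [aeval _ _ _ _ _ _]/= sW sU wU.
  case: ch => [[sB h]|[w0 [sB w0U h]]]; [left|right].
    by split=> // v /splitw[->|/h].
  exists w0; split=> // v /splitw[->|/h //].
  by rewrite wU.
rewrite sem_if [aeval _ _ _ _ _ _]/= sW sU (negPf wU) sem_seq; set s1 := exec load_prog s.
have s1S : s1 vSUM 0 = load e U w by apply: load_correct st sW.
have fr1 a : a \notin writes load_prog -> s1 a = s a by move=> ha; rewrite /s1 sem_frame.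
have [s1F s1B s1W] : [/\ s1 vFAC 0 = n`!, s1 vBEST = s vBEST & s1 iW 0 = w :> nat].
  by rewrite !fr1 //; case: st.
clearbody s1.
rewrite sem_if [aeval _ _ _ _ _ _]/= s1S s1F; case: ifP => [cond|/negbFE cond].
  case: ch => [[sB h]|[w0 [sB w0U h]]].
    by move: cond; rewrite s1B sB subnn muln0.
  right; exists w0; rewrite -[exec PSkip s1]/s1 s1B; split=> // v /splitw[->|/h //] _ le.
  by move: cond; rewrite (eqP (_ : load e U w - n`! == 0)) ?mul0n // subn_eq0.
right; exists w; split=> //.
  by rewrite sem_assign /upd /= s1W modn_small // (ltn_trans (ltn_ord w)).
move=> v /splitw[-> //|wv] vU le.
case: ch => [[sB h]|[w0 [sB w0U h]]]; first by rewrite h in vU.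
move: cond; rewrite s1B sB muln_eq0 !subn_eq0 [n <= w0]leqNgt ltn_ord orbF //.
Qed.

(** [U] is the set of vertices with a bit and [bw] their positions. The load bound refers to the
    vertices placed earlier and presupposes a cycle cover. *)
Definition placed (j : nat) (s : store) (U : {set 'I_n}) (bw : 'I_n -> nat) : Prop :=
  [/\ order_static U s /\ (forall v : 'I_n, s vUSED v = (v \in U)),
      #|U| = n - j, s vWT 0 = 2 ^ (n - j),
      (forall w, w \in U -> s vPW w = 2 ^ bw w /\ bw w < n - j) /\ {in U &, injective bw} &
      (exists f : 'S_n, forall u, e u (f u)) ->
      forall w, w \in U -> load e [set v in U | bw v < bw w]%SET w <= n`!].

Let place_correct j s U bw : j < n -> placed j.+1 s U bw ->
  exists U' bw', placed j (exec place_prog s) U' bw'.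
Proof.
move=> jn [[[sD sF sO] sU] cU sW [sPW inj] greedy].
rewrite /place_prog sem_seq; set s1 := exec (vBEST ::= EN) s.
have s1B : s1 vBEST 0 = n by rewrite /s1 sem_assign /upd /= modn_small.
have fr1 a : a \notin [:: vBEST] -> s1 a = s a by move=> ha; rewrite /s1 sem_frame.
clearbody s1; rewrite sem_seq; set s2 := exec (PFor _ _ _) s1.
have fr2 a : a \notin writes (PFor iW EN choose_prog) -> s2 a = s1 a.
  by move=> ha; rewrite /s2 sem_frame.
have ch : chosen U 0 s2.
  apply: vertex_for_rule => // [|k s' kn s'W fr h].
    by left; split=> // w; rewrite leqNgt ltn_ord.
  apply: (@choose_correct U (Ordinal kn)) => //.
    by rewrite /order_static !fr // !fr1.
  by move=> v; rewrite fr // fr1.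
have [s2U s2PW s2O s2D] : [/\ s2 vUSED = s vUSED, s2 vPW = s vPW, s2 vOUT = s vOUT & s2 vDEG = s vDEG].
  by rewrite !fr2 // !fr1.
have [s2F s2W] : s2 vFAC = s vFAC /\ s2 vWT = s vWT by rewrite !fr2 // !fr1.
clearbody s2.
have [w0 [s2B w0U best]] : exists w0 : 'I_n, [/\ s2 vBEST 0 = w0 :> nat, w0 \notin U &
    forall w, w \notin U -> load e U w <= n`! -> load e U w0 <= n`!].
  case: ch => [[_ h]|[w0 [sB w0U h]]]; last first.
    by exists w0; split=> // w; apply: h.
  suff : n <= #|U| by rewrite cU; lia.
  rewrite -[X in X <= _](card_ord n); apply: subset_leq_card.
  by apply/fintype.subsetP => w _; apply: h.
clear ch; rewrite sem_seq; set s3 := exec (vUSED @ _ ::= _) s2.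
have s3U (v : 'I_n) : s3 vUSED v = (v \in w0 |: U)%SET.
  rewrite /s3 /= s2B idx1 ?(ltnW (ltn_ord w0)) // modn_small // /upd /= s2U sU !inE.
  by rewrite -(inj_eq val_inj) /=; case: eqVneq.
have fr3 a : a \notin [:: vUSED] -> s3 a = s2 a by move=> ha; rewrite /s3 sem_frame.
clearbody s3; rewrite sem_seq; set s4 := exec (vPW @ _ ::= _) s3.
have powW : 2 ^ (n - j.+1) < M by apply: lt_modM; rewrite /log_mod; nia.
have s4PW (v : 'I_n) : s4 vPW v = if v == w0 then 2 ^ (n - j.+1) else s vPW v.
  rewrite /s4 /= fr3 // s2B idx1 ?(ltnW (ltn_ord w0)) // fr3 // s2W sW modn_small //.
  by rewrite /upd /= fr3 // s2PW.
have fr4 a : a \notin [:: vPW] -> s4 a = s3 a by move=> ha; rewrite /s4 sem_frame.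
clearbody s4; rewrite sem_seq; set s5 := exec (vWT ::= _) s4.
have s5W : s5 vWT 0 = 2 ^ (n - j).
  rewrite /s5 sem_assign /upd /= fr4 // fr3 // s2W sW -expnSr -subSn // subSS.
  by rewrite modn_small //; apply: lt_modM; rewrite /log_mod; nia.
have fr5 a : a \notin [:: vWT] -> s5 a = s4 a by move=> ha; rewrite /s5 sem_frame.
have [s5U s5PW] : s5 vUSED = s3 vUSED /\ s5 vPW = s4 vPW by rewrite !fr5 // fr4.
have [s5O s5D] : s5 vOUT = s vOUT /\ s5 vDEG = s vDEG.
  by rewrite !fr5 // !fr4 // !fr3 // s2O.
have [s5F s5B] : s5 vFAC = s vFAC /\ s5 vBEST 0 = w0 :> nat.
  by rewrite !fr5 // !fr4 // !fr3 // s2F.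
clearbody s5; set s6 := exec (PFor _ _ _) s5.
have out_step u : out_of (w0 |: U)%SET u = out_of U u + e u w0.
  rewrite /out_of; have [euw|neuw] := boolP (e u w0); last first.
    rewrite addn0; apply: eq_card => v; rewrite !inE.
    by case: eqVneq => //= ->; rewrite (negPf neuw) (negPf w0U).
  transitivity #|(w0 |: [set w in U | e u w])%SET|.
    by apply: eq_card => v; rewrite !inE; case: eqVneq => //= ->; rewrite euw.
  by rewrite cardsU1 !inE (negPf w0U) addnC.
have s6O (u : 'I_n) : s6 vOUT u = out_of (w0 |: U)%SET u.
  pose J k (s' : store) := (forall u : 'I_n, k <= u -> s' vOUT u = out_of (w0 |: U)%SET u) /\
    (forall u : 'I_n, u < k -> s' vOUT u = out_of U u).
  suff [h _] : J 0 s6 by apply: h.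
  apply: vertex_for_rule => // [|k s' kn s'U fr [h1 h2]].
    by split=> v; [rewrite leqNgt ltn_ord|rewrite s5O].
  have av : adjm (s' iU 0 %% n) (s' vBEST 0 %% n) = e (Ordinal kn) w0.
    by rewrite s'U fr // s5B -adjmE !modn_small.
  have le_out : out_of U (Ordinal kn) + e (Ordinal kn) w0 <= n.
    by rewrite -out_step -[X in _ <= X](card_ord n); apply: max_card.
  split=> v kv; rewrite /= /upd /= av s'U idx1 ?(ltnW kn) // (h2 (Ordinal kn)) //.
    rewrite modn_small ?(leq_ltn_trans le_out nM) //.
    case: eqVneq => [E|ne]; last by rewrite h1 // ltn_neqAle kv andbT eq_sym.
    by rewrite (_ : v = Ordinal kn) ?out_step //; apply: val_inj.
  by rewrite ltn_eqF // h2 // ltnW.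
have fr6 a : a \notin [:: iU; vOUT] -> s6 a = s5 a by move=> ha; rewrite /s6 sem_frame.
clearbody s6.
pose bw' v := if v == w0 then n - j.+1 else bw v.
have ltU v : v \in U -> v == w0 = false by move=> vU; apply/eqP => E; rewrite -E vU in w0U.
have nj : n - j = (n - j.+1).+1 by rewrite subnSK.
exists (w0 |: U)%SET, bw'; split.
- split; first by split=> // [u|]; rewrite fr6 ?s5D ?s5F.
  by move=> v; rewrite fr6 // s5U s3U.
- by rewrite cardsU1 w0U cU add1n nj.
- by rewrite fr6.
- split=> [w|w w']; rewrite ?fr6 // ?s5PW ?s4PW !inE /bw'.
    case: eqVneq => [_ _|ne /= wU]; first by rewrite nj.
    by have [-> h] := sPW w wU; rewrite nj ltnS ltnW.
  case: eqVneq => [->|ne] /=; case: eqVneq => [->|ne'] //= wU.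
  + by move=> wU' E; have [_] := sPW _ wU'; rewrite -E ltnn.
  + by move=> _ E; have [_] := sPW _ wU; rewrite E ltnn.
  + by move=> wU'; apply: inj.
- move=> ham w; rewrite !inE => wU'.
  have [->|ne] := eqVneq w w0.
    have -> : [set v in w0 |: U | bw' v < bw' w0]%SET = U.
      apply/finset.setP => v; rewrite !inE /bw' eqxx.
      case: eqVneq => [->|nv] /=; first by rewrite ltnn (negPf w0U).
      by case: (boolP (v \in U)) => // vU; have [_ ->] := sPW v vU.
    have [f hf] := ham; have [|w1 w1U le] := load_le_fact (U := U) hf.
      by apply/eqP => E; move: w0U; rewrite E finset.in_setT.
    exact: best w1U le.
  have wU : w \in U by move: wU'; rewrite (negPf ne).
  (* The new vertex takes the highest position, so it precedes none of the old ones. *)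
  have -> : [set v in w0 |: U | bw' v < bw' w]%SET = [set v in U | bw v < bw w]%SET.
    apply/finset.setP => v; rewrite !inE /bw' (negPf ne).
    case: eqVneq => [->|nv] //=; rewrite (negPf w0U).
    by have [_] := sPW w wU; case: ltngtP => // h1 h2; have := ltn_trans h1 h2; rewrite ltnn.
  exact: greedy.
Qed.

Lemma order_correct (s : store) :
  (forall u : 'I_n, s vDEG u = outdeg e u) -> s vFAC 0 = n`! ->
  (forall i, s vOUT i = 0) -> (forall i, s vUSED i = 0) ->
  exists b : 'S_n, [/\ search_static b (exec order_prog s) &
    (exists f : 'S_n, forall u, e u (f u)) ->
    forall w, \sum_(u | e u w && (b w <= low_bit e b u)) n`! %/ outdeg e u <= n`!].
Proof.
move=> sD sF sO sU; rewrite /order_prog sem_seq; set s1 := exec (vWT ::= _) s.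
have s1W : s1 vWT 0 = 1 by rewrite /s1 sem_assign /upd /= modn_small.
have fr1 a : a \notin [:: vWT] -> s1 a = s a by move=> ha; rewrite /s1 sem_frame.
clearbody s1; set s2 := exec (PFor _ _ _) s1.
pose J j (s' : store) := exists U bw, placed j s' U bw.
have [U [bw [_ cU sW [sPW inj] greedy]]] : J 0 s2.
  apply: vertex_for_rule => // [|j s' jn _ _ [U [bw h]]]; last exact: place_correct h.
  exists finset.set0, (fun=> 0); split.
  - split; first (split=> [u||u]; rewrite fr1 // ?sO /out_of).
      by rewrite (_ : [set _ in _ | _]%SET = finset.set0) ?cards0 //; apply/finset.setP => w; rewrite !inE.
    by move=> v; rewrite fr1 // sU inE.
  - by rewrite cards0 subnn.
  - by rewrite subnn.
  - by split=> [w|w w']; rewrite inE.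
  - by move=> _ w; rewrite inE.
rewrite subn0 in cU sPW sW.
have UT : U = [set: 'I_n]%SET.
  by apply/eqP; rewrite eqEcard finset.subsetT cardsT card_ord cU leqnn.
have bwlt w : bw w < n by have [|_ ->] := sPW w; rewrite ?UT ?inE.
have bwinj : injective (fun w => Ordinal (bwlt w)).
  by move=> w w' [] /inj; apply; rewrite UT inE.
pose b := perm bwinj.
have bE w : b w = bw w :> nat by rewrite permE.
exists b; split.
  by split=> // w; rewrite bE; have [|-> _] := sPW w; rewrite ?UT ?inE.
move=> ham w; have := greedy ham w; rewrite UT inE => /(_ isT); apply: leq_trans.
rewrite /load; apply: eq_leq; apply: eq_bigl => u; congr (_ && _).
apply/(low_bit_leP _ _ _ (ltnW (ltn_ord (b w))))/forallP => h v.
  by apply/implyP => /h; rewrite !inE /= -!bE -leqNgt.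
by move=> euv; have := h v; rewrite euv !inE /= -!bE -leqNgt.
Qed.

End OrderProg.

(** * Correctness of the whole program *)

Fixpoint coin_free_expr (e : aexpr) : bool :=
  match e with
  | ECst _ | EN | EMod => true
  | EAdj e1 e2 | EBin _ e1 e2 => coin_free_expr e1 && coin_free_expr e2
  | ECoin _ _ => false
  | EArr _ e1 => coin_free_expr e1
  end.

Fixpoint coin_free (p : aprog) : bool :=
  match p with
  | PSkip => true
  | PSet _ e1 e2 => coin_free_expr e1 && coin_free_expr e2
  | PSeq p q => coin_free p && coin_free q
  | PIf e p q => [&& coin_free_expr e, coin_free p & coin_free q]
  | PFor _ e p => coin_free_expr e && coin_free p
  end.

(** The order [b] must be the same for all tapes, since the expectation is taken over the coins with
    [b] fixed. *)
Lemma sem_coin_free n M adjm coinm coinm' p s : coin_free p ->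
  sem n M adjm coinm p s = sem n M adjm coinm' p s.
Proof.
have ev s' e : coin_free_expr e -> aeval n M adjm coinm s' e = aeval n M adjm coinm' s' e.
  elim: e => //= [e1 IH1 e2 IH2 /andP[/IH1-> /IH2->] //|k e1 IH1 /IH1-> //|].
  by move=> o e1 IH1 e2 IH2 /andP[/IH1-> /IH2->].
elim: p s => //= [k e1 e2 s /andP[h1 h2]|p IHp q IHq s /andP[/IHp hp /IHq hq]
    |e p IHp q IHq s /and3P[he /IHp hp /IHq hq]|k e p IHp s /andP[he /IHp hp]].
- by rewrite !ev.
- by rewrite hp hq.
- by rewrite ev // hp hq.
- rewrite ev //; move: (_ %% M) (upd s _ _ _) => N; elim: N => //= N IHN s'.
  by rewrite hp IHN.
Qed.

Lemma nth_allpairs (S1 S2 U : Type) (f : S1 -> S2 -> U) x0 y0 z0 s t i j :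
  i < size s -> j < size t ->
  nth z0 [seq f x y | x <- s, y <- t] (size t * i + j) = f (nth x0 s i) (nth y0 t j).
Proof.
elim: s i => //= x s IH [|i]; rewrite ?ltnS => hi hj; rewrite nth_cat size_map.
  by rewrite muln0 add0n hj (nth_map y0).
by rewrite mulnS -addnA ltnNge leq_addr /= addKn IH.
Qed.

Lemma nth_digraph_code (G : digraph) (u v : 'I_(nvert G)) :
  nth 0 (digraph_code G) (1 + (nvert G * u + v)) = adj u v.
Proof.
have := @nth_allpairs _ _ _ (fun u v => nat_of_bool (@adj G u v)) u v 0
  (enum 'I_(nvert G)) (enum 'I_(nvert G)) u v.
by rewrite !size_enum_ord !nth_ord_enum; apply.
Qed.

Lemma size_digraph_code (G : digraph) :
  size (digraph_code G) = (nvert G * nvert G).+1.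
Proof. by rewrite /= size_allpairs size_enum_ord. Qed.

Definition order_phase : aprog := setup_prog;; order_prog.

Section Main.
Variable G : digraph.
Let n := nvert G.
Hypothesis n0 : 0 < n.
Let M := 2 ^ log_mod n.
Let e : rel 'I_n := @adj G.

Definition adj_cell (u v : nat) : nat := nth 0 (digraph_code G) (1 + (n * u + v)).
Definition coin_cell (w : seq bool) (u v : nat) : nat := nat_of_bool (nth false w (n * u + v)).

Let adjE (u v : 'I_n) : adj_cell u v = e u v.
Proof. exact: nth_digraph_code. Qed.

Definition prepared (w : seq bool) : store :=
  sem n M adj_cell (coin_cell w) order_phase (fun _ _ => 0).

Lemma prepared_coins w w' : prepared w = prepared w'.
Proof. exact: sem_coin_free. Qed.

Lemma prepared_frame w a :
  a \notin writes order_phase -> prepared w a = fun=> 0.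
Proof. by move=> ha; rewrite /prepared sem_frame. Qed.

Lemma prepared_correct : exists b : 'S_n, forall w,
  [/\ search_static b (prepared w), prepared w vBUD 0 = budget e &
    (exists f : 'S_n, forall u, e u (f u)) ->
    forall w, \sum_(u | e u w && (b w <= low_bit e b u)) n`! %/ outdeg e u <= n`!].
Proof.
have [hD hF hB] := setup_correct (coin_cell [::]) n0 adjE (fun _ _ => 0).
have fr a : a \notin writes setup_prog ->
    sem n M adj_cell (coin_cell [::]) setup_prog (fun _ _ => 0) a = fun=> 0.
  by move=> ha; rewrite sem_frame.
have [||b [hb1 hb2]] := order_correct (coin_cell [::]) n0 adjE hD hF.
- by move=> i; rewrite fr.
- by move=> i; rewrite fr.
exists b => w; rewrite (prepared_coins w [::]) /prepared sem_seq; split=> //.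
by rewrite sem_frame.
Qed.

Let M1 : 1 < M.
Proof. by rewrite -(expn0 2) ltn_exp2l // /log_mod. Qed.

Let natr_eq0 x : ((x%:R : 'Z_M) == 0)%R = (M %| x).
Proof.
by rewrite -(inj_eq val_inj) /= val_Zp_nat.
Qed.

Let cards := #|cycle_perms (Ordinal n0) e|.

(** At most n! permutations are counted, so the count vanishes modulo [M] only if it is 0. *)
Let cards_lt : cards < M.
Proof.
apply: (@leq_ltn_trans (2 ^ (n * n))); last first.
  by rewrite ltn_exp2l // /log_mod; lia.
apply: leq_trans (max_card _) _; rewrite card_Sn fact_prod big_add1 big_mkord expnM.
apply: prod_ord_le => [|v]; first by rewrite expn_gt0.
by apply: leq_trans (ltn_ord v) (ltnW (ltn_expl _ _)).
Qed.

Definition outcome (w : seq bool) : nat :=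
  sem n M adj_cell (coin_cell w) main_prog (fun _ _ => 0) vRES 0.

(** A nonzero outcome requires a complete search, whose accumulator is the number of Hamiltonian
    cycles modulo [M]; completeness is guaranteed when the blocks fit into the budget. *)
Lemma main_correct : exists b : 'S_n,
  [/\ (exists f : 'S_n, forall u, e u (f u)) -> forall w,
        \sum_(u | e u w && (b w <= low_bit e b u)) n`! %/ outdeg e u <= n`!,
      forall w, outcome w != 0 -> hamiltonian G &
      forall w, hamiltonian G -> blocks e b w <= budget e -> outcome w != 0].
Proof.
have [b hb] := prepared_correct; exists b.
have pow_nM : 2 ^ n < M by rewrite ltn_exp2l // /log_mod; nia.
have MR : (M%:R = 0 :> 'Z_M)%R by apply/eqP; rewrite natr_eq0.
have main w : exists2 p, p <= 2 ^ n &
    (blocks e b w <= budget e -> p = 2 ^ n) /\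
    exists2 acc, (acc%:R = \sum_(0 <= i < p) signed_det (Ordinal n0) e b
       (fun u v => (coins_of n w u v)%:R) i :> 'Z_M)%R &
      outcome w = (1 - (2 ^ n - p)) * acc %% M.
  have [st sB _] := hb w.
  have coinE (u v : 'I_n) : coin_cell w u v = coins_of n w u v by rewrite !ffunE.
  have [||| p [pP hp] [pA pB]] := @search_loop_correct n M adj_cell (coin_cell w)
    n0 pow_nM e (fun u v => coins_of n w u v) b adjE coinE 'Z_M MR (prepared w) st.
  - by rewrite prepared_frame.
  - by rewrite prepared_frame.
  - by rewrite sB budget_lt.
  have sWT : sem n M adj_cell (coin_cell w) (PFor iT (!vBUD)%A search_prog)
      (prepared w) vWT 0 = 2 ^ n by rewrite sem_frame //; case: st.
  exists p => //; split; first by rewrite /blocks -sB.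
  have -> : outcome w = sem n M adj_cell (coin_cell w)
      (vRES ::= (1 - (!vWT - !vPOS)) * !vACC)
      (sem n M adj_cell (coin_cell w) (PFor iT (!vBUD)%A search_prog) (prepared w)) vRES 0.
    by [].
  move: sWT pP pA; set sL := sem _ _ _ _ (PFor _ _ _) _; clearbody sL => sWT pP pA.
  exists (sL vACC 0) => //.
  by rewrite sem_assign /upd /= sWT pP.
have sum_all w : (\sum_(0 <= i < 2 ^ n) signed_det (Ordinal n0) e b
       (fun u v => (coins_of n w u v)%:R) i = cards%:R :> 'Z_M)%R.
  by rewrite big_mkord sum_signed_det.
have hamE : hamiltonian G <-> 0 < cards by apply: hamiltonian_cycle_perms.
split=> [|w|w ham hw]; first by case: (hb [::]).
- have [p hp [_ [acc hacc ->]]] := main w => nz.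
  have [pE|np] := eqVneq p (2 ^ n); last first.
    have : 0 < 2 ^ n - p by rewrite subn_gt0 ltn_neqAle np hp.
    by case: (2 ^ n - p) nz => // k; rewrite subSS sub0n mul0n mod0n eqxx.
  move: nz; rewrite pE subnn mul1n => nz; apply/hamE; rewrite lt0n.
  apply: contra nz => /eqP c0; move: hacc; rewrite pE sum_all c0 mulr0n => /eqP.
  by rewrite natr_eq0.
- have [p hp [hpw [acc hacc ->]]] := main w.
  rewrite (hpw hw) subnn mul1n; rewrite (hpw hw) sum_all in hacc.
  have c0 : 0 < cards by apply/hamE.
  rewrite -[_ == 0]/(M %| acc) -natr_eq0 hacc natr_eq0.
  by rewrite gtnNdvd.
Qed.

End Main.

(** * Running time, space and error probability *)

Definition write_answer : prog := Assign (Const 0) (compile_expr (!vRES)%A).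

Definition hamilton_prog : prog :=
  Seq init_prog (Seq (compile main_prog) write_answer).

(** Covers all work outside the main loop and one round of it, so that a factor [(budget e).+1]
    bounds the whole run. *)
Definition step_factor (n : nat) : nat :=
  6 * (n * n) + 20 + static_time n setup_prog + static_time n order_prog +
  static_time n search_prog.

Section Run.
Variable G : digraph.
Let n := nvert G.
Hypothesis n0 : 0 < n.
Let M := 2 ^ log_mod n.
Let e : rel 'I_n := @adj G.
Let Kc := prog_weight hamilton_prog * (log_mod n).+1.
Let Sp := mem_size n * (log_mod n).+2.

Lemma time_main_le w :
  time n M (adj_cell G) (coin_cell G w) main_prog (fun _ _ => 0) <=
  static_time n setup_prog + static_time n order_prog + 7 +
  budget e * (3 + static_time n search_prog).
Proof.
have time_seq p q s : time n M (adj_cell G) (coin_cell G w) (p ;; q) s =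
    1 + time n M (adj_cell G) (coin_cell G w) p s +
    time n M (adj_cell G) (coin_cell G w) q (sem n M (adj_cell G) (coin_cell G w) p s) by [].
rewrite /main_prog 3!time_seq.
have h1 := @time_le n M (adj_cell G) (coin_cell G w) setup_prog (fun _ _ => 0) isT.
set s1 := sem _ _ _ _ setup_prog _.
have h2 := @time_le n M (adj_cell G) (coin_cell G w) order_prog s1 isT.
rewrite -[sem _ _ _ _ order_prog s1]/(prepared G w).
have [b hb] := prepared_correct n0; have [_ hB _] := hb w.
have := @loop_time_le (static_time n search_prog) (prepared G w vBUD 0 %% M)
  (fun j s' => time n M (adj_cell G) (coin_cell G w) search_prog (upd s' iT 0 j))
  (fun j s' => sem n M (adj_cell G) (coin_cell G w) search_prog (upd s' iT 0 j))
  (upd (prepared G w) iT 0 (prepared G w vBUD 0 %% M))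
  (fun i s' => @time_le n M (adj_cell G) (coin_cell G w) search_prog _ isT).
have hN : prepared G w vBUD 0 %% M = budget e by rewrite hB modn_small // budget_lt.
rewrite [X in _ <= 1 + X * _]hN.
set lt := loop_time _ _ _ _ => h3.
rewrite -[time _ _ _ _ (PFor _ _ _) _]/(2 + lt).
rewrite -[time _ _ _ _ (vRES ::= _) _]/1.
by move: h1 h2 h3; rewrite -/n -/M -/e; lia.
Qed.

Lemma hamilton_run w : exists k m w',
  [/\ run Kc Sp k (Config [:: hamilton_prog] (digraph_code G) w) (Config [::] m w'),
      k <= step_factor n * (budget e).+1 &
      nth 0 m 0 = outcome G w].
Proof.
have M1 : 1 < M by rewrite -(expn0 2) ltn_exp2l // /log_mod.
have M256 : 256 <= M by rewrite (@leq_exp2l 2 8) // /log_mod; lia.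
have consts p : prog_consts_le 256 p -> prog_consts_le M p by apply: prog_consts_leW.
have in_le : all (fun v => v <= M) (digraph_code G).
  apply/allP => v; rewrite inE => /predU1P[->|/allpairsP[x [_ _ ->]]].
    apply: ltnW; apply: leq_trans (ltn_expl _ (isT : 1 < 2)) _.
    by rewrite leq_exp2l // /log_mod -/n; nia.
  by apply: leq_trans (leq_b1 _) (ltnW M1).
have [m1 r1 run1] := @init_correct n (prog_weight hamilton_prog) (digraph_code G) w
  n0 (size_digraph_code G) erefl in_le isT [:: Seq (compile main_prog) write_answer].
have [m2 r2 run2] := @compile_correct n (log_mod n) (prog_weight hamilton_prog) _ _ n0 M1
  main_prog _ m1 [:: write_answer] (drop (n * n) w) r1 isT isT
  (consts (compile main_prog) isT).
pose v := outcome G w.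
have evv : expr_eval m2 (compile_expr (!vRES)%A) = v.
  exact: (expr_eval_compile n0 r2 (e := (!vRES)%A) isT).
have le3 : all (fun v => v <= M) (set_nth 0 m2 0 v).
  apply/(all_nthP 0) => j _; rewrite nth_set_nth /=.
  case: ifP => _; last exact: all_nth0 (rep_le r2).
  by rewrite -evv; apply: all_nth0 (rep_le r2).
have size3 : size (set_nth 0 m2 0 v) <= mem_size n.
  by rewrite size_set_nth geq_max (rep_size r2) andbT /mem_size; nia.
pose k := 1 + (6 * (n * n) + 5 + (1 + (time n M (adj_cell G) (coin_cell G w)
  main_prog (fun _ _ => 0) + 1))).
exists k, (set_nth 0 m2 0 v), (drop (n * n) w); split.
- apply: (run_step_bounded n0 M1) => //; first by rewrite size_digraph_code /mem_size; nia.
    exact: consts.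
  rewrite /step; apply: run_trans run1 _.
  apply: (run_step n0 M1 r1) => //; first exact: consts.
  rewrite /step; apply: run_trans run2 _.
  apply: (run_step n0 M1 r2) => //; first exact: consts.
  rewrite -[step _]/(Config [::] (set_nth 0 m2 0
    (expr_eval m2 (compile_expr (!vRES)%A))) (drop (n * n) w)) evv; apply: run0.
  by apply: (space_used_le (erefl M) le3) _ _ _ size3.
- have := time_main_le w; rewrite /k /step_factor -/n -/M -/e; nia.
- by rewrite nth_set_nth.
Qed.

End Run.

Local Open Scope ring_scope.

Lemma budget_ratio (F : numFieldType) n (e : rel 'I_n) :
  (budget_num e)%:R / (budget_den e)%:R = \prod_u (2 - 2 * 2^-1 ^+ outdeg e u) :> F.
Proof.
rewrite !natr_prod -prodf_div; apply: eq_bigr => u _.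
rewrite natrM natrB ?expn_gt0 // !natrX exprVn; field.
by rewrite expf_neq0 ?pnatr_eq0.
Qed.

Lemma budget_den_gt0 n (e : rel 'I_n) : (0 < budget_den e)%N.
Proof. by rewrite prodn_gt0 // => u; rewrite expn_gt0. Qed.

Lemma budget_ge n (e : rel 'I_n) (b : 'S_n) :
  3 * ((2 * n + 1)%:R * rate e b 0) <= (budget e)%:R :> rat.
Proof.
have -> : rate e b 0 = (budget_num e)%:R / (budget_den e)%:R.
  rewrite budget_ratio /rate subn0 -[X in 2 ^+ X](card_ord n) -prodr_const.
  rewrite -big_split /=; apply: eq_big => u //= _.
  by rewrite /kept; ring.
have d0 : 0 < (budget_den e)%:R :> rat by rewrite ltr0n budget_den_gt0.
rewrite !mulrA ler_pdivrMr // -[3]/(3%:R) -!natrM ler_nat.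
have := ltn_ceil (budget_num e * (6 * n + 3)) (budget_den_gt0 e).
rewrite /budget => /ltnW; apply: leq_trans; lia.
Qed.

Lemma budget_le (R : realType) (d : R) (G : digraph) : avg_outdegree_le d G ->
  (budget (@adj G))%:R <=
    (6 * nvert G + 3)%:R * (2 - 2 * 2 `^ (- d)) ^+ nvert G + 1 :> R.
Proof.
case=> n0 hd; have arcsE : narcs G = (\sum_u outdeg (@adj G) u)%N.
  under eq_bigr => u _ do rewrite outdegE.
  rewrite pair_bigA /= /narcs -sum1_card big_mkcond; apply: eq_bigr => p _.
  by rewrite inE; case: (adj _ _).
have n0R : 0 < (nvert G)%:R :> R by rewrite ltr0n.
have := @prod_outdeg_le R _ (outdeg (@adj G)) d n0.
rewrite -arcsE -ler_pdivrMr // => /(_ hd); rewrite -budget_ratio => h.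
have d0 : 0 < (budget_den (@adj G))%:R :> R by rewrite ltr0n budget_den_gt0.
rewrite /budget -[X in X%:R]addn1 natrD lerD2r.
apply: (@le_trans _ _ ((budget_num (@adj G) * (6 * nvert G + 3))%:R / (budget_den (@adj G))%:R)).
  by rewrite ler_pdivlMr // -natrM ler_nat leq_divM.
by rewrite natrM mulrAC mulrC ler_wpM2l.
Qed.

(** Cost of a step, times [step_factor], times the polynomial factor of the budget; [6 * n + 5]
    absorbs the two additive units into the power, which is at least 1. *)
Definition time_factor (n : nat) : nat :=
  (prog_weight hamilton_prog * (log_mod n).+1 * step_factor n * (6 * n + 5))%N.

Lemma poly_mul (f g : nat -> nat) :
  (exists c k, forall n, f n <= c * n.+1 ^ k)%N ->
  (exists c k, forall n, g n <= c * n.+1 ^ k)%N ->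
  (exists c k, forall n, f n * g n <= c * n.+1 ^ k)%N.
Proof.
move=> [c [k hf]] [c' [k' hg]]; exists (c * c')%N, (k + k')%N => n.
by rewrite expnD mulnACA leq_mul.
Qed.

Lemma poly_add (f g : nat -> nat) :
  (exists c k, forall n, f n <= c * n.+1 ^ k)%N ->
  (exists c k, forall n, g n <= c * n.+1 ^ k)%N ->
  (exists c k, forall n, f n + g n <= c * n.+1 ^ k)%N.
Proof.
move=> [c [k hf]] [c' [k' hg]]; exists (c + c')%N, (k + k')%N => n.
rewrite mulnDl leq_add //; [apply: leq_trans (hf n) _|apply: leq_trans (hg n) _];
  by rewrite leq_mul2l leq_pexp2l ?leq_addl ?leq_addr ?orbT.
Qed.

Lemma poly_const (a : nat) : (exists c k, forall n, a <= c * n.+1 ^ k)%N.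
Proof. by exists a, 0%N => n; rewrite muln1. Qed.

Lemma poly_id : (exists c k, forall n, n <= c * n.+1 ^ k)%N.
Proof. by exists 1%N, 1%N => n; rewrite mul1n. Qed.

Lemma poly_log_mod : (exists c k, forall n, (log_mod n).+2 <= c * n.+1 ^ k)%N.
Proof. by exists 18%N, 2%N => n; rewrite /log_mod; nia. Qed.

Lemma poly_time_factor : (exists c k, forall n, time_factor n <= c * n.+1 ^ k)%N.
Proof.
apply: poly_mul; last first.
  by apply: poly_add; [apply: poly_mul; [apply: poly_const|apply: poly_id]|apply: poly_const].
apply: poly_mul.
  apply: poly_mul; first exact: poly_const.
  have [c [k h]] := poly_log_mod; exists c, k => n; apply: leq_trans (h n); exact: leqW.
have nn : (exists c k, forall n, n * n <= c * n.+1 ^ k)%N by apply: poly_mul; apply: poly_id.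
do 3 (apply: poly_add; last exact: static_time_poly).
by apply: poly_add; [apply: poly_mul => //; apply: poly_const|apply: poly_const].
Qed.

Lemma poly_space : (exists c k, forall n, mem_size n * (log_mod n).+2 <= c * n.+1 ^ k)%N.
Proof.
apply: poly_mul; last exact: poly_log_mod.
by exists 69%N, 2%N => n; rewrite /mem_size; nia.
Qed.

Lemma bigO_poly (R : realType) (T : nat -> nat) (f : R) (F : nat -> nat) : 0 <= f ->
  (exists c k, forall n, F n <= c * n.+1 ^ k)%N ->
  (forall n, (T n)%:R <= (F n)%:R * f ^+ n) -> bigOstar T (fun n => f ^+ n).
Proof.
move=> f0 [c [k hF]] hT; exists k; apply/eqO_exP.
(* For [n >= 1] one has [n.+1 <= 2 * n], whence the factor [2 ^ k]; the successor makes the constant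
   positive. *)
exists (c * 2 ^ k).+1%:R; first by rewrite /= ltr0n.
exists 1%N => // n /= n1.
rewrite ger0_norm ?ler0n // ger0_norm ?mulr_ge0 ?exprn_ge0 //.
apply: le_trans (hT n) _; rewrite [leRHS]mulrCA [leLHS]mulrC ler_wpM2l ?exprn_ge0 //.
rewrite -natrX -natrM ler_nat; apply: leq_trans (hF n) _.
rewrite mulSn; apply: leq_trans (leq_addl _ _).
rewrite -mulnA leq_mul2l -expnMn; apply/orP; right.
by case: (k) => // k'; rewrite leq_exp2r //; lia.
Qed.

Lemma two_minus_powR_ge1 (R : realType) (d : R) : 0 <= d -> 1 <= 2 - 2 `^ (- d) :> R.
Proof.
move=> d0; have : 2 `^ (- d) <= 2 `^ 0 :> R by rewrite ler_powR ?ler1n // oppr_le0.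
by rewrite powRr0; lra.
Qed.

Lemma run_le_time (R : realType) (d : R) (G : digraph) k :
  avg_outdegree_le d G -> 0 <= d ->
  (k <= step_factor (nvert G) * (budget (@adj G)).+1)%N ->
  ((k * (prog_weight hamilton_prog * (log_mod (nvert G)).+1))%N)%:R <=
    (time_factor (nvert G))%:R * (2 - 2 `^ (- d)) ^+ nvert G :> R.
Proof.
move=> hG d0 hk; have f1 := two_minus_powR_ge1 d0; set f := 2 - _ in f1 *.
set n := nvert G in hk *; have fn1 : 1 <= f ^+ n by rewrite exprn_ege1.
have hB : (budget (@adj G)).+1%:R <= (6 * n + 5)%:R * f ^+ n :> R.
  have := budget_le hG; rewrite -/n => hB.
  (* The base of the budget is relaxed to that of the statement, which is at least 1. *)
  have le_pow : (2 - 2 * 2 `^ (- d)) ^+ n <= f ^+ n.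
    have p0 : 0 <= 2 `^ (- d) :> R by apply: powR_ge0.
    by rewrite lerXn2r ?nnegrE /f; move: f1; rewrite /f; lra.
  have : (6 * n + 3)%:R * (2 - 2 * 2 `^ (- d)) ^+ n <= (6 * n + 3)%:R * f ^+ n :> R.
    by rewrite ler_wpM2l.
  rewrite -[X in X%:R <= _]addn1 !natrD; move: hB; rewrite !natrD; lra.
apply: (@le_trans _ _ ((step_factor n * (budget (@adj G)).+1 *
    (prog_weight hamilton_prog * (log_mod n).+1))%N)%:R).
  by rewrite ler_nat leq_mul2r hk orbT.
rewrite /time_factor; move: (prog_weight _) (step_factor n) (log_mod n).+1 => W a l.
have -> : (W * l * a * (6 * n + 5))%N%:R * f ^+ n = (a * (W * l))%N%:R * ((6 * n + 5)%:R * f ^+ n) :> R.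
  by rewrite mulrA -natrM; congr (_%:R * _); ring.
by rewrite mulnAC natrM ler_wpM2l.
Qed.

(** Ensures that tapes whose length is the time bound contain all [n * n] coins. *)
Lemma sq_le_time (R : realType) (d : R) n : 0 <= d ->
  ((n * n)%N)%:R <= (time_factor n)%:R * (2 - 2 `^ (- d)) ^+ n :> R.
Proof.
move=> d0; have f1 := two_minus_powR_ge1 d0.
apply: (@le_trans _ _ (time_factor n)%:R); last first.
  by rewrite ler_peMr // exprn_ege1.
have W0 : (0 < prog_weight hamilton_prog)%N by [].
have a0 : (0 < step_factor n)%N by rewrite /step_factor; lia.
rewrite ler_nat /time_factor; move: W0 a0; move: (prog_weight _) (step_factor n) => W a W0 a0.
apply: (@leq_trans (W * (log_mod n).+1 * a)); last by rewrite leq_pmulr // addn_gt0 orbT.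
apply: (@leq_trans (W * (log_mod n).+1)); last by rewrite leq_pmulr.
apply: (@leq_trans (log_mod n).+1); last by rewrite leq_pmull.
by rewrite /log_mod; lia.
Qed.

Lemma hamilton_accepts (G : digraph) T (w : T.-tuple bool) : (0 < nvert G)%N ->
  (forall k, k <= step_factor (nvert G) * (budget (@adj G)).+1 ->
    k * (prog_weight hamilton_prog * (log_mod (nvert G)).+1) <= T)%N ->
  runs_within hamilton_prog (digraph_code G) w T
    (mem_size (nvert G) * (log_mod (nvert G)).+2) /\
  accepts hamilton_prog (digraph_code G) w T = (outcome G w != 0%N).
Proof.
move=> n0 hT; have [k [m [w' [hrun hk hm]]]] := hamilton_run n0 w.
have K0 : (0 < prog_weight hamilton_prog * (log_mod (nvert G)).+1)%N by rewrite muln_gt0.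
have [h1 h2] := run_halts K0 hrun (hT k hk).
by split; [exact: h1|rewrite /accepts h2 -hm].
Qed.

(** The Hamiltonian cycle supplies the cycle cover for the greedy bound, and the program fails only
    on tapes whose number of blocks exceeds the budget. *)
Lemma error_bound (G : digraph) T : (0 < nvert G)%N -> (nvert G * nvert G <= T)%N ->
  hamiltonian G ->
  (2 * 2 ^ T <= 3 * #|[set w : T.-tuple bool | outcome G w != 0%N]%SET|)%N.
Proof.
move=> n0 nT ham; have [b [greedy _ hb]] := main_correct n0.
have [f hf] : exists f : 'S_(nvert G), forall u, @adj G u (f u).
  have /card_gt0P[f] := proj1 (hamiltonian_cycle_perms (Ordinal n0)) ham.
  by rewrite inE => /andP[/forallP hf _]; exists f.
have deg0 u : (0 < outdeg (@adj G) u)%N.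
  by apply/card_gt0P; exists (f u); rewrite inE.
have := markov_blocks deg0 (greedy (ex_intro _ f hf)) nT (ltn0Sn _) (budget_ge (@adj G) b).
set bad := [set w : T.-tuple bool | _]%SET.
set good := [set w : T.-tuple bool | _]%SET => hbad.
have sub : (#|~: good| <= #|bad|)%N.
  apply: subset_leq_card; apply/fintype.subsetP => w; rewrite !inE negbK ltnNge.
  apply: contraTN => hw; exact: hb.
have := cardsC good; rewrite card_tuple card_bool; lia.
Qed.

Lemma hamilton_monte_carlo (R : realType) (d : R) : 0 <= d ->
  directed_hamiltonicity_solves d hamilton_prog
    (fun n => Num.truncn ((time_factor n)%:R * (2 - 2 `^ (- d)) ^+ n : R))
    (fun n => mem_size n * (log_mod n).+2)%N.
Proof.
move=> d0 G hG; have [n0 _] := hG; set T := Num.truncn _.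
have f0 : 0 <= (time_factor (nvert G))%:R * (2 - 2 `^ (- d)) ^+ nvert G :> R.
  by rewrite mulr_ge0 // exprn_ge0 // (le_trans _ (two_minus_powR_ge1 d0)).
have hT k : (k <= step_factor (nvert G) * (budget (@adj G)).+1 ->
    k * (prog_weight hamilton_prog * (log_mod (nvert G)).+1) <= T)%N.
  by move=> hk; rewrite truncn_ge_nat //; apply: run_le_time.
have nT : (nvert G * nvert G <= T)%N by rewrite truncn_ge_nat //; apply: sq_le_time.
clearbody T; clear f0; have acc w := hamilton_accepts w n0 hT.
have p0 : 0 < 2 ^+ T :> rat by rewrite exprn_gt0.
have probE : accept_prob hamilton_prog (digraph_code G) T =
    #|[set w : T.-tuple bool | outcome G w != 0%N]%SET|%:R / 2 ^+ T.
  rewrite /accept_prob; congr (_%:R / _); apply: eq_card => w.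
  by rewrite !inE (acc w).2.
split=> [w|ham|nham].
- exact: (acc w).1.
- rewrite probE; have := error_bound n0 nT ham.
  move: #|_| (2 ^+ T) (natrX rat 2 T) p0 => A p; move: (2 ^ T)%N => p' pE p0.
  by rewrite -(ler_nat rat) !natrM pE ler_pdivlMr // => hA; lra.
(* There are no false positives: no tape is accepted. *)
- rewrite probE (_ : #|_| = 0%N) ?mul0r ?divr_ge0 //.
  have [b [_ h _]] := main_correct n0.
  by apply: eq_card0 => w; apply: contra_notF nham; rewrite inE; apply: h.
Qed.

Theorem theorem7 (R : realType) (d : R) :
  exists (P : prog) (T S : nat -> nat),
    [/\ directed_hamiltonicity_solves d P T S,
        bigOstar T (fun n => (2 - 2 `^ (- d)) ^+ n) &
        polynomially_bounded R S].
Proof.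
have [d0|d0] := leP 0 d; last first.
  (* For negative [d] the class of digraphs is empty, as average outdegrees are nonnegative. *)
  exists Skip, (fun=> 0%N), (fun=> 0%N); split.
  - move=> G [n0 hd]; have : 0 <= avg_outdegree R G by rewrite divr_ge0.
    by move=> h; have := le_lt_trans (le_trans h hd) d0; rewrite ltxx.
  - by exists 0%N; apply/eqO_exP; exists 1 => //; apply: filterE => n /=; rewrite normr0 mul1r.
  - by exists 0%N; apply/eqO_exP; exists 1 => //; apply: filterE => n /=; rewrite normr0 mul1r.
exists hamilton_prog, (fun n => Num.truncn ((time_factor n)%:R * (2 - 2 `^ (- d)) ^+ n : R)),
  (fun n => mem_size n * (log_mod n).+2)%N; split.
- exact: hamilton_monte_carlo.
- have f1 := two_minus_powR_ge1 d0.
  apply: bigO_poly poly_time_factor _ => [|n]; first exact: le_trans f1.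
  by rewrite truncn_le mulr_ge0 // exprn_ge0 // (le_trans _ f1).
(* Polynomial growth is the case of base 1. *)
- have [n|k hk] := @bigO_poly R (fun n => mem_size n * (log_mod n).+2)%N 1 _ ler01 poly_space.
    by rewrite expr1n mulr1.
  exists k; move: hk.
  rewrite (_ : (fun n => 1 ^+ n * n%:R ^+ k) = (fun n => n%:R ^+ k)) //.
  by apply: funext => n; rewrite expr1n mul1r.
Qed.
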